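(* Let $\tau$ be a Liouville number and let $0\le\beta\le1$. Then there exists a $C^\infty$ orientation-preserving diffeomorphism $f$ of the circle $S^1=\mathbb R/\mathbb Z$ with rotation number $\tau$ such that its unique invariant Borel probability measure $\mu$ satisfies: (1) $\underline d_\mu(x)=\beta$ and $\overline d_\mu(x)=1$ for $\mu$-almost every $x\in S^1$; (2) $\dim_H\mu=\underline{\dim}_B\,\mu=\beta$ and $\overline{\dim}_B\,\mu=1$.
   Context: An irrational number $\tau$ is a Liouville number if for every $n\ge1$ there exist integers $p,q$ with $q>1$ and $|\tau-p/q|<1/q^n$. The rotation number of an orientation-preserving circle homeomorphism $f$ is $\tau(f)=\pi(\lim_{|n|\to\infty}\frac1n(F^n(x)-x))$, where $F$ is a lift of $f$ to $\mathbb R$ and $\pi:\mathbb R\to\mathbb R/\mathbb Z$ the projection. For a Borel measure $\mu$ on $S^1$ (with its standard metric), $\underline d_\mu(x)=\liminf_{r\to0}\frac{\log\mu(B(x,r))}{\log r}$ and $\overline d_\mu(x)=\limsup_{r\to0}\frac{\log\mu(B(x,r))}{\log r}$, $B(x,r)$ the ball of radius $r$ about $x$. For a set $Z$, $\overline{\dim}_B Z$ and $\underline{\dim}_B Z$ are the $\limsup$ and $\liminf$ as $\varepsilon\to0$ of $\frac{\log N(Z,\varepsilon)}{\log(1/\varepsilon)}$, $N(Z,\varepsilon)$ being the least number of balls of diameter $\varepsilon$ covering $Z$; $\dim_H Z$ is the Hausdorff dimension. For a Borel probability measure $\mu$: $\dim_H\mu=\inf\{\dim_H Z:\mu(Z)=1\}$,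 $\underline{\dim}_B\mu=\lim_{\varepsilon\to0}\inf\{\underline{\dim}_B Z:\mu(Z)>1-\varepsilon\}$, $\overline{\dim}_B\mu=\lim_{\varepsilon\to0}\inf\{\overline{\dim}_B Z:\mu(Z)>1-\varepsilon\}$. *)

(* Defs.v *)
From HB Require Import structures.
From mathcomp Require Import all_boot all_order all_algebra.
From mathcomp Require Import all_classical all_reals all_analysis.
Set Implicit Arguments. Unset Strict Implicit. Unset Printing Implicit Defensive.
Import Order.TTheory GRing.Theory Num.Theory.
Import numFieldNormedType.Exports.
Local Open Scope classical_set_scope.
Local Open Scope ring_scope.

Section Defs.
Variable R : realType.

Definition liouville (tau : R) : Prop :=
  (~ exists (p q : int), q != 0 /\ tau = p%:~R / q%:~R) /\
  (forall n : nat, (1 <= n)%N ->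
     exists (p q : int), 1 < q /\ `|tau - p%:~R / q%:~R| < (q%:~R ^+ n)^-1).

(* S^1 = R/Z is modelled by its fundamental domain [0,1) *)
Definition circle : set R := [set x | 0 <= x < 1].

Definition cdist (x y : R) : R :=
  let t := (x - y) - (Num.floor (x - y))%:~R in Num.min t (1 - t).

Definition cball (x r : R) : set R := [set y | circle y /\ cdist x y < r].

Definition circ_proj (y : R) : R := y - (Num.floor y)%:~R.

Definition smooth_lift (F : R -> R) : Prop :=
  (forall (n : nat) (x : R), derivable (derive1n n F) x 1) /\
  (forall x, 0 < derive1 F x) /\
  (forall x, F (x + 1) = F x + 1).

Definition rotation_number_is (F : R -> R) (tau : R) : Prop :=
  exists rho : R,
    (forall x : R, (fun n : nat => (iter n F x - x) / n%:R) @ \oo --> rho) /\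
    exists k : int, rho - tau = k%:~R.

(* Borel probability measures on the circle: probabilities on R carried by [0,1) *)
Definition circle_prob (mu : probability R R) : Prop := mu circle = 1%E.

Definition circ_invariant (F : R -> R) (mu : probability R R) : Prop :=
  forall A : set R, measurable A -> A `<=` circle ->
    mu ((circ_proj \o F) @^-1` A `&` circle) = mu A.

Definition ldq (mu : probability R R) (x r : R) : \bar R :=
  if 0 < fine (mu (cball x r)) then (ln (fine (mu (cball x r))) / ln r)%:E
  else +oo%E.

Definition liminf0 (g : R -> \bar R) : \bar R :=
  ereal_sup [set ereal_inf [set g r | r in `]0, d[] | d in `]0, 1[].
Definition limsup0 (g : R -> \bar R) : \bar R :=
  ereal_inf [set ereal_sup [set g r | r in `]0, d[] | d in `]0, 1[].

Definition lower_local_dim (mu : probability R R) (x : R) : \bar R :=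
  liminf0 (ldq mu x).
Definition upper_local_dim (mu : probability R R) (x : R) : \bar R :=
  limsup0 (ldq mu x).

Definition covnum (Z : set R) (eps : R) : \bar R :=
  ereal_inf [set (size cs)%:R%:E | cs in [set cs : seq R |
     (forall c, c \in cs -> circle c) /\
     Z `<=` \bigcup_(c in [set c | c \in cs]) cball c (eps / 2)]].

Definition bq (Z : set R) (eps : R) : \bar R :=
  (ln (fine (covnum Z eps)) / ln eps^-1)%:E.

Definition upper_box_dim (Z : set R) : \bar R := limsup0 (bq Z).
Definition lower_box_dim (Z : set R) : \bar R := liminf0 (bq Z).

Definition cdiam (U : set R) : R := sup [set cdist x y | x in U & y in U].

Definition hausdorff_content (s d : R) (Z : set R) : \bar R :=
  ereal_inf [set (\sum_(0 <= i <oo) ((cdiam (U i)) `^ s)%:E)%E |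
     U in [set U : nat -> set R | (forall i, U i `<=` circle /\ cdiam (U i) <= d) /\
        Z `<=` \bigcup_i U i]].

Definition hausdorff_measure (s : R) (Z : set R) : \bar R :=
  ereal_sup [set hausdorff_content s d Z | d in `]0, +oo[].

Definition hausdorff_dim (Z : set R) : \bar R :=
  ereal_inf [set s%:E | s in [set s : R | 0 <= s /\ hausdorff_measure s Z = 0%E]].

Definition hausdorff_dim_meas (mu : probability R R) : \bar R :=
  ereal_inf [set hausdorff_dim Z | Z in [set Z | measurable Z /\ Z `<=` circle /\ mu Z = 1%E]].

Definition box_dim_meas (bd : set R -> \bar R) (mu : probability R R) : \bar R :=
  ereal_sup [set ereal_inf [set bd Z | Z in [set Z | measurable Z /\ Z `<=` circle /\
                                            (1 - e%:E < mu Z)%E]] | e in `]0, 1[].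

Definition lower_box_dim_meas := box_dim_meas lower_box_dim.
Definition upper_box_dim_meas := box_dim_meas upper_box_dim.

End Defs.

(* Main.v *)
(* Anosov-Katok construction, organised around the distribution function Phi of mu.
   Put Phi_0 = id and Phi_(n+1) = G_n o Phi_n, where G_n commutes with the rotation by
   p/q, p/q being an extremely good approximation of tau, and is a q-fold cover of a
   Moebius map of derivative between 1/l and l, with l = q^(1/theta_n - 1) and
   theta_n = max(beta, 1/(n+1)).  The conjugates F_n = Phi_n^-1 o (Phi_n + tau) satisfy
   |F_(n+1) - F_n| <= q^C |tau - p/q|, and since all their derivatives are polynomial
   in q, interpolation makes F_(n+1) - F_n small in C^k; so F_n converges to a smooth
   diffeomorphism F, and Phi o F = Phi + tau in the limit.

   As |Phi - Phi_n| <= 2/q_(n+1), an interval of length r has mass at most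
   C min(r l, 1/q) <= C r^theta_n, with C negligible against powers of q: this yields
   all lower bounds, and the exponent 1 at the scale r = 1/q.  Conversely, up to mass
   2^-n, mu sits on q intervals of length about q^(-1/theta_n), which bounds the
   Hausdorff and lower box dimensions and the lower local dimension by beta.  The upper
   local dimension is at most 1 almost everywhere for every measure, by Borel-Cantelli
   on dyadic intervals. *)

Require Import Defs.
From HB Require Import structures.
From mathcomp Require Import all_boot all_order all_algebra.
From mathcomp Require Import ring lra zify.
From mathcomp Require Import all_classical all_reals all_analysis.
From mathcomp Require Import measurable_realfun.
Set Implicit Arguments. Unset Strict Implicit. Unset Printing Implicit Defensive.
Import Order.TTheory GRing.Theory Num.Theory.
Import numFieldNormedType.Exports.
Local Open Scope classical_set_scope.
Local Open Scope ring_scope.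

(** * Calculus *)

Section Calculus.
Context {R : realType}.
Implicit Types f g : R -> R.

(** The Liouville property gives |tau - p/q| < q^(-N) for each N fixed in advance, so every constant
    of a stage has to be bounded by a power of q whose exponent is known before q. This is why
    theta_n stays positive even for beta = 0 (l must be polynomial in q), and why estimates are made
    for the whole family over q >= 2, a member being picked only afterwards. The exponent of l comes
    from balance: the Moebius cover puts mass about 1/q on intervals of length about 1/(q l), and
    1/q = (1/(q l))^theta means l = q^(1/theta - 1). The distortion of Phi_n enters every estimate;
    q_(n+1) is taken so large that its power 1/(n+1) exceeds it, and this loss of exponent vanishes
    in the limit. Only the commutation of G_n with the translation by p/q enters, so a fraction may
    be expanded to enlarge its denominator. The limit of the Phi_n is merely continuous: it is used
    through monotonicity, degree one and the semiconjugacy, while smoothness is obtained for F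
    alone. *)

Definition has_deriv f f' := forall x, is_derive x (1 : R) f (f' x).

Lemma has_deriv_continuous f f' : has_deriv f f' -> continuous f.
Proof.
by move=> h x; apply/differentiable_continuous/derivable1_diffP; case: (h x).
Qed.

Lemma has_deriv_eq f f' g : has_deriv f f' -> (forall x, f' x = g x) -> has_deriv f g.
Proof. by move=> h e x; rewrite -e. Qed.

Lemma has_deriv_ext f g f' : has_deriv f f' -> (forall x, f x = g x) -> has_deriv g f'.
Proof. by move=> h /funext <-. Qed.

Lemma has_derivD f f' g g' : has_deriv f f' -> has_deriv g g' ->
  has_deriv (fun x => f x + g x) (fun x => f' x + g' x).
Proof. by move=> hf hg x; apply: is_deriveD. Qed.

Lemma has_derivN f f' : has_deriv f f' -> has_deriv (fun x => - f x) (fun x => - f' x).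
Proof. by move=> hf x; apply: is_deriveN. Qed.

Lemma has_derivB f f' g g' : has_deriv f f' -> has_deriv g g' ->
  has_deriv (fun x => f x - g x) (fun x => f' x - g' x).
Proof. by move=> hf hg; apply: has_derivD => //; apply: has_derivN. Qed.

Lemma has_derivM f f' g g' : has_deriv f f' -> has_deriv g g' ->
  has_deriv (fun x => f x * g x) (fun x => f' x * g x + f x * g' x).
Proof.
move=> hf hg x; apply: is_derive_eq; first exact: is_deriveM.
by rewrite addrC /GRing.scale /= [g x * _]mulrC.
Qed.

Lemma has_deriv_cst (c : R) : has_deriv (fun=> c) (fun=> 0).
Proof. by move=> x; apply: is_derive_cst. Qed.

Lemma has_deriv_id : has_deriv (fun x => x) (fun=> 1).
Proof. by move=> x; apply: is_derive_id. Qed.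

Lemma has_deriv_comp f f' g g' : has_deriv f f' -> has_deriv g g' ->
  has_deriv (fun x => f (g x)) (fun x => f' (g x) * g' x).
Proof. by move=> hf hg x; apply: is_derive1_comp. Qed.

Lemma has_derivZ (c : R) f f' : has_deriv f f' -> has_deriv (fun x => c * f x) (fun x => c * f' x).
Proof.
by move=> hf; apply: (has_deriv_eq (has_derivM (has_deriv_cst c) hf)) => x; rewrite mul0r add0r.
Qed.

Lemma has_derivV f f' : (forall x, f x != 0) -> has_deriv f f' ->
  has_deriv (fun x => (f x)^-1) (fun x => - f' x * ((f x)^-1 * (f x)^-1)).
Proof.
move=> f0 hf x; apply: is_derive_eq; first exact: is_deriveV.
by rewrite /GRing.scale /= expr2 invfM; ring.
Qed.

Lemma has_deriv_MVT f f' (x y : R) : has_deriv f f' -> x <= y ->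
  exists2 c, x <= c <= y & f y - f x = f' c * (y - x).
Proof.
move=> hf xy.
have [|c cxy E] := @MVT_segment _ f f' x y xy (fun z _ => hf z).
  by apply: continuous_subspaceT; apply: has_deriv_continuous hf.
by exists c; rewrite -?in_itv.
Qed.

Lemma has_deriv_le f f' (a b x y : R) : has_deriv f f' ->
  (forall z, x <= z <= y -> a <= f' z <= b) -> x <= y ->
  a * (y - x) <= f y - f x <= b * (y - x).
Proof.
move=> hf hab xy; have [c cxy ->] := has_deriv_MVT hf xy.
have /andP[ha hb] := hab _ cxy.
by rewrite !ler_wpM2r// subr_ge0.
Qed.

Lemma has_deriv_lip f f' (C : R) : has_deriv f f' -> (forall z, `|f' z| <= C) ->
  forall x y, `|f x - f y| <= C * `|x - y|.
Proof.
move=> hf hC x y; wlog xy : x y / y <= x.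
  move=> H; have [/H//|/ltW/H] := leP y x; by rewrite distrC (distrC y).
have [c _ ->] := has_deriv_MVT hf xy.
by rewrite normrM ler_wpM2r.
Qed.

Lemma has_deriv_derive1 f f' : has_deriv f f' -> f^`()%classic = f'.
Proof. by move=> h; apply/funext => x; rewrite derive1E; case: (h x). Qed.

Lemma has_deriv_derivable f f' : has_deriv f f' -> forall x, derivable f x 1.
Proof. by move=> h x; case: (h x). Qed.

Lemma derivable_hd f : (forall x, derivable f x 1) -> has_deriv f f^`()%classic.
Proof. by move=> h x; rewrite derive1E; apply: derivableP. Qed.

(* Interpolation between sup norms: compare f' x with the slope of f on [x, x + t]. *)
Lemma landau f f' f'' (e B t : R) : has_deriv f f' -> has_deriv f' f'' -> 0 < t ->
  (forall x, `|f x| <= e) -> (forall x, `|f'' x| <= B) ->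
  forall x, `|f' x| <= 2 * e / t + B * t.
Proof.
move=> hf hf' t0 fe fB x.
have xt : x <= x + t by rewrite lerDl ltW.
have [c /andP[xc ct] E] := has_deriv_MVT hf xt.
rewrite addrAC subrr add0r in E.
have -> : f' x = (f (x + t) - f x) / t + (f' x - f' c).
  by rewrite E mulfK ?gt_eqF//; ring.
apply: (le_trans (ler_normD _ _)); apply: lerD.
  rewrite normrM normfV (gtr0_norm t0) ler_pM2r ?invr_gt0//.
  by rewrite (le_trans (ler_normB _ _))// mulr_natl mulr2n lerD.
rewrite (le_trans (has_deriv_lip hf' fB _ _))//.
rewrite ler_wpM2l//; first by apply: le_trans (fB x).
by rewrite distrC ger0_norm ?subr_ge0// lerBlDl.
Qed.

(** A slope of at least [c] gives injectivity, and with m = |y - f 0| / c the values at -m and m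
    enclose y, so that the intermediate value theorem applies. *)
Lemma has_deriv_bij f f' (c : R) : has_deriv f f' -> 0 < c -> (forall x, c <= f' x) ->
  exists g, cancel f g /\ cancel g f.
Proof.
move=> hf c0 hc.
have lo x y : x <= y -> c * (y - x) <= f y - f x.
  move=> xy; have [z _ ->] := has_deriv_MVT hf xy.
  by rewrite ler_wpM2r ?subr_ge0.
have inj : injective f.
  move=> x y; wlog xy : x y / x <= y.
    by move=> H; have [/H//|/ltW/H {}H e] := leP x y; exact/esym/H.
  move=> e; apply/le_anti; rewrite xy /=.
  by have := lo _ _ xy; rewrite e subrr pmulr_rle0// subr_le0.
have surj y : exists x, f x = y.
  pose m := `|y - f 0| / c.
  have m0 : 0 <= m by rewrite divr_ge0// ltW.
  have mc : c * m = `|y - f 0| by rewrite mulrC divfK ?gt_eqF.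
  have Nm : - m <= 0 by lra.
  have h1 := lo _ _ m0; have h2 := lo _ _ Nm.
  have [] := @IVT _ f (- m) m y.
  - lra.
  - by apply: continuous_subspaceT; apply: has_deriv_continuous hf.
  - rewrite subr0 mc in h1; rewrite sub0r opprK mc in h2.
    have := ler_norm (y - f 0); have := ler_norm (- (y - f 0)); rewrite normrN => *.
    rewrite ge_min le_max; apply/andP; split; apply/orP; [left|right]; lra.
  - by move=> x _ <-; exists x.
have [g gK] := choice surj.
by exists g; split => // x; apply: inj; rewrite gK.
Qed.

Lemma has_deriv_inv f f' g (c : R) : has_deriv f f' -> 0 < c -> (forall x, c <= f' x) ->
  cancel f g -> cancel g f -> has_deriv g (fun y => (f' (g y))^-1).
Proof.
move=> hf c0 hc fK gK y; rewrite -{1}(gK y).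
apply: is_derive_inverse (hf _) _.
- by near=> z; exact: fK.
- by near=> z; exact: (has_deriv_continuous hf).
- by rewrite gt_eqF// (lt_le_trans c0).
Unshelve. all: by end_near. Qed.

Lemma shift1_int (f : R -> R) : (forall x, f (x + 1) = f x + 1) ->
  forall x (k : int), f (x + k%:~R) = f x + k%:~R.
Proof.
move=> f1; have N (n : nat) y : f (y + n%:R) = f y + n%:R.
  elim: n y => [|n IH] y; first by rewrite !addr0.
  by rewrite -natr1 !addrA f1 IH.
move=> x [n|n]; first exact: N.
rewrite NegzE mulrNz /=.
by rewrite -[in RHS](subrK (n.+1%:R) x) N addrK.
Qed.

End Calculus.

(** * Moderate families of functions *)

Section Moderate.
Context {R : realType}.
Implicit Types f g : nat -> R -> R.

(** Starting at q = 2 lets constants be absorbed into the exponent: C <= 2^N <= q^N. *)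
Definition pbounded g :=
  exists N, forall q, (2 <= q)%N -> forall x, `|g q x| <= (q%:R : R) ^+ N.

(* Moderateness in the sense of Colombeau: the parameter q indexes a family of
   functions.  The class is stable under products, composition and inversion, which
   replaces explicit estimates of the derivatives of a conjugated rotation. *)
Fixpoint moderate k g : Prop := pbounded g /\
  if k is k'.+1 then
    exists g', (forall q, (2 <= q)%N -> has_deriv (g q) (g' q)) /\ moderate k' g'
  else True.

Lemma le_pow (q M N : nat) : (2 <= q)%N -> (M <= N)%N ->
  (q%:R : R) ^+ M <= q%:R ^+ N.
Proof. by move=> q2; apply: ler_weXn2l; rewrite ler1n; lia. Qed.

Lemma le_pow2 (q M : nat) : (2 <= q)%N -> 2 ^+ M <= (q%:R : R) ^+ M.
Proof. by move=> q2; rewrite lerXn2r ?nnegrE// ler_nat. Qed.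

Lemma pow2_unbounded (C : R) : exists N, C <= 2 ^+ N.
Proof.
exists (Num.bound `|C|).
apply: (@le_trans _ _ (Num.bound `|C|)%:R).
  by apply: le_trans (ler_norm _) _; apply/ltW/archi_boundP.
by rewrite -natrX ler_nat; apply/ltnW/ltn_expl.
Qed.

Lemma pbounded_ext f g : (forall q, (2 <= q)%N -> forall x, f q x = g q x) ->
  pbounded f -> pbounded g.
Proof. by move=> e [N h]; exists N => q q2 x; rewrite -e//; exact: h. Qed.

Lemma moderate_ext k f g : (forall q, (2 <= q)%N -> forall x, f q x = g q x) ->
  moderate k f -> moderate k g.
Proof.
case: k => [|k] e [hb h]; split => //; try exact: pbounded_ext hb.
have [g' [hg' mg']] := h; exists g'; split => // q q2.
by apply: has_deriv_ext (hg' _ q2) _; exact: e.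
Qed.

Lemma moderate_bounded k g : moderate k g -> pbounded g.
Proof. by case: k => [|k] []. Qed.

Lemma moderate_S k g : moderate k.+1 g -> moderate k g.
Proof.
elim: k g => [|k IH] g [hb [g' [hg mg]]]; split => //.
by exists g'; split => //; exact: IH.
Qed.

Lemma moderateD k f g : moderate k f -> moderate k g -> moderate k (fun q x => f q x + g q x).
Proof.
have bD f1 g1 : pbounded f1 -> pbounded g1 ->
    pbounded (fun q x => f1 q x + g1 q x).
  move=> [M hM] [N hN]; exists (maxn M N).+1 => q q2 x.
  rewrite (le_trans (ler_normD _ _))// exprS.
  have h2 : 2 <= (q%:R : R) by rewrite ler_nat.
  apply: (@le_trans _ _ (2 * q%:R ^+ maxn M N)).
    rewrite mulr_natl mulr2n; apply: lerD.
      by rewrite (le_trans (hM _ q2 x))// le_pow// leq_maxl.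
    by rewrite (le_trans (hN _ q2 x))// le_pow// leq_maxr.
  by rewrite ler_wpM2r// exprn_ge0.
elim: k f g => [|k IH] f g [bf hf] [bg hg]; split => //; try exact: bD.
have [f' [df mf]] := hf; have [g' [dg mg]] := hg.
exists (fun q x => f' q x + g' q x); split; last exact: IH.
by move=> q q2; apply: has_derivD; [exact: df|exact: dg].
Qed.

Lemma moderateM k f g : moderate k f -> moderate k g -> moderate k (fun q x => f q x * g q x).
Proof.
have bM f1 g1 : pbounded f1 -> pbounded g1 ->
    pbounded (fun q x => f1 q x * g1 q x).
  move=> [M hM] [N hN]; exists (M + N)%N => q q2 x.
  by rewrite normrM exprD ler_pM// ?hM ?hN.
elim: k f g => [|k IH] f g mf mg;
  have b := bM _ _ (moderate_bounded mf) (moderate_bounded mg); split => //.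
have [_ [f' [df mf']]] := mf; have [_ [g' [dg mg']]] := mg.
exists (fun q x => f' q x * g q x + f q x * g' q x); split.
  by move=> q q2; apply: has_derivM; [exact: df|exact: dg].
by apply: moderateD; apply: IH => //; exact: moderate_S.
Qed.

Lemma moderate_const k (c : nat -> R) (N : nat) :
  (forall q, (2 <= q)%N -> `|c q| <= q%:R ^+ N) -> moderate k (fun q => fun=> c q).
Proof.
elim: k c N => [|k IH] c N h;
  have b : pbounded (fun q => fun=> c q) by (exists N => q q2 _; exact: h).
  by split.
split => //.
exists (fun q => fun=> 0); split; first by move=> q _; exact: has_deriv_cst.
by apply: (IH _ 0%N) => q _; rewrite normr0 expr0.
Qed.

Lemma moderateN k f : moderate k f -> moderate k (fun q x => - f q x).
Proof.
move=> h; apply: (@moderate_ext _ (fun q x => -1 * f q x)).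
  by move=> q _ x; rewrite mulN1r.
by apply: moderateM => //; apply: (@moderate_const _ _ 0%N) => q _; rewrite normrN1.
Qed.

Lemma moderate_comp0 f (g : nat -> R -> R) :
  moderate 0 f -> moderate 0 (fun q x => f q (g q x)).
Proof. by move=> [[N h] _]; split => //; exists N => q q2 x; exact: h. Qed.

(** Only the derivative of [g] is asked to be moderate, since lifts of circle maps are themselves
    unbounded. *)
Lemma moderate_comp k f g g' : (forall q, (2 <= q)%N -> has_deriv (g q) (g' q)) ->
  moderate k.+1 f -> moderate k g' -> moderate k.+1 (fun q x => f q (g q x)).
Proof.
move=> dg; elim: k f => [|k IH] f mf mg.
  have [f' [df mf']] := mf.2.
  split; first by have [] := @moderate_comp0 f g (moderate_S mf).
  exists (fun q x => f' q (g q x) * g' q x); split.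
    by move=> q q2; apply: has_deriv_comp; [exact: df|exact: dg].
  by apply: moderateM => //; exact: moderate_comp0.
have [f' [df mf']] := mf.2.
split; first by have [] := @moderate_comp0 f g (conj (moderate_bounded mf) I).
exists (fun q x => f' q (g q x) * g' q x); split.
  by move=> q q2; apply: has_deriv_comp; [exact: df|exact: dg].
by apply: moderateM => //; apply: IH => //; exact: moderate_S.
Qed.

(** The derivative of 1/f is -f' (1/f)^2, a product of families already handled, so the analytic
    input is the bound of order 0, where the lower bound q^(-N) enters. *)
Lemma moderateV k f (N : nat) :
  (forall q, (2 <= q)%N -> forall x, (q%:R ^+ N)^-1 <= f q x) ->
  moderate k f -> moderate k (fun q x => (f q x)^-1).
Proof.
move=> lo; have f0 q x : (2 <= q)%N -> 0 < f q x.
  move=> q2; apply: lt_le_trans (lo _ q2 x).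
  by rewrite invr_gt0 exprn_gt0// ltr0n; lia.
have b0 : pbounded (fun q x => (f q x)^-1).
  exists N => q q2 x; rewrite ger0_norm; last by rewrite invr_ge0 ltW// f0.
  rewrite -[X in _ <= X]invrK lef_pV2 ?posrE ?f0 ?lo//.
  by rewrite invr_gt0 exprn_gt0// ltr0n; lia.
elim: k => [|k IH] mf; split => //.
have [_ [f' [df mf']]] := mf.
exists (fun q x => - f' q x * ((f q x)^-1 * (f q x)^-1)); split.
  by move=> q q2; apply: has_derivV; [move=> x; rewrite gt_eqF ?f0|exact: df].
by apply: moderateM; [exact: moderateN|apply: moderateM; apply: IH; exact: moderate_S].
Qed.

(** Bootstrap for the autonomous equation g' = w(g): if g' is moderate of order k, composing [w]
    with [g] gains one order. Inverse functions are such solutions, with w = 1/Phi'. *)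
Lemma moderate_ode k w g :
  (forall q, (2 <= q)%N -> has_deriv (g q) (fun x => w q (g q x))) ->
  (forall k, moderate k w) -> moderate k (fun q x => w q (g q x)).
Proof.
move=> dg mw; elim: k => [|k IH]; first exact: moderate_comp0.
exact: (moderate_comp dg).
Qed.

(** A single member is viewed as a constant family, so that the map built with the chosen q can be
    the data of the next stage, where a new q varies. *)
Lemma moderate_fix k g (q : nat) : (2 <= q)%N -> moderate k g -> moderate k (fun=> g q).
Proof.
move=> q2; elim: k g => [|k IH] g [[N hb] h].
  split => //.
  have [M hM] := pow2_unbounded (q%:R ^+ N).
  exists M => p p2 x; apply: le_trans (hb _ q2 x) _.
  by apply: le_trans hM _; exact: le_pow2.
split.
  have [M hM] := pow2_unbounded (q%:R ^+ N).
  exists M => p p2 x; apply: le_trans (hb _ q2 x) _.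
  by apply: le_trans hM _; exact: le_pow2.
have [g' [dg mg]] := h.
by exists (fun=> g' q); split; [move=> p _; exact: dg|exact: IH].
Qed.

Lemma moderate_derivable k g (q j : nat) : (2 <= q)%N -> moderate k g -> (j < k)%N ->
  forall x, derivable (derive1n j (g q)) x 1.
Proof.
move=> q2; elim: j k g => [|j IH] [|k] g // [_ [g' [dg mg]]] jk.
  by have := has_deriv_derivable (dg _ q2).
move=> x; rewrite /derive1n iterSr -/(derive1n j _) (has_deriv_derive1 (dg _ q2)).
exact: IH mg _ _.
Qed.

(* Interpolation: for a moderate family only the sup norm has to be estimated. *)
Lemma moderate_small g g' (k L : nat) :
  (forall q, (2 <= q)%N -> has_deriv (g q) (g' q)) -> (forall k, moderate k g') ->
  exists N, forall q, (2 <= q)%N ->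
    (forall x, `|g q x| <= (q%:R ^+ N)^-1) ->
    forall j, (j <= k)%N -> forall x, `|derive1n j (g q) x| <= (q%:R ^+ L)^-1.
Proof.
elim: k g g' => [|k IH] g g' dg mg.
  by exists L => q q2 h [|j]//= _ x; exact: h.
have [_ [g'' [dg' _]]] := mg 1%N.
(* [mg] supplies a second derivative for each order separately; uniqueness of the derivative makes
   them one function. *)
have mg'' k' : moderate k' g''.
  have [_ [h [dh mh]]] := mg k'.+1.
  apply: moderate_ext mh => q q2 x.
  by rewrite -(has_deriv_derive1 (dh _ q2)) (has_deriv_derive1 (dg' _ q2)).
have [N' hN'] := IH _ _ dg' mg''.
have [B hB] := moderate_bounded (mg'' 0%N).
(* With t = q^(-s) and |g| <= q^(-(N' + s + 2)), interpolation gives 2 q^(-(N' + 2)) + q^(-(N' +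
   1)), at most q^(-N') because 2/q^2 + 1/q <= 1 for q >= 2. *)
pose s := (B + N' + 1)%N.
exists (maxn L (N' + s + 2))%N => q q2 h [|j] jk x.
  rewrite (le_trans (h x))// lef_pV2 ?posrE ?exprn_gt0 ?ltr0n; try lia.
  by apply: le_pow => //; exact: leq_maxl.
rewrite /derive1n iterSr -/(derive1n j _) (has_deriv_derive1 (dg _ q2)).
apply: hN' => // {}x.
have q0 : 0 < (q%:R : R) by rewrite ltr0n; lia.
have p0 M : 0 < (q%:R : R) ^+ M by rewrite exprn_gt0.
have t0 : 0 < (q%:R ^+ s)^-1 :> R by rewrite invr_gt0.
have h' y : `|g q y| <= (q%:R ^+ (N' + s + 2))^-1.
  rewrite (le_trans (h y))// lef_pV2 ?posrE//.
  by apply: le_pow => //; exact: leq_maxr.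
apply: le_trans (landau (dg _ q2) (dg' _ q2) t0 h' (hB _ q2) x) _.
rewrite invrK /s !exprD expr1 !invfM.
set u := _ ^+ N'; set v := _ ^+ B; set w := (q%:R : R).
have u0 : 0 < u by exact: p0.
have v0 : 0 < v by exact: p0.
have w2 : 2 <= w by rewrite ler_nat.
have -> : 2 * (u^-1 * (v^-1 / u / w) * (w^-1 / w^+1)) * (v * u * w) +
   v * (v^-1 / u / w) = u^-1 * (2 / (w * w) + w^-1).
  by rewrite expr1; field; rewrite ?gt_eqF//; lra.
rewrite -[leRHS]mulr1 ler_pM2l ?invr_gt0//.
have wi : w^-1 <= 2^-1 by rewrite lef_pV2 ?posrE; lra.
have wi0 : 0 < w^-1 by rewrite invr_gt0; lra.
rewrite invfM; nra.
Qed.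

End Moderate.

(** * The building block *)

Section Moebius.
Context {R : realType}.
Implicit Types l x a : R.

(* tan (pi * mob l x) = l * tan (pi * x): the lift of a hyperbolic Moebius map of the
   circle, whose derivative for large l is a density concentrated near the integers. *)
Definition mob l x : R :=
  x + (pi^-1) * atan (((l - 1) * (sin (pi * x) * cos (pi * x))) *
                 (cos (pi * x) * cos (pi * x) + l * (sin (pi * x) * sin (pi * x)))^-1).

Definition mobden l x : R :=
  cos (pi * x) * cos (pi * x) + l * l * (sin (pi * x) * sin (pi * x)).

(** The Poisson kernel of the disc at radius (l - 1)/(l + 1) and angle 2 pi x. It equals l at the
    integers and 1/l midway between them. *)
Definition dmob l x : R := l * (mobden l x)^-1.

Lemma mulcs_id x : cos x * cos x + sin x * sin x = 1 :> R.
Proof. by rewrite -!expr2 cos2Dsin2. Qed.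

Lemma cs_gt0 (k x : R) : 0 < k -> 0 < cos x * cos x + k * (sin x * sin x).
Proof.
move=> k0; have := mulcs_id x; have := sqr_ge0 (cos x); have := sqr_ge0 (sin x).
rewrite !expr2; set C := cos x * _; set S := sin x * _; nra.
Qed.

Lemma has_deriv_sinpi : has_deriv (fun x => sin (pi * x)) (fun x => cos (pi * x) * pi).
Proof.
have := @has_deriv_comp R sin cos _ _ (fun x => is_derive_sin x) (has_derivZ pi (@has_deriv_id R)).
by move=> h; apply: (has_deriv_eq h) => x; rewrite mulr1.
Qed.

Lemma has_deriv_cospi : has_deriv (fun x => cos (pi * x)) (fun x => - sin (pi * x) * pi).
Proof.
have := @has_deriv_comp R cos (fun x => - sin x) _ _ (fun x => is_derive_cos x)
  (has_derivZ pi (@has_deriv_id R)).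
by move=> h; apply: (has_deriv_eq h) => x; rewrite mulr1.
Qed.

(** The argument of [atan] in [mob] is tan(A - B) with tan A = l t, tan B = t, t = tan(pi x),
    numerator and denominator being multiplied by cos^2 to remove the poles. For this quotient u/v,
    u^2 + v^2 = [mobden] and u' v - u v' = pi (l - [mobden]). *)
Lemma has_deriv_mob l : 0 < l -> has_deriv (mob l) (dmob l).
Proof.
move=> l0.
have hs := has_deriv_sinpi; have hc := has_deriv_cospi.
have hu := has_derivZ (l - 1) (has_derivM hs hc).
have hv := has_derivD (has_derivM hc hc) (has_derivZ l (has_derivM hs hs)).
have v0 x : cos (pi * x) * cos (pi * x) + l * (sin (pi * x) * sin (pi * x)) != 0.
  by rewrite gt_eqF// cs_gt0.
have hat := @has_deriv_comp R atan _ _ _ (fun x => is_derive1_atan x) (has_derivM hu (has_derivV v0 hv)).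
apply: (has_deriv_eq (has_derivD (@has_deriv_id R) (has_derivZ pi^-1 hat))) => x.
have pi0 : (pi : R) != 0 by rewrite gt_eqF// pi_gt0.
have w0 : mobden l x != 0.
  by rewrite gt_eqF// /mobden cs_gt0// mulr_gt0.
have e1 := mulcs_id (pi * x).
move: {v0} (v0 x) w0 e1; rewrite /dmob /mobden.
set c := cos _; set s := sin _.
set w := c * c + l * l * (s * s); set v := c * c + l * (s * s).
set u := (l - 1) * (s * c); move=> v0 w0 e1.
(* Inserting c^2 + s^2 = 1 makes this identity and the next homogeneous, within reach of [ring]. *)
have E1 : v * v + u * u = w.
  transitivity ((c * c + s * s) * w); last by rewrite e1 mul1r.
  by rewrite /u /v /w; ring.
set v' := _ + l * (_ + _); set u' := (l - 1) * (_ + _).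
have E2 : u' * v - u * v' = pi * (l - w).
  transitivity (pi * ((c * c + s * s) * (l * (c * c + s * s) - w))).
    by rewrite /u' /v' /v /u /w; ring.
  by rewrite e1 mul1r mulr1.
have -> : (1 + (u / v) ^+ 2)^-1 = v * v / w.
  by rewrite -E1; field; rewrite E1 w0 v0.
have -> : u' / v + u * (- v' * (v^-1 * v^-1)) = pi * (l - w) / (v * v).
  by rewrite -E2; field.
have F (P y z : R) : P != 0 -> y != 0 -> z != 0 ->
    1 + P^-1 * (z * z / y * (P * (l - y) / (z * z))) = l / y.
  by move=> P0 y0 z0; field; rewrite P0 y0 z0.
exact: F.
Qed.

Lemma mobden_ge1 l x : 1 <= l -> 1 <= mobden l x <= l * l.
Proof.
move=> l1; rewrite /mobden.
have := mulcs_id (pi * x); have := sqr_ge0 (cos (pi * x)).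
have := sqr_ge0 (sin (pi * x)); rewrite !expr2.
set C := cos _ * _; set S := sin _ * _ => S0 C0 e.
have L1 : 1 <= l * l by nra.
by apply/andP; split; nra.
Qed.

Lemma dmob_bounds l x : 1 <= l -> l^-1 <= dmob l x <= l.
Proof.
move=> l1; have /andP[d1 d2] := mobden_ge1 x l1; rewrite /dmob.
have l0 : 0 < l by lra.
apply/andP; split.
  by rewrite ler_pdivlMr ?ler_pdivrMl//; lra.
by rewrite ler_pdivrMr ?ler_peMr//; lra.
Qed.

Lemma mob0 l : mob l 0 = 0.
Proof. by rewrite /mob mulr0 sin0 mul0r mulr0 mul0r atan0 mulr0 addr0. Qed.

Lemma mobN l x : mob l (- x) = - mob l x.
Proof.
rewrite /mob mulrN sinN cosN opprD; congr (_ + _).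
by rewrite !mulNr !mulrN opprK mulNr atanN mulrN.
Qed.

Lemma mob1 l x : mob l (x + 1) = mob l x + 1.
Proof.
rewrite /mob mulrDr mulr1 sinDpi cosDpi !mulNr !mulrN !opprK.
by rewrite addrAC.
Qed.

Lemma mob_half l : mob l 2^-1 = 2^-1.
Proof. by rewrite /mob cos_pihalf mulr0 mulr0 mul0r atan0 mulr0 addr0. Qed.

Lemma mob_near l x : `|mob l x - x| <= 1.
Proof.
rewrite /mob addrAC subrr add0r normrM gtr0_norm ?invr_gt0 ?pi_gt0//.
set t := (X in atan X); have := atan_ltpi2 t; have := atan_gtNpi2 t.
have p0 := @pi_gt0 R => *.
rewrite ler_pdivrMl// mulr1 ler_norml; apply/andP; split; lra.
Qed.

Lemma mob_int l x (p : int) : mob l (x + p%:~R) = mob l x + p%:~R.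
Proof. exact: shift1_int (mob1 l) x p. Qed.

(** Jordan's inequality by concavity: [cos] decreases between the two mean value points, so if the
    mean slope on [0, x] is below 2, so is the one on [x, 1/2], and the value 1 at 1/2 gives the
    claim. *)
Lemma sinpi_ge x : 0 <= x <= 2^-1 -> 2 * x <= sin (pi * x).
Proof.
move=> /andP[x0 x2]; have p0 := @pi_gt0 R.
have hs : has_deriv (@sin R) cos by move=> z; apply: is_derive_sin.
have y0 : 0 <= pi * x by rewrite mulr_ge0// ltW.
have y2 : pi * x <= pi * 2^-1 by rewrite ler_wpM2l// ltW.
have [c /andP[c0 cy] Ec] := has_deriv_MVT hs y0.
have [d /andP[yd d2] Ed] := has_deriv_MVT hs y2.
rewrite sin_pihalf in Ed; rewrite sin0 !subr0 in Ec.
have cd : cos d <= cos c.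
  have [->//|cd] := eqVneq c d.
  apply/ltW; rewrite ltr_cos ?in_itv /=.
  - by rewrite lt_neqAle cd (le_trans cy yd).
  - apply/andP; split; lra.
  - apply/andP; split; lra.
have Z0 : 0 <= pi * 2^-1 - pi * x by lra.
have [h|h] := lerP 2 (cos c * pi); first by rewrite Ec mulrA ler_wpM2r.
suff : 1 - sin (pi * x) <= 1 - 2 * x by lra.
rewrite Ed; apply: (le_trans (ler_wpM2r Z0 cd)).
have -> : cos c * (pi * 2^-1 - pi * x) = (cos c * pi) * (2^-1 - x) by ring.
have -> : 1 - 2 * x = 2 * (2^-1 - x) by field.
by rewrite ler_wpM2r ?subr_ge0// ltW.
Qed.

(* On [a, 1/2] the derivative of [mob l] is at most 1 / (4 l x^2). *)
Lemma mob_gap l a : 1 <= l -> 0 < a <= 2^-1 ->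
  1 - 2 * mob l a <= (2 * l * a)^-1.
Proof.
move=> l1 /andP[a0 a2]; have l0 : 0 < l by lra.
(* The bound k / x^2 has primitive -k / x, so [mob l] + k / x does not increase from a to 1/2;
   comparing the end values gives the claim, as [mob l] fixes 1/2. *)
pose k := (4 * l)^-1.
have k0 : 0 < k by rewrite invr_gt0; lra.
have hf x : a <= x ->
    is_derive x (1 : R) (mob l + (k \*: (fun y : R => y^-1)))
      (dmob l x + k *: (- x ^- 2 *: 1)).
  move=> ax; have x0 : x != 0 by rewrite gt_eqF//; lra.
  apply: is_deriveD; first exact: has_deriv_mob.
  exact/is_deriveZ/is_deriveV.
have D x : x \in `]a, 2^-1[%R -> is_derive x (1 : R)
    (mob l + (k \*: (fun y : R => y^-1)))
    (dmob l x + k *: (- x ^- 2 *: (1 : R))).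
  by rewrite in_itv /= => /andP[ax _]; apply: hf; exact: ltW.
have C : {within `[a, 2^-1], continuous (mob l + (k \*: (fun y : R => y^-1)))}.
  apply: derivable_within_continuous => x; rewrite in_itv /= => /andP[ax _].
  by have [] := hf x ax.
have [c] := MVT_segment a2 D C.
rewrite in_itv /= => /andP[c1 c2].
have c0 : 0 < c by lra.
have dc : dmob l c <= k * (c * c)^-1.
  rewrite /dmob /k -invfM ler_pdivrMr; last first.
    by have /andP[] := mobden_ge1 c l1; lra.
  rewrite ler_pdivlMl; last by rewrite !mulr_gt0.
  have : 4 * (c * c) <= sin (pi * c) * sin (pi * c).
    have : 2 * c <= sin (pi * c) by apply: sinpi_ge; rewrite c2 ltW.
    by nra.
  rewrite /mobden; have := sqr_ge0 (cos (pi * c)); rewrite expr2.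
  by nra.
move=> E.
have {}E : (mob l 2^-1 + k * (2^-1)^-1) - (mob l a + k * a^-1) =
    (dmob l c + k * (- (c * c)^-1)) * (2^-1 - a).
  by move: E; rewrite /GRing.scale /= mulr1 expr2.
have : (mob l 2^-1 + k * (2^-1)^-1) - (mob l a + k * a^-1) <= 0.
  rewrite E -subr_ge0 sub0r -mulNr mulr_ge0//; lra.
rewrite mob_half.
have -> : (2 * l * a)^-1 = 2 * (k * a^-1).
  by rewrite /k; field; rewrite gt_eqF//= gt_eqF.
by rewrite invrK; nra.
Qed.

Lemma moderate_sincos k : moderate k (fun q x => sin (pi * (q%:R * x)) : R) /\
  moderate k (fun q x => cos (pi * (q%:R * x)) : R).
Proof.
have bs : pbounded (fun q x => sin (pi * (q%:R * x)) : R).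
  by exists 0%N => q _ x; rewrite expr0 sin_max.
have bc : pbounded (fun q x => cos (pi * (q%:R * x)) : R).
  by exists 0%N => q _ x; rewrite expr0 cos_max.
have mc k' : moderate k' (fun q => fun=> (pi : R) * q%:R).
  apply: (@moderate_const _ _ _ 3) => q q2.
  have p0 := @pi_gt0 R; have p4 : pi < 4 :> R by have := @pihalf_lt2 R; lra.
  have h2 : 2 <= (q%:R : R) by rewrite ler_nat.
  rewrite ger0_norm ?mulr_ge0//; last exact: ltW.
  have -> : (q%:R : R) ^+ 3 = (q%:R * q%:R) * q%:R by rewrite -expr2 -exprSr.
  by rewrite ler_wpM2r//; nra.
elim: k => [|k [IHs IHc]]; first by split; split.
split; split => //.
- exists (fun q x => cos (pi * (q%:R * x)) * (pi * q%:R)); split; last exact: moderateM.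
  move=> q _; have h := has_deriv_comp has_deriv_sinpi (has_derivZ q%:R (@has_deriv_id R)).
  by apply: (has_deriv_eq h) => x; rewrite mulr1 -mulrA.
- exists (fun q x => - sin (pi * (q%:R * x)) * (pi * q%:R)); split.
    move=> q _; have h := has_deriv_comp has_deriv_cospi (has_derivZ q%:R (@has_deriv_id R)).
    by apply: (has_deriv_eq h) => x; rewrite mulr1 -mulrA.
  by apply: moderateM => //; exact: moderateN.
Qed.

Lemma moderate_dmob k (l : nat -> R) (N : nat) :
  (forall q, (2 <= q)%N -> 1 <= l q <= q%:R ^+ N) ->
  moderate k (fun q x => dmob (l q) (q%:R * x)).
Proof.
move=> hl; have [ms mc] := moderate_sincos k.
have ml : moderate k (fun q => fun=> l q).
  apply: (@moderate_const _ _ _ N) => q q2; have /andP[h1 h2] := hl q q2.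
  by rewrite ger0_norm//; lra.
apply: moderateM => //; apply: (@moderateV _ _ _ 0%N).
  move=> q q2 x; rewrite expr0 invr1.
  by have /andP[h1 _] := hl q q2; have /andP[] := mobden_ge1 (q%:R * x) h1.
apply: moderateD; first exact: moderateM.
by apply: moderateM; exact: moderateM.
Qed.

(* The circle diffeomorphism [mob l] lifted through the covering x -> q x. *)
Definition gmob (q : nat) l x : R := q%:R^-1 * mob l (q%:R * x).

Lemma has_deriv_gmob (q : nat) l : (0 < q)%N -> 0 < l ->
  has_deriv (gmob q l) (fun x => dmob l (q%:R * x)).
Proof.
move=> q0 l0.
have h := has_derivZ (q%:R^-1) (has_deriv_comp (has_deriv_mob l0) (has_derivZ q%:R (@has_deriv_id R))).
apply: (has_deriv_eq h) => x; rewrite mulr1 mulrCA mulVf ?mulr1//.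
by rewrite pnatr_eq0; lia.
Qed.

(** The bound is independent of [l]: however strong the concentration, the conjugacies move by 1/q
    only. Their uniform convergence rests on this. *)
Lemma gmob_near (q : nat) l x : (0 < q)%N -> `|gmob q l x - x| <= q%:R^-1.
Proof.
move=> q0.
have -> : gmob q l x - x = q%:R^-1 * (mob l (q%:R * x) - q%:R * x).
  by rewrite mulrBr mulKf// pnatr_eq0; lia.
by rewrite normrM ger0_norm ?invr_ge0// ler_piMr ?invr_ge0// mob_near.
Qed.

Lemma gmob_shift (q : nat) l x (p : int) : (0 < q)%N ->
  gmob q l (x + p%:~R / q%:R) = gmob q l x + p%:~R / q%:R.
Proof.
move=> q0; have q0' : (q%:R : R) != 0 by rewrite pnatr_eq0; lia.
have e : q%:R * (x + p%:~R / q%:R) = q%:R * x + p%:~R by field.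
by rewrite /gmob e mob_int; field.
Qed.

End Moebius.

(** * Rational approximation with large denominators *)

Section Liouville.
Context {R : realType}.

(** The definition gives q > 1 without making q large. Applying it with exponent N (Q0 + 1) + 1 and
    expanding p/q to the denominator Q = q^(Q0 + 1) makes Q exceed [Q0], while the error stays below
    Q^(-N). *)
Lemma liouville_pow (tau : R) (N Q0 : nat) : liouville tau ->
  exists (P : int) (Q : nat), [/\ (Q0 < Q)%N, (2 <= Q)%N &
    `|tau - P%:~R / Q%:R| < (Q%:R ^+ N)^-1].
Proof.
move=> [_ h]; have [//|p [q [q1 hq]]] := h (N * Q0.+1).+1.
case: q q1 hq => // q q1 hq.
have q1' : (1 < q)%N by [].
exists (p * (q%:Z) ^+ Q0), (q ^ Q0.+1)%N; split.
- exact: ltnW (ltn_expl Q0.+1 q1').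
- by rewrite expnS; have := expn_gt0 q Q0; nia.
apply: (@lt_le_trans _ _ ((q%:R ^+ (N * Q0.+1).+1)^-1)).
  rewrite [X in `|tau - X|](_ : _ = p%:~R / q%:R)//.
  rewrite rmorphM rmorphXn /= natrX exprS.
  have q0 : (q%:R : R) != 0 by rewrite pnatr_eq0; lia.
  by rewrite -pmulrn; field; rewrite q0 expf_neq0.
rewrite natrX -exprM lef_pV2 ?posrE ?exprn_gt0 ?ltr0n//; try lia.
by apply: le_pow => //; lia.
Qed.

End Liouville.

(** * The inductive construction *)

Section Step.
Context {R : realType}.

(** The data carried through the induction. Moderateness of the constant family says that [phi'] is
    smooth with all derivatives bounded; [L] is the distortion that the next denominator has to
    beat. *)
Definition bilip_lift (phi : R -> R) (L : R) := 1 <= L /\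
  exists phi', [/\ has_deriv phi phi', forall x, L^-1 <= phi' x <= L,
    forall k, moderate k (fun=> phi'), forall x, phi (x + 1) = phi x + 1 & phi 0 = 0].

Definition lifted (tau : R) (phi F : R -> R) :=
  (forall x, phi (F x) = phi x + tau) /\
  exists2 F', has_deriv F F' & forall k, moderate k (fun=> F').

(** F = psi(Phi + tau), where the inverse psi of Phi solves psi' = w(psi) with w = 1/Phi'; this
    avoids formulas for the higher derivatives of the inverse. *)
Lemma lift_family (tau : R) (Phi Phi' : nat -> R -> R) (N : nat) :
  (forall q, (2 <= q)%N -> has_deriv (Phi q) (Phi' q)) ->
  (forall q, (2 <= q)%N -> forall x, (q%:R ^+ N)^-1 <= Phi' q x) ->
  (forall k, moderate k Phi') ->
  exists F F', [/\ forall q, (2 <= q)%N -> forall x, Phi q (F q x) = Phi q x + tau,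
    forall q, (2 <= q)%N -> has_deriv (F q) (F' q) & forall k, moderate k F'].
Proof.
move=> dPhi lo mPhi.
have p0 q : (2 <= q)%N -> 0 < (q%:R ^+ N)^-1 :> R.
  by move=> q2; rewrite invr_gt0 exprn_gt0// ltr0n; lia.
have [psi psiK] : {psi : nat -> R -> R & forall q, (2 <= q)%N ->
    cancel (Phi q) (psi q) /\ cancel (psi q) (Phi q)}.
  apply: (choice (P := fun q g => (2 <= q)%N -> cancel (Phi q) g /\ cancel g (Phi q))).
  move=> q; have [q2|] := boolP (2 <= q)%N; last by exists id.
  by have [g gK] := has_deriv_bij (dPhi _ q2) (p0 _ q2) (lo _ q2); exists g.
pose w q x := (Phi' q x)^-1.
have dpsi q : (2 <= q)%N -> has_deriv (psi q) (fun y => w q (psi q y)).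
  by move=> q2; have [h1 h2] := psiK _ q2; exact: has_deriv_inv (dPhi _ q2) (p0 _ q2) (lo _ q2) h1 h2.
have mw k : moderate k w by exact: moderateV lo (mPhi k).
have mpsi k := moderate_ode k dpsi mw.
have dPt q : (2 <= q)%N -> has_deriv (fun x => Phi q x + tau) (Phi' q).
  by move=> q2; apply: (has_deriv_eq (has_derivD (dPhi _ q2) (has_deriv_cst tau))) => x; rewrite addr0.
exists (fun q x => psi q (Phi q x + tau)).
exists (fun q x => w q (psi q (Phi q x + tau)) * Phi' q x); split.
- by move=> q q2 x; have [_ ->] := psiK _ q2.
- by move=> q q2; exact: has_deriv_comp (dpsi _ q2) (dPt _ q2).
- move=> k; apply: moderateM => //; apply: moderate_S.
  exact: (moderate_comp (f := fun q y => w q (psi q y)) dPt (mpsi _) (mPhi _)).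
Qed.

Lemma bilip_ge phi L : bilip_lift phi L -> forall x y, x <= y ->
  L^-1 * (y - x) <= phi y - phi x <= L * (y - x).
Proof.
by move=> [_ [phi' [d b _ _ _]]] x y; apply: has_deriv_le d _ => z _; exact: b.
Qed.

Lemma bilip_dist phi L : bilip_lift phi L -> forall x y,
  `|x - y| <= L * `|phi x - phi y|.
Proof.
move=> g x y; wlog xy : x y / y <= x.
  by move=> H; have [/H//|/ltW/H] := leP y x; rewrite distrC (distrC (phi _)).
have /andP[h _] := bilip_ge g xy; have L0 : 0 < L by case: g; lra.
have h0 : 0 <= x - y by rewrite subr_ge0.
have h1 : 0 <= phi x - phi y by apply: le_trans h; rewrite mulr_ge0// invr_ge0 ltW.
by rewrite !ger0_norm// -ler_pdivrMl.
Qed.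

(** The differences between the conjugates for q and F form a moderate family in q, so the exponent
    demanded by interpolation is known before the Liouville property provides q. The fraction p/q
    itself enters only the sup estimate. *)
Lemma conjugation_step (tau : R) (l : nat -> R) (e k Q0 : nat) (phi F : R -> R) (L : R) :
  liouville tau -> (forall q, (2 <= q)%N -> 1 <= l q <= q%:R ^+ e) ->
  bilip_lift phi L -> lifted tau phi F ->
  exists q, [/\ (Q0 < q)%N, (2 <= q)%N,
    bilip_lift (gmob q (l q) \o phi) (l q * L) &
    exists2 F1, lifted tau (gmob q (l q) \o phi) F1 &
      forall j, (j <= k)%N -> forall x,
        `|derive1n j (fun y => F1 y - F y) x| <= q%:R^-1].
Proof.
move=> lt hl gphi [Fphi [F' dF mF]].
have [L1 [phi' [dphi bphi mphi phi1 phi0]]] := gphi.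
have L0 : 0 < L by lra.
pose Phi q := gmob q (l q) \o phi.
pose Phi' q x := dmob (l q) (q%:R * phi x) * phi' x.
have dPhi q : (2 <= q)%N -> has_deriv (Phi q) (Phi' q).
  move=> q2; have q0 : (0 < q)%N by lia.
  have l0 : 0 < l q by have := hl q q2; lra.
  exact: has_deriv_comp (has_deriv_gmob q0 l0) dphi.
have mPhi k' : moderate k' Phi'.
  apply: moderateM => //; apply: moderate_S.
  apply: (moderate_comp (f := fun q x => dmob (l q) (q%:R * x)) (g := fun=> phi)
    (g' := fun=> phi')) => //.
  exact: moderate_dmob hl.
have [M hM] := pow2_unbounded L.
have LM q : (2 <= q)%N -> L <= q%:R ^+ M.
  by move=> q2; apply: le_trans hM _; exact: le_pow2.
have Phib q x : (2 <= q)%N -> (l q * L)^-1 <= Phi' q x <= l q * L.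
  move=> q2; have /andP[l1 _] := hl q q2.
  have /andP[d1 d2] := dmob_bounds (q%:R * phi x) l1.
  have /andP[b1 b2] := bphi x.
  have i1 : 0 < (l q)^-1 by rewrite invr_gt0; lra.
  have i2 : 0 < L^-1 by rewrite invr_gt0.
  by rewrite invfM; apply/andP; split; apply: ler_pM => //; lra.
have Philo q : (2 <= q)%N -> forall x, (q%:R ^+ (e + M))^-1 <= Phi' q x.
  move=> q2 x; have /andP[h _] := Phib q x q2; apply: le_trans h.
  have /andP[l1 l2] := hl q q2.
  have := LM _ q2 => LMq.
  rewrite lef_pV2 ?posrE ?mulr_gt0 ?exprn_gt0 ?ltr0n//; try lra; try lia.
  by rewrite exprD ler_pM//; lra.
have [G [G' [GPhi dG mG]]] := lift_family tau dPhi Philo mPhi.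
have gPhi q : (2 <= q)%N -> bilip_lift (Phi q) (l q * L).
  move=> q2; have /andP[l1 l2] := hl q q2; split; first by nra.
  exists (Phi' q); split.
  - exact: dPhi.
  - by move=> x; exact: Phib.
  - by move=> k'; exact: moderate_fix q2 (mPhi k').
  - move=> x; rewrite /Phi /= phi1.
    have := @gmob_shift R q (l q) (phi x) q; rewrite divff; last first.
      by rewrite pnatr_eq0; lia.
    by apply; lia.
  - by rewrite /Phi /= phi0 /gmob mulr0 mob0 mulr0.
pose D q x := G q x - F x.
have dD q : (2 <= q)%N -> has_deriv (D q) (fun x => G' q x - F' x).
  by move=> q2; apply: has_derivB => //; exact: dG.
have mD k' : moderate k' (fun q x => G' q x - F' x).
  by apply: moderateD => //; exact: moderateN.
have [N hN] := moderate_small k 1 dD mD.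
(* [N] is what interpolation demands; the remaining exponent pays for 2 l^2 L <= q^(2 e + M + 1). *)
have [p [q [qQ q2 hq]]] := liouville_pow (N + (e + e + M).+1) Q0 lt.
exists q; split => //; first exact: gPhi.
exists (G q).
  split; first exact: GPhi.
  by exists (G' q); [exact: dG|move=> k'; exact: moderate_fix q2 (mG k')].
suff C0 x : `|D q x| <= (q%:R ^+ N)^-1 by move=> j jk x; have := hN q q2 C0 j jk x; rewrite expr1.
apply: le_trans (bilip_dist (gPhi q q2) _ _) _.
rewrite GPhi// /Phi /= Fphi.
set u := phi x; set d := tau - p%:~R / q%:R.
have /andP[l1 l2] := hl q q2.
have q0 : (0 < q)%N by lia.
(* Commuting the cover with the translation by p/q leaves only terms of size l |d|. *)
have -> : u + tau = (u + d) + p%:~R / q%:R by rewrite /d; ring.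
rewrite gmob_shift//.
have -> : gmob q (l q) u + tau - (gmob q (l q) (u + d) + p%:~R / q%:R) =
    d - (gmob q (l q) (u + d) - gmob q (l q) u) by rewrite /d; ring.
have hG : `|gmob q (l q) (u + d) - gmob q (l q) u| <= l q * `|d|.
  have -> : `|d| = `|u + d - u| by congr `|_|; ring.
  have l0 : 0 < l q by lra.
  apply: (has_deriv_lip (has_deriv_gmob q0 l0)) => z.
  have /andP[d1 d2] := dmob_bounds (q%:R * z) l1.
  rewrite ger0_norm//; apply: le_trans d1.
  by rewrite invr_ge0 ltW.
have ht : `|d - (gmob q (l q) (u + d) - gmob q (l q) u)| <= (2 * l q) * `|d|.
  apply: (le_trans (ler_normB _ _)).
  by have := normr_ge0 d; nra.
have lL : 0 <= l q * L by rewrite mulr_ge0//; lra.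
apply: (le_trans (ler_wpM2l lL ht)).
have hc : l q * L * (2 * l q) <= q%:R ^+ (e + e + M).+1.
  have -> : l q * L * (2 * l q) = 2 * (l q * l q * L) by ring.
  rewrite exprS ler_pM//; first by rewrite !mulr_ge0//; lra.
    by rewrite ler_nat.
  by rewrite !exprD ler_pM ?LM// ?mulr_ge0//; try lra; rewrite ler_pM//; lra.
rewrite mulrA; apply: (le_trans (ler_wpM2r (normr_ge0 _) hc)).
move: hq => /ltW; rewrite -/d exprD invfM => hq.
have pp n : 0 < (q%:R : R) ^+ n by rewrite exprn_gt0// ltr0n.
by rewrite -ler_pdivlMl// mulrC.
Qed.

End Step.

(** * Limits of smooth functions *)

Section Limits.
Context {R : realType}.

(** The intervals of radius 2 c_n about u_n, n >= n0, meet pairwise, and the supremum of their left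
    ends lies in all of them. *)
Lemma geometric_limit (u c : nat -> R) (n0 : nat) :
  (forall n, 0 <= c n) -> (forall n, 2 * c n.+1 <= c n) ->
  (forall n, (n0 <= n)%N -> `|u n.+1 - u n| <= c n) ->
  exists l, forall n, (n0 <= n)%N -> `|l - u n| <= 2 * c n.
Proof.
move=> c0 c2 uc.
have H n k : (n0 <= n)%N -> `|u (n + k)%N - u n| <= 2 * c n - 2 * c (n + k)%N.
  move=> nn; elim: k => [|k IH]; first by rewrite addn0 !subrr normr0.
  rewrite addnS.
  have -> : u (n + k).+1 - u n = (u (n + k).+1 - u (n + k)%N) + (u (n + k)%N - u n).
    by ring.
  apply: (le_trans (ler_normD _ _)).
  have := uc (n + k)%N (leq_trans nn (leq_addr _ _)).
  by have := c2 (n + k)%N; lra.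
have ab n m : (n0 <= n)%N -> (n0 <= m)%N -> u n - 2 * c n <= u m + 2 * c m.
  move=> hn hm; have [nm|/ltnW mn] := leqP n m.
    have := H n (m - n)%N hn; rewrite subnKC// ler_norml => /andP[].
    by have := c0 m; lra.
  have := H m (n - m)%N hm; rewrite subnKC// ler_norml => /andP[].
  by have := c0 n; lra.
pose A := [set u n - 2 * c n | n in [set n | (n0 <= n)%N]].
exists (sup A) => n hn.
have l1 : u n - 2 * c n <= sup A.
  apply: ub_le_sup; last by exists n.
  by exists (u n + 2 * c n) => _ [m hm <-]; exact: ab.
have l2 : sup A <= u n + 2 * c n.
  apply: ge_sup; first by exists (u n - 2 * c n); exists n.
  by move=> _ [m hm <-]; exact: ab.
by rewrite ler_norml; apply/andP; split; lra.
Qed.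

(** The mean value theorem for f_m - f_n, with m arbitrarily large, shows that the difference
    quotients of g and f_n differ by at most c_n; Caratheodory's criterion then passes to the
    derivative. *)
Lemma has_deriv_lim (f f' : nat -> R -> R) (g g' : R -> R) (c : nat -> R) (n0 : nat) :
  (forall n, (n0 <= n)%N -> has_deriv (f n) (f' n)) ->
  (forall n x, (n0 <= n)%N -> `|g x - f n x| <= c n) ->
  (forall n x, (n0 <= n)%N -> `|g' x - f' n x| <= c n) ->
  (forall e, 0 < e -> exists2 n, (n0 <= n)%N & c n <= e) ->
  has_deriv g g'.
Proof.
move=> df gf gf' ce x.
have slope n z : (n0 <= n)%N -> `|(g z - g x) - (f n z - f n x)| <= c n * `|z - x|.
  move=> hn; have [->|zx] := eqVneq z x.
    by rewrite !subrr normr0 mulr0.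
  apply/ler_addgt0Pr => e e0.
  have d0 : 0 < `|z - x| by rewrite normr_gt0 subr_eq0.
  have [|m hm cm] := ce (e / (`|z - x| + 2)); first by rewrite divr_gt0//; lra.
  have h1 : `|(f m z - f n z) - (f m x - f n x)| <= (c m + c n) * `|z - x|.
    apply: (has_deriv_lip (has_derivB (df m hm) (df n hn))) => y.
    have -> : f' m y - f' n y = (g' y - f' n y) - (g' y - f' m y) by ring.
    apply: (le_trans (ler_normB _ _)).
    by have := gf' n y hn; have := gf' m y hm; lra.
  have -> : (g z - g x) - (f n z - f n x) = (g z - f m z) - (g x - f m x) +
      ((f m z - f n z) - (f m x - f n x)) by ring.
  apply: (le_trans (ler_normD _ _)).
  have h2 := ler_normB (g z - f m z) (g x - f m x).
  have := gf m z hm; have := gf m x hm.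
  have : c m * (`|z - x| + 2) <= e by rewrite -ler_pdivlMr//; lra.
  by nra.
apply/is_derive1_caratheodory.
exists (fun z => if z == x then g' x else (g z - g x) / (z - x)); split.
- move=> z; case: eqP => [->|/eqP zx]; first by rewrite !subrr mulr0.
  by rewrite divfK// subr_eq0.
- apply/cvgrPdist_le => e e0 /=; rewrite eqxx.
  have [|n hn cn] := ce (e / 3); first by rewrite divr_gt0.
  have /is_derive1_caratheodory [h [fh ch hx]] := df n hn x.
  have e3 : 0 < e / 3 by rewrite divr_gt0.
  move/cvgrPdist_le : ch => /(_ _ e3) ch.
  near=> z.
  have hz : `|h x - h z| <= e / 3 by near: z.
  case: eqP => [_|/eqP zx]; first by rewrite subrr normr0 ltW.
  have h3 : `|(g z - g x) / (z - x) - h z| <= c n.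
    have zx0 : z - x != 0 by rewrite subr_eq0.
    have -> : (g z - g x) / (z - x) - h z = ((g z - g x) - (f n z - f n x)) / (z - x).
      by rewrite fh; field.
    by rewrite normrM normfV ler_pdivrMr ?normr_gt0// slope.
  have -> : g' x - (g z - g x) / (z - x) =
    (g' x - f' n x) + (h x - h z) - ((g z - g x) / (z - x) - h z).
    by rewrite hx; ring.
  apply: (le_trans (ler_normB _ _)).
  have := ler_normD (g' x - f' n x) (h x - h z).
  by have := gf' n x hn; lra.
- by rewrite eqxx.
Unshelve. all: by end_near. Qed.

Definition smooth (f : R -> R) := forall j x, derivable (derive1n j f) x 1.

Lemma smooth_hd f j : smooth f -> has_deriv (derive1n j f) (derive1n j.+1 f).
Proof. by move=> s; apply: (derivable_hd (s j)). Qed.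

Lemma derive1nB f g j : smooth f -> smooth g ->
  derive1n j (fun x => f x - g x) = (fun x => derive1n j f x - derive1n j g x).
Proof.
move=> sf sg; elim: j => [//|j IH].
rewrite [LHS]/derive1n iterS -/(derive1n j _) IH.
exact: has_deriv_derive1 (has_derivB (smooth_hd j sf) (smooth_hd j sg)).
Qed.

Lemma lifted_smooth (tau : R) phi F : lifted tau phi F -> smooth F.
Proof.
move=> [_ [F' dF mF]] [|j] x; first exact: has_deriv_derivable dF x.
rewrite /derive1n iterSr -/(derive1n j _) (has_deriv_derive1 dF).
exact: (@moderate_derivable _ j.+1 (fun=> F') 2 j).
Qed.

(** Stage n controls the orders up to n + 1 only, so the j-th derivatives converge from stage j - 1
    on. The limits of all orders are chosen at once, as a function of the pair (j, x), and then
    identified as successive derivatives. *)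
Lemma smooth_lim (F : nat -> R -> R) (c : nat -> R) :
  (forall n, smooth (F n)) ->
  (forall n, 0 <= c n) -> (forall n, 2 * c n.+1 <= c n) ->
  (forall n j x, (j <= n.+1)%N ->
    `|derive1n j (F n.+1) x - derive1n j (F n) x| <= c n) ->
  exists2 G, smooth G & forall n j x, (j <= n.+1)%N ->
    `|derive1n j G x - derive1n j (F n) x| <= 2 * c n.
Proof.
move=> sF c0 c2 hF.
have [G hG] : {G : nat * R -> R & forall jx n, (jx.1 <= n.+1)%N ->
    `|G jx - derive1n jx.1 (F n) jx.2| <= 2 * c n}.
  apply: (choice (P := fun jx l => forall n, (jx.1 <= n.+1)%N ->
    `|l - derive1n jx.1 (F n) jx.2| <= 2 * c n)) => -[j x] /=.
  have [|l hl] := @geometric_limit (fun n => derive1n j (F n) x) c j.-1 c0 c2.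
    by move=> n jn; apply: hF; lia.
  by exists l => n jn; apply: hl; lia.
have small e : 0 < e -> forall n0, exists2 n, (n0 <= n)%N & 2 * c n <= e.
  move=> e0 n0.
  have [N hN] := pow2_unbounded (2 * c 0%N / e).
  exists (n0 + N)%N; first exact: leq_addr.
  have h n : 2 ^+ n * c n <= c 0%N.
    elim: n => [|n IH]; first by rewrite expr0 mul1r.
    rewrite exprSr -mulrA; apply: le_trans IH.
    by rewrite ler_wpM2l// exprn_ge0.
  have hm := h (n0 + N)%N.
  have p1 : 0 < 2 ^+ N :> R by rewrite exprn_gt0.
  have p2 : 2 ^+ N <= 2 ^+ (n0 + N) :> R by rewrite ler_weXn2l ?leq_addl// ler1n.
  rewrite ler_pdivrMr// in hN.
  have : 2 ^+ N * (2 * c (n0 + N)%N) <= 2 ^+ N * e.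
    by have := c0 (n0 + N)%N; nra.
  by rewrite ler_pM2l.
have dG j : has_deriv (fun x => G (j, x)) (fun x => G (j.+1, x)).
  apply: (@has_deriv_lim (fun n => derive1n j (F n)) (fun n => derive1n j.+1 (F n))
    _ _ (fun n => 2 * c n) j).
  - by move=> n _; exact: smooth_hd.
  - by move=> n x jn; apply: (hG (j, x)) => /=; lia.
  - by move=> n x jn; apply: (hG (j.+1, x)) => /=; lia.
  - by move=> e e0; exact: small.
have eG j : derive1n j (fun x => G (0%N, x)) = (fun x => G (j, x)).
  elim: j => [//|j IH].
  by rewrite /derive1n iterS -/(derive1n j _) IH (has_deriv_derive1 (dG j)).
exists (fun x => G (0%N, x)).
  by move=> j x; rewrite eG; exact: has_deriv_derivable (dG j) x.
by move=> n j x jn; rewrite eG; exact: (hG (j, x)).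
Qed.

End Limits.

(** * Iteration of the conjugation step *)

Section Construction.
Context {R : realType}.

(** Dependent choice over the states (q, L, Phi, F). The threshold [Q0] sees the stage already
    reached, so that growth conditions on the next denominator can be imposed later. *)
Lemma conjugation_sequence (tau : R) (E : nat -> R) (Q0 : nat -> nat -> R -> nat) :
  liouville tau -> (forall n, 1 <= E n) ->
  exists (q : nat -> nat) (L : nat -> R) (Phi F : nat -> R -> R),
  [/\ [/\ q 0%N = 1%N, L 0%N = 1, Phi 0%N = id & F 0%N = (fun x => x + tau)],
      forall n, bilip_lift (Phi n) (L n) /\ lifted tau (Phi n) (F n),
      forall n, (Q0 n (q n) (L n) < q n.+1)%N /\ (2 <= q n.+1)%N,
      forall n, Phi n.+1 = gmob (q n.+1) ((q n.+1)%:R `^ (E n - 1)) \o Phi n /\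
        L n.+1 = (q n.+1)%:R `^ (E n - 1) * L n &
      forall n j x, (j <= n.+1)%N ->
        `|derive1n j (F n.+1) x - derive1n j (F n) x| <= (q n.+1)%:R^-1].
Proof.
move=> lt E1.
pose S := (nat * R * (R -> R) * (R -> R))%type.
pose sq (s : S) := s.1.1.1; pose sL (s : S) := s.1.1.2.
pose sP (s : S) := s.1.2; pose sF (s : S) := s.2.
pose ok (s : S) := bilip_lift (sP s) (sL s) /\ lifted tau (sP s) (sF s).
pose rel n (s s' : S) := [/\ (Q0 n (sq s) (sL s) < sq s')%N, (2 <= sq s')%N,
  sP s' = gmob (sq s') ((sq s')%:R `^ (E n - 1)) \o sP s,
  sL s' = (sq s')%:R `^ (E n - 1) * sL s &
  forall j, (j <= n.+1)%N -> forall x,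
    `|derive1n j (fun y => sF s' y - sF s y) x| <= (sq s')%:R^-1].
have [nx hnx] : {nx : nat * S -> S & forall ns, ok ns.2 ->
    ok (nx ns) /\ rel ns.1 ns.2 (nx ns)}.
  apply: (choice (P := fun ns s' => ok ns.2 -> ok s' /\ rel ns.1 ns.2 s')).
  move=> [n s] /=; have [oks|] := pselect (ok s); last by exists s.
  have hl q : (2 <= q)%N -> 1 <= (q%:R : R) `^ (E n - 1) <= q%:R ^+ Num.bound (E n - 1).
    move=> q2; have q1 : 1 <= (q%:R : R) by rewrite ler1n; lia.
    have e0 : 0 <= E n - 1 by rewrite subr_ge0.
    rewrite -powR_mulrn ?ler0n// -[X in X <= _ <= _](powRr0 q%:R).
    by rewrite !ler_powR//; apply/ltW/archi_boundP.
  have [g lf] := oks.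
  have [q [qQ q2 gq [F1 lF1 hF1]]] := conjugation_step n.+1 (Q0 n (sq s) (sL s)) lt hl g lf.
  by exists (q, q%:R `^ (E n - 1) * sL s, gmob q (q%:R `^ (E n - 1)) \o sP s, F1).
pose s := fix s n : S := if n is n'.+1 then nx (n', s n')
  else (1%N, 1, id, fun x => x + tau).
have dF0 : has_deriv (fun x : R => x + tau) (fun=> 1).
  by apply: (has_deriv_eq (has_derivD (@has_deriv_id R) (has_deriv_cst tau))) => x; rewrite addr0.
have m1 k : moderate k (fun=> (fun=> 1 : R)).
  by apply: (@moderate_const _ _ (fun=> 1) 0%N) => q _; rewrite normr1 expr0.
have ok0 : ok (s 0%N).
  split; last by split => //; exists (fun=> 1).
  split; first exact: lexx.
  exists (fun=> 1); split => //; first exact: has_deriv_id.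
  by move=> x; rewrite invr1 /= /sL /= lexx.
have oks n : ok (s n).
  by elim: n => [//|n IH]; have [] := hnx (n, s n) IH.
have rels n : rel n (s n) (s n.+1) by have [] := hnx (n, s n) (oks n).
exists (sq \o s), (sL \o s), (sP \o s), (sF \o s); split => //=.
- by move=> n; have [] := rels n.
- by move=> n; have [] := rels n.
- move=> n j x jn; have [_ _ _ _ h] := rels n.
  have := h j jn x; rewrite derive1nB//; first exact: lifted_smooth (oks _).2.
  exact: lifted_smooth (oks _).2.
Qed.

End Construction.

(** * Measures on the circle *)

Section CdfMeasure.
Context {R : realType}.

Lemma cvg_dist_lt (f : R -> R) (x e : R) : continuous f -> 0 < e ->
  exists2 d, 0 < d & forall y, `|x - y| < d -> `|f x - f y| < e.
Proof.
move=> cf e0; have /cvgrPdist_lt/(_ _ e0)/nbhs_ballP[d /= d0 hd] := cf x.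
by exists d => // y xy; exact: hd.
Qed.

Section Clamp.
Variable Phi : R -> R.
Hypothesis Phi_nd : {homo Phi : x y / x <= y}.
Hypothesis Phi_c : continuous Phi.
Hypothesis Phi0 : Phi 0 = 0.
Hypothesis Phi1 : Phi 1 = 1.

Let clamp (x : R) : R := Phi (Num.min (Num.max x 0) 1).

Let clamp_nd : nondecreasing clamp.
Proof. by move=> x y xy; apply: Phi_nd; rewrite le_min2// le_max2. Qed.

Let clamp_rc : right_continuous clamp.
Proof.
move=> x; apply: cvg_at_right_filter.
have c : {for x, continuous (fun x : R => Num.min (Num.max x 0) 1)}.
  apply: continuous_min; last exact: cvg_cst.
  by apply: continuous_max; [exact: cvg_id|exact: cvg_cst].
have cP : {for Num.min (Num.max x 0) 1, continuous Phi} by exact: Phi_c.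
exact: (continuous_comp c cP).
Qed.

#[local] HB.instance Definition _ := isCumulative.Build R _ R clamp clamp_nd clamp_rc.

Let clampNy : clamp x @[x --> -oo] --> (0 : R).
Proof.
apply: (@cvg_trans _ ((fun=> 0 : R) @ -oo)); last exact: cvg_cst.
apply: near_eq_cvg; near=> x.
have x0 : x <= 0 by near: x; exact: nbhs_ninfty_le.
by rewrite /clamp max_r// min_l// Phi0.
Unshelve. all: by end_near. Qed.

Let clampy : clamp x @[x --> +oo] --> (1 : R).
Proof.
apply: (@cvg_trans _ ((fun=> 1 : R) @ +oo)); last exact: cvg_cst.
apply: near_eq_cvg; near=> x.
have x1 : 1 <= x by near: x; exact: nbhs_pinfty_ge.
by rewrite /clamp max_l ?min_r ?Phi1//; lra.
Unshelve. all: by end_near. Qed.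

#[local] HB.instance Definition _ :=
  isCumulativeBounded.Build R 0 1 clamp clampNy clampy.

Let lsf := lebesgue_stieltjes_measure clamp.
Let idTR : measurableTypeR R -> R := idfun.

#[local] HB.instance Definition _ :=
  @isMeasurableFun.Build _ _ _ _ idTR (@measurable_id _ _ setT).

Lemma cdf_measure : exists mu : probability R R,
  forall r, mu `]-oo, r]%classic = (Phi (Num.min (Num.max r 0) 1))%:E.
Proof.
exists (distribution lsf idTR) => r.
exact: cdf_lebesgue_stieltjes_id.
Qed.

(** Stieltjes masses are known for closed rays, whereas the arcs of [0, 1[ are half-open. Continuity
    of [Phi] excludes atoms: closed rays ending slightly before t already have almost the mass
    [Phi t]. *)
Lemma circle_measure : exists mu : probability R R,
  forall t : R, 0 <= t <= 1 -> mu `[0, t[%classic = (Phi t)%:E.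
Proof.
have [mu hmu] := cdf_measure; exists mu => t /andP[t0 t1].
have hm r : 0 <= r <= 1 -> mu `]-oo, r]%classic = (Phi r)%:E.
  by move=> /andP[r0 r1]; rewrite hmu max_l// min_l.
apply/eqP; rewrite eq_le; apply/andP; split.
  rewrite -(hm t) ?t0//; apply: le_measure; rewrite ?inE//.
  by move=> x /=; rewrite !in_itv /= => /andP[_ /ltW].
have [->|tn0] := eqVneq t 0; first by rewrite Phi0.
have tgt : 0 < t by rewrite lt_neqAle eq_sym tn0.
apply/lee_addgt0Pr => e e0.
have [d d0 hd] := cvg_dist_lt t Phi_c e0.
pose t' := Num.max 0 (t - d / 2).
have t'0 : 0 <= t' by rewrite le_max lexx.
have t't : t' < t by rewrite gt_max tgt /=; lra.
have td : `|t - t'| < d.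
  rewrite ger0_norm ?subr_ge0 ?ltW//.
  have : t - d / 2 <= t' by rewrite le_max lexx orbT.
  lra.
have h1 : Phi t <= Phi t' + e.
  by have := ler_norm (Phi t - Phi t'); have := hd _ td; lra.
apply: (@le_trans _ _ (Phi t' + e)%:E); first by rewrite lee_fin.
rewrite EFinD leeD2r// -(hm t'); last by rewrite t'0 /=; lra.
pose U := `]-oo, (0 : R)]%classic `|` `[0, t[%classic.
apply: (@le_trans _ _ (mu U)).
  apply: le_measure; rewrite ?inE//; first exact: measurableU.
  move=> x /=; rewrite !in_itv /= => xt; have [x0|x0] := lerP x 0; [left|right] => //.
  by rewrite /= in_itv /= (ltW x0) (le_lt_trans xt t't).
apply: le_trans (measureU2 _ _ _) _ => //.
have h0 : mu `]-oo, (0 : R)]%classic = 0%E by rewrite hm ?lexx ?ler01 ?Phi0.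
by rewrite [X in (X + _)%E]h0 add0e.
Qed.

End Clamp.

Lemma circleE : @circle R = `[0, 1[%classic.
Proof. by apply/seteqP; split => x; rewrite /circle /= in_itv. Qed.

Lemma measurable_circle : measurable (@circle R).
Proof. by rewrite circleE. Qed.

Lemma prob_circleI (mu : probability R R) (A : set R) : circle_prob mu ->
  measurable A -> mu (A `&` @circle R) = mu A.
Proof.
move=> mu1 mA.
have e : A = (A `&` @circle R) `|` (A `\` @circle R) by rewrite setUIDK.
have mC := measurable_circle.
have mI : measurable (A `&` @circle R) by exact: measurableI.
have mD : measurable (A `\` @circle R) by exact: measurableD.
have eU : mu A = (mu (A `&` @circle R) + mu (A `\` @circle R))%E.
  by rewrite {1}e; apply: measureU => //; rewrite setIACA setICr setI0.
rewrite eU.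
suff -> : mu (A `\` @circle R) = 0%E by rewrite adde0.
apply/eqP; rewrite -measure_le0.
have <- : mu (~` @circle R) = 0%E.
  by rewrite probability_setC// mu1 subee.
apply: le_measure; rewrite ?inE; [exact: mD|exact: measurableC|by move=> x []].
Qed.

Lemma circle_prob_unique (m1 m2 : probability R R) :
  circle_prob m1 -> circle_prob m2 ->
  (forall t : R, 0 <= t <= 1 -> m1 `[0, t[%classic = m2 `[0, t[%classic) ->
  forall A, measurable A -> m1 A = m2 A.
Proof.
move=> p1 p2 h A mA.
apply: (@measure_unique _ _ _ (@measurable_realfun.RGenInftyO.G R) (fun n => `]-oo, n%:R[%classic)) => //.
- exact: measurable_realfun.RGenInftyO.measurableE.
- move=> _ _ [x ->] [y ->]; exists (Num.min x y); apply/seteqP; split => z /=.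
    by rewrite !in_itv /= lt_min => -[-> ->].
  by rewrite !in_itv /= lt_min => /andP[-> ->].
- by move=> n; exists n%:R.
- rewrite -subTset => x _; exists (Num.bound `|x|) => //=.
  by rewrite in_itv /= (le_lt_trans (ler_norm x))// archi_boundP.
- move=> _ [x ->].
  have mI : measurable `]-oo, x[%classic by [].
  apply: (etrans (esym (prob_circleI p1 mI)) (etrans _ (prob_circleI p2 mI))).
  have -> : `]-oo, x[%classic `&` @circle R = `[0, Num.max 0 (Num.min x 1)[%classic.
    apply/seteqP; split => z; rewrite /circle /= !in_itv /= lt_max lt_min.
      by move=> [zx /andP[z0 z1]]; rewrite z0 zx z1 orbT.
    move=> /andP[z0 /orP[|/andP[]]]; last by rewrite z0.
    by rewrite ltNge z0.
  by apply: h; rewrite le_max lexx /= ge_max ler01 /= ge_min lexx orbT.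
- by move=> k; rewrite (le_lt_trans (probability_le1 _ _))// ltry.
Qed.

End CdfMeasure.

(** * Arcs and lifted distribution functions *)

Section Arcs.
Context {R : realType}.
Implicit Types (Phi : R -> R) (a b x : R).

(** The image in the circle of the interval [a, b[ of the line, so that arcs passing through 0 are
    treated like the others. *)
Definition carc a b : set R :=
  [set z | @circle R z /\ exists k : int, a <= z + k%:~R < b].

Lemma carc_shift a b (k : int) : carc (a + k%:~R) (b + k%:~R) = carc a b.
Proof.
apply/seteqP; split => z [cz [j /andP[h1 h2]]]; split => //.
  by exists (j - k); rewrite intrB; apply/andP; split; lra.
by exists (j + k); rewrite intrD; apply/andP; split; lra.
Qed.

Lemma int_small (k : int) x y : 0 <= x < 1 -> 0 <= y < 1 -> x = y + k%:~R :> R -> k = 0.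
Proof.
move=> hx hy e.
have h1 : (-1)%:~R < (k%:~R : R) by rewrite mulrNz; lra.
have h2 : (k%:~R : R) < 1%:~R by lra.
by rewrite !ltr_int in h1 h2; lia.
Qed.

Lemma carc_le1 a b : 0 <= a -> b <= 1 -> carc a b = `[a, b[%classic.
Proof.
move=> a0 b1; apply/seteqP; split => z; rewrite /= in_itv /=.
  move=> [/andP[z0 z1] [k /andP[h1 h2]]].
  have k0 : k = 0 by apply: (@int_small k (z + k%:~R) z); rewrite ?z0 //; lra.
  by move: h1 h2; rewrite k0 addr0 => -> ->.
move=> /andP[h1 h2]; split; first by rewrite /circle /=; lra.
by exists 0; rewrite addr0 h1 h2.
Qed.

Lemma carc_ge1 a b : 0 <= a < 1 -> 1 <= b <= a + 1 ->
  carc a b = `[a, 1[%classic `|` `[0, b - 1[%classic.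
Proof.
move=> /andP[a0 a1] /andP[b1 ba]; apply/seteqP; split => z; rewrite /= !in_itv /=.
  move=> [/andP[z0 z1] [k /andP[h1 h2]]].
  have [zk|zk] := ltrP (z + k%:~R) 1.
    left; have k0 : k = 0.
      by apply: (@int_small k (z + k%:~R) z); [lra|lra|].
    by move: h1 h2; rewrite k0 addr0 z1 andbT.
  right; have k0 : k - 1 = 0.
    apply: (@int_small (k - 1) (z + k%:~R - 1) z); [lra|lra|].
    by rewrite intrB; lra.
  have k1 : k = 1 by lia.
  by move: h2; rewrite k1 z0 /=; lra.
move=> [/andP[h1 h2]|/andP[h1 h2]]; split.
- by rewrite /circle /=; lra.
- by exists 0; rewrite addr0; lra.
- by rewrite /circle /=; lra.
- by exists 1; lra.
Qed.

Lemma itv_mass (nu : probability R R) Phi :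
  (forall t : R, 0 <= t <= 1 -> nu `[0, t[%classic = (Phi t)%:E) ->
  forall a b, 0 <= a -> a <= b -> b <= 1 -> nu `[a, b[%classic = (Phi b - Phi a)%:E.
Proof.
move=> h a b a0 ab b1.
pose A := `[(0 : R), a[%classic; pose B := `[a, b[%classic.
have e : `[0, b[%classic = A `|` B.
  apply/seteqP; split => z; rewrite /A /B /= !in_itv /=.
    by move=> /andP[z0 zb]; have [za|za] := ltrP z a; [left|right]; rewrite ?z0.
  by move=> [] /andP[h1 h2]; lra.
have hU : nu (A `|` B) = (nu A + nu B)%E.
  apply: measureU; [exact: measurable_itv|exact: measurable_itv|].
  apply/seteqP; split => z //=.
  by rewrite /A /B /= !in_itv /= => -[/andP[_ h1] /andP[h2 _]]; lra.
have hb : nu (A `|` B) = (Phi b)%:E by rewrite -e h//; lra.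
have ha : nu A = (Phi a)%:E by rewrite h//; lra.
by rewrite EFinB -hb -ha hU [X in (X - _)%E]addeC addeK// ha.
Qed.

Lemma carc_mass (nu : probability R R) Phi :
  (forall t : R, 0 <= t <= 1 -> nu `[0, t[%classic = (Phi t)%:E) ->
  (forall x, Phi (x + 1) = Phi x + 1) ->
  forall a b, a <= b <= a + 1 ->
  measurable (carc a b) /\ nu (carc a b) = (Phi b - Phi a)%:E.
Proof.
move=> h P1 a b /andP[ab ba].
wlog : a b ab ba / 0 <= a < 1.
  move=> H; have /andP[f1 f2] := floor_itv a; rewrite intrD in f2.
  rewrite -(carc_shift a b (- Num.floor a)).
  have -> : Phi b - Phi a = Phi (b + (- Num.floor a)%:~R) - Phi (a + (- Num.floor a)%:~R).
    by rewrite !(shift1_int P1); ring.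
  by apply: H; rewrite mulrNz; lra.
move=> /andP[a0 a1].
have [b1|b1] := lerP b 1.
  by rewrite carc_le1//; split => //; apply: itv_mass.
rewrite carc_ge1; [|lra|lra].
split; first exact: measurableU.
pose A := `[a, 1[%classic; pose B := `[(0 : R), b - 1[%classic.
have hU : nu (A `|` B) = (nu A + nu B)%E.
  apply: measureU; [exact: measurable_itv|exact: measurable_itv|].
  apply/seteqP; split => z //=.
  by rewrite /A /B /= !in_itv /= => -[/andP[h1 _] /andP[_ h2]]; lra.
rewrite hU /A /B.
have -> : nu `[a, 1[%classic = (Phi 1 - Phi a)%:E by apply: itv_mass => //; lra.
have -> : nu `[0, b - 1[%classic = (Phi (b - 1))%:E by apply: h; lra.
have := P1 (b - 1); rewrite subrK => ->.
have := P1 0; rewrite add0r => ->.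
have : nu `[0, 0[%classic = (Phi 0)%:E by apply: h; lra.
rewrite set_itvxx measure0 => -[<-].
by rewrite -EFinD; congr (_%:E); ring.
Qed.

(** Extended to the line as a map of degree one, to be compared with [Phi] along the orbits of a
    lift. *)
Definition circle_cdf (nu : probability R R) x : R :=
  (Num.floor x)%:~R + fine (nu `[0, x - (Num.floor x)%:~R[%classic).

Lemma circle_cdfE (nu : probability R R) : circle_prob nu ->
  forall t : R, 0 <= t <= 1 -> nu `[0, t[%classic = (circle_cdf nu t)%:E.
Proof.
move=> nu1 t /andP[t0 t1]; rewrite /circle_cdf.
move: t1; rewrite le_eqVlt => /orP[/eqP->|t1].
  by rewrite floor1 subrr set_itvxx measure0 /= addr0 -circleE.
have -> : Num.floor t = 0 by apply: floor_def; rewrite t0 add0r.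
by rewrite subr0 add0r fineK// fin_num_measure.
Qed.

Lemma circle_cdf1 (nu : probability R R) x : circle_cdf nu (x + 1) = circle_cdf nu x + 1.
Proof.
have e : Num.floor (x + 1) = Num.floor x + 1.
  by apply: floor_def; have := floor_itv x; rewrite !intrD; lra.
rewrite /circle_cdf e intrD.
have -> : x + 1 - ((Num.floor x)%:~R + 1%:~R) = x - (Num.floor x)%:~R by lra.
by rewrite addrAC.
Qed.

Lemma shift1_nd Phi : (forall x, Phi (x + 1) = Phi x + 1) ->
  (forall a b, a <= b <= a + 1 -> Phi a <= Phi b) -> {homo Phi : x y / x <= y}.
Proof.
move=> P1 h a b ab.
have /andP[f1 f2] := floor_itv (b - a); rewrite intrD in f2.
set k := Num.floor (b - a) in f1 f2.
have k0 : 0 <= (k%:~R : R) by rewrite ler0z /k floor_ge0; lra.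
have := h a (b - k%:~R) _.
have := shift1_int P1 (b - k%:~R) k; rewrite subrK => -> hh.
by have := hh ltac:(lra); lra.
Qed.

Lemma shift1_near Phi : (forall x, Phi (x + 1) = Phi x + 1) ->
  {homo Phi : x y / x <= y} -> Phi 0 = 0 -> forall x, `|Phi x - x| <= 1.
Proof.
move=> P1 nd P0 x.
have /andP[f1 f2] := floor_itv x; rewrite intrD in f2.
have h1 := nd _ _ f1.
have h2 : Phi x <= Phi ((Num.floor x)%:~R + 1) by apply: nd; lra.
have := shift1_int P1 0 (Num.floor x); rewrite P0 !add0r => e.
rewrite P1 e in h2; rewrite e in h1.
rewrite ler_norml; apply/andP; split; lra.
Qed.

End Arcs.

(** * Invariance and unique ergodicity *)

Section Dynamics.
Context {R : realType}.
Variables (tau : R) (Phi F Fi : R -> R).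
Hypothesis Phi_nd : {homo Phi : x y / x <= y}.
Hypothesis Phi1 : forall x, Phi (x + 1) = Phi x + 1.
Hypothesis Phi0 : Phi 0 = 0.
Hypothesis F_lt : {mono F : x y / x <= y}.
Hypothesis F1 : forall x, F (x + 1) = F x + 1.
Hypothesis FiK : cancel Fi F.
Hypothesis PhiF : forall x, Phi (F x) = Phi x + tau.

Lemma circ_proj_circle (x : R) : @circle R (circ_proj x).
Proof.
by have /andP[h1 h2] := floor_itv x; rewrite intrD in h2; rewrite /circle /circ_proj /=; lra.
Qed.

Lemma preimage_carc (a b : R) :
  (@circ_proj R \o F) @^-1` (carc (F a) (F b)) `&` @circle R = carc a b.
Proof.
have FM := shift1_int F1.
have F_ltm := leW_mono F_lt.
apply/seteqP; split => z /=.
  move=> [[_ [k hk]] cz]; split => //; exists (k - Num.floor (F z)).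
  rewrite -[a <= _]F_lt -[_ < b]F_ltm FM intrB.
  by move: hk; rewrite /circ_proj => hk; rewrite [_ + (_ - _)]addrA addrAC.
move=> [cz [k hk]]; split => //; split; first exact: circ_proj_circle.
exists (k + Num.floor (F z)); move: hk; rewrite -[a <= _]F_lt -[_ < b]F_ltm FM intrD.
by rewrite /circ_proj => hk; lra.
Qed.

Lemma measurable_proj : measurable_fun setT (@circ_proj R \o F).
Proof.
have mF : measurable_fun setT F.
  by apply: nondecreasing_measurable => // x y xy; rewrite F_lt.
apply: measurable_funB => //.
apply: nondecreasing_measurable => // x y xy.
by rewrite ler_int le_floor// F_lt.
Qed.

Lemma carc01 (t : R) : 0 <= t <= 1 -> `[0, t[%classic = carc 0 t.
Proof. by move=> /andP[_ t1]; rewrite carc_le1. Qed.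

(** The push-forward of mu is a probability, hence determined by the arcs [0, t[. Their preimages
    are the arcs from [Fi 0] to [Fi t], of mass Phi (Fi t) - Phi (Fi 0) = Phi t by the
    semiconjugacy. *)
Lemma cdf_invariant (mu : probability R R) : circle_prob mu ->
  (forall t : R, 0 <= t <= 1 -> mu `[0, t[%classic = (Phi t)%:E) ->
  circ_invariant F mu.
Proof.
move=> mu1 hmu A mA AC.
have mg := measurable_proj.
pose g := @circ_proj R \o F.
have mgi B : measurable B -> measurable (g @^-1` B).
  by move=> mB; rewrite -[X in measurable X]setTI; exact: mg.
pose g' : {mfun R >-> R} := HB.pack g (isMeasurableFun.Build _ _ _ _ g mg).
pose nu : probability R R := distribution mu g'.
rewrite (prob_circleI mu1 (mgi _ mA)).
suff H : nu A = mu A by [].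
apply: circle_prob_unique mA => //.
  rewrite /circle_prob.
  have -> : nu (@circle R) = mu setT.
    congr (mu _); apply/seteqP; split => // x _; exact: circ_proj_circle.
  exact: probability_setT.
move=> t ht; rewrite (hmu t ht).
rewrite [LHS](_ : _ = mu (g @^-1` `[0, t[%classic))//.
have := prob_circleI mu1 (mgi `[0, t[%classic (measurable_itv _)) => <-.
rewrite (carc01 ht) -{1}(FiK 0) -{1}(FiK t) preimage_carc.
have hab : Fi 0 <= Fi t <= Fi 0 + 1.
  by rewrite -F_lt -[X in _ && X]F_lt F1 !FiK add0r.
have [_ ->] := carc_mass hmu Phi1 hab.
have e1 := PhiF (Fi t); have e2 := PhiF (Fi 0); rewrite FiK in e1; rewrite FiK Phi0 in e2.
by congr (_%:E); lra.
Qed.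

Lemma iter_conj (N : R -> R) (c : R) : (forall x, N (F x) = N x + c) ->
  forall n x, N (iter n F x) = N x + n%:R * c.
Proof.
move=> h; elim=> [|n IH] x; first by rewrite mul0r addr0.
by rewrite iterS h IH -natr1 mulrDl mul1r addrA.
Qed.

(** Phi is within 1 of the identity, so F^n x - x differs by at most 2 from Phi (F^n x) - Phi x = n
    tau. *)
Lemma rotation_lift : rotation_number_is F tau.
Proof.
exists tau; split; last by exists 0; rewrite subrr.
move=> x; apply/cvgrPdist_le => e e0.
near=> n.
have n0 : 0 < (n%:R : R) by rewrite ltr0n; near: n; exact: nbhs_infty_gt.
have -> : tau - (iter n F x - x) / n%:R = (n%:R * tau - (iter n F x - x)) / n%:R.
  by field; lra.
rewrite normrM normfV (gtr0_norm n0) ler_pdivrMr//.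
have h := iter_conj PhiF n x.
have h1 := shift1_near Phi1 Phi_nd Phi0 x.
have h2 := shift1_near Phi1 Phi_nd Phi0 (iter n F x).
apply: (@le_trans _ _ 2).
  have -> : n%:R * tau - (iter n F x - x) =
     (Phi (iter n F x) - iter n F x) - (Phi x - x) by rewrite h; ring.
  by apply: (le_trans (ler_normB _ _)); lra.
rewrite mulrC -ler_pdivrMr//; near: n.
exact: nbhs_infty_ger.
Unshelve. all: by end_near. Qed.

(** Exponent 2 gives d = Q tau - P with |d| < 1/Q < b - a, and irrationality gives d <> 0; steps of
    length |d| from an integer cannot jump over ]a, b[. *)
Lemma dense_orbit (a b : R) : liouville tau -> a < b ->
  exists (n : nat) (m : int), a < n%:R * tau + m%:~R < b.
Proof.
move=> lt ab.
have ba : 0 < b - a by lra.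
have [P [Q [QQ Q2 hPQ]]] := liouville_pow 2 (Num.bound (b - a)^-1) lt.
have Q0 : 0 < (Q%:R : R) by rewrite ltr0n; lia.
pose d := Q%:R * tau - P%:~R.
have dn0 : d != 0.
  apply/negP => /eqP d0; case: lt => irr _; apply: irr.
  exists P, (Q%:Z); split; first by lia.
  rewrite -pmulrn; move: d0; rewrite /d => d0.
  have -> : P%:~R = Q%:R * tau by lra.
  by field; lra.
have dab : `|d| < b - a.
  have -> : d = Q%:R * (tau - P%:~R / Q%:R) by rewrite /d; field; lra.
  rewrite normrM (gtr0_norm Q0).
  have h1 : (b - a)^-1 < Q%:R.
    apply: (@lt_trans _ _ (Num.bound (b - a)^-1)%:R); last by rewrite ltr_nat.
    by apply: archi_boundP; rewrite invr_ge0 ltW.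
  have h2 : Q%:R^-1 < b - a by rewrite -[X in _ < X]invrK ltf_pV2 ?posrE ?invr_gt0.
  apply: lt_trans h2; rewrite -ltr_pdivlMl// -invfM -expr2.
  exact: hPQ.
have orb (k : nat) (m : int) :
    k%:R * d + m%:~R = (k * Q)%:R * tau + (m - P * k%:Z)%:~R.
  by rewrite /d natrM intrB intrM -pmulrn; ring.
have [dpos|dneg] := ltrP 0 d.
  pose m := Num.floor a; have /andP[m1 m2] := floor_itv a.
  pose k := (Num.truncn ((a - m%:~R) / d)).+1.
  have x0 : 0 <= (a - m%:~R) / d by apply: divr_ge0; lra.
  have /andP[k1 k2] := truncn_itv x0.
  exists (k * Q)%N, (m - P * k%:Z); rewrite -orb.
  rewrite -/k ltr_pdivrMr// in k2; rewrite ler_pdivlMr// in k1.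
  have : k%:R * d = (Num.truncn ((a - m%:~R) / d))%:R * d + d.
    by rewrite /k -natr1 mulrDl mul1r.
  rewrite (gtr0_norm dpos) in dab.
  by move=> e; apply/andP; split; lra.
(* Only forward orbits are available, so for d < 0 one descends from the integer just above b. *)
have dneg' : 0 < - d by rewrite oppr_gt0 lt_neqAle dn0.
pose m := Num.floor b + 1; have /andP[m1 m2] := floor_itv b; rewrite -/m in m2.
pose k := (Num.truncn ((m%:~R - b) / (- d))).+1.
have x0 : 0 <= (m%:~R - b) / (- d) by apply: divr_ge0; lra.
have /andP[k1 k2] := truncn_itv x0.
exists (k * Q)%N, (m - P * k%:Z); rewrite -orb.
rewrite -/k ltr_pdivrMr// in k2; rewrite ler_pdivlMr// in k1.
have : k%:R * d = (Num.truncn ((m%:~R - b) / (- d)))%:R * d + d.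
  by rewrite /k -natr1 mulrDl mul1r.
rewrite (ler0_norm dneg) in dab.
by move=> e; apply/andP; split; lra.
Qed.

(* Both N and Phi semiconjugate F to the rotation, so they agree on the orbit of 0,
   which is ordered by Phi as a dense subset of the line. *)
Lemma cdf_unique (nu : probability R R) : liouville tau -> circle_prob nu ->
  circ_invariant F nu -> forall x, circle_cdf nu x = Phi x.
Proof.
move=> lt nu1 inv; pose N := circle_cdf nu.
have N1 : forall x, N (x + 1) = N x + 1 by exact: circle_cdf1.
have hN := circle_cdfE nu1.
have am a b : a <= b <= a + 1 -> nu (carc a b) = (N b - N a)%:E.
  by move=> hab; have [] := carc_mass hN N1 hab.
have Nnd : {homo N : x y / x <= y}.
  apply: shift1_nd => // a b hab; rewrite -subr_ge0 -lee_fin -am//.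
have N0 : N 0 = 0.
  by apply: EFin_inj; rewrite -hN ?lexx ?ler01// set_itvxx measure0.
have Fab a b : a <= b <= a + 1 -> F a <= F b <= F a + 1.
  by rewrite -(F1 a) !F_lt.
have Nc a b : a <= b <= a + 1 -> N (F b) - N (F a) = N b - N a.
  move=> hab; apply: EFin_inj; rewrite -!am ?Fab// -(preimage_carc a b).
  apply/esym/inv; first by have [] := carc_mass hN N1 (Fab _ _ hab).
  by move=> z [].
pose c := N (F 0) - N 0.
have NF x : N (F x) = N x + c.
  have /andP[f1 f2] := floor_itv x; rewrite intrD in f2.
  have : N (F (x + (- Num.floor x)%:~R)) - N (F 0) = N (x + (- Num.floor x)%:~R) - N 0.
    by apply: Nc; rewrite mulrNz; lra.
  by rewrite (shift1_int F1) !(shift1_int N1) /c; lra.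
have Nnear := shift1_near N1 Nnd N0.
have Pnear := shift1_near Phi1 Phi_nd Phi0.
(* N and Phi stay within 1 of the identity and grow by n c and n tau over n steps of the orbit of 0;
   a bounded difference forces c = tau. *)
have ct : c = tau.
  apply/eqP/negPn/negP => ctn.
  have d0 : 0 < `|c - tau| by rewrite normr_gt0 subr_eq0.
  pose n := Num.bound (2 / `|c - tau|).
  have hn : 2 / `|c - tau| < n%:R by apply: archi_boundP; rewrite divr_ge0.
  rewrite ltr_pdivrMr// in hn.
  have e1 := iter_conj NF n 0; have e2 := iter_conj PhiF n 0.
  have h : n%:R * (c - tau) = (N (iter n F 0) - iter n F 0) -
      (Phi (iter n F 0) - iter n F 0) by rewrite e1 e2 N0 Phi0; ring.
  have h2 : `|n%:R * (c - tau)| <= 2.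
    rewrite h (le_trans (ler_normB _ _))//.
    by have := Nnear (iter n F 0); have := Pnear (iter n F 0); lra.
  by rewrite normrM ger0_norm// in h2; lra.
have NO n (m : int) : N (iter n F 0 + m%:~R) = n%:R * tau + m%:~R.
  by rewrite shift1_int// (iter_conj NF) N0 add0r ct.
have PO n (m : int) : Phi (iter n F 0 + m%:~R) = n%:R * tau + m%:~R.
  by rewrite shift1_int// (iter_conj PhiF) Phi0 add0r.
move=> x; rewrite -/(N x); apply/eqP; rewrite eq_le; apply/andP; split; rewrite leNgt; apply/negP.
  move=> /(dense_orbit lt)[n [m /andP[h1 h2]]].
  have [xo|/ltW ox] := lerP (iter n F 0 + m%:~R) x.
    by have := Phi_nd xo; rewrite PO; lra.
  by have := Nnd _ _ ox; rewrite NO; lra.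
move=> /(dense_orbit lt)[n [m /andP[h1 h2]]].
have [xo|/ltW ox] := lerP (iter n F 0 + m%:~R) x.
  by have := Nnd _ _ xo; rewrite NO; lra.
by have := Phi_nd ox; rewrite PO; lra.
Qed.

End Dynamics.

(** * Local and box dimension at a scale *)

Section ExtendedLimits.
Context {R : realType}.
Implicit Types (g : R -> \bar R) (X : \bar R).

Lemma lee_lt_ub (b : R) X : (forall s, s < b -> (s%:E <= X)%E) -> (b%:E <= X)%E.
Proof.
move=> h; apply/lee_subgt0Pr => e e0; rewrite -EFinB; apply: h.
by lra.
Qed.

Lemma lee_gt_lb (b : R) X : (forall s, b < s -> (X <= s%:E)%E) -> (X <= b%:E)%E.
Proof.
move=> h; apply/lee_addgt0Pr => e e0; rewrite -EFinD; apply: h.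
by lra.
Qed.

Lemma liminf0_ge g X d : 0 < d < 1 -> (forall r, 0 < r < d -> (X <= g r)%E) ->
  (X <= liminf0 g)%E.
Proof.
move=> d01 h; apply: (@le_trans _ _ (ereal_inf [set g r | r in `]0, d[])).
  by apply: le_ereal_inf_tmp => _ [r + <-]; rewrite /= in_itv /=; exact: h.
by apply: ereal_sup_ubound; exists d => //=; rewrite in_itv.
Qed.

Lemma liminf0_le g X : (forall d, 0 < d < 1 -> exists2 r, 0 < r < d & (g r <= X)%E) ->
  (liminf0 g <= X)%E.
Proof.
move=> h; apply: ge_ereal_sup => _ [d /= + <-]; rewrite in_itv /= => /h[r rd hr].
by apply: le_trans hr; apply: ereal_inf_lbound; exists r => //=; rewrite in_itv.
Qed.

Lemma limsup0_le g X d : 0 < d < 1 -> (forall r, 0 < r < d -> (g r <= X)%E) ->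
  (limsup0 g <= X)%E.
Proof.
move=> d01 h; apply: (@le_trans _ _ (ereal_sup [set g r | r in `]0, d[])).
  by apply: ereal_inf_lbound; exists d => //=; rewrite in_itv.
by apply: ge_ereal_sup => _ [r + <-]; rewrite /= in_itv /=; exact: h.
Qed.

Lemma limsup0_ge g X : (forall d, 0 < d < 1 -> exists2 r, 0 < r < d & (X <= g r)%E) ->
  (X <= limsup0 g)%E.
Proof.
move=> h; apply: le_ereal_inf_tmp => _ [d /= + <-]; rewrite in_itv /= => /h[r rd hr].
by apply: le_trans hr _; apply: ereal_sup_ubound; exists r => //=; rewrite in_itv.
Qed.

Lemma ge0_series_le (a : nat -> \bar R) (C : \bar R) : (forall i, 0 <= a i)%E ->
  (forall N, \sum_(0 <= i < N) a i <= C)%E -> (\sum_(0 <= i <oo) a i <= C)%E.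
Proof.
move=> a0 h; apply: lime_le; first exact: is_cvg_nneseries.
by apply: nearW.
Qed.

Lemma ln_ratio_le (m r s : R) : 0 < r < 1 -> r `^ s <= m -> ln m / ln r <= s.
Proof.
move=> /andP[r0 r1] h; have l0 : ln r < 0 by rewrite ln_lt0 ?r0.
have p0 : 0 < r `^ s by exact: powR_gt0.
rewrite ler_ndivrMr// -ln_powR ler_ln ?posrE//; lra.
Qed.

Lemma ln_ratio_ge (m r s : R) : 0 < r < 1 -> 0 < m <= r `^ s -> s <= ln m / ln r.
Proof.
move=> /andP[r0 r1] /andP[m0 h]; have l0 : ln r < 0 by rewrite ln_lt0 ?r0.
by rewrite ler_ndivlMr// -ln_powR ler_ln ?posrE// powR_gt0.
Qed.

Lemma powR_small (p C : R) : 0 < p -> 0 < C ->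
  exists2 d, 0 < d < 1 & forall r, 0 < r < d -> r `^ p <= C.
Proof.
move=> p0 C0; exists (Num.min 2^-1 (C `^ p^-1)).
  by rewrite lt_min gt_min powR_gt0//; lra.
move=> r; rewrite lt_min => /andP[r0 /andP[_ rC]].
have -> : C = (C `^ p^-1) `^ p by rewrite -powRrM mulVf ?powRr1// ?ltW// gt_eqF.
by rewrite ge0_ler_powR ?nnegrE ?powR_ge0//; lra.
Qed.

Lemma le_powR_exp (r s s' : R) : 0 < r <= 1 -> s <= s' -> r `^ s' <= r `^ s.
Proof. by move=> r01 ss; apply: ger_powR. Qed.

End ExtendedLimits.

(** * The metric of the circle *)

Section CircleMetric.
Context {R : realType}.
Implicit Types x y r : R.

(** Together with [cdist_witness] this makes [cdist x y] the minimum of |x - y - k| over the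
    integers k, the form in which it is mostly used. *)
Lemma cdist_le x y (k : int) : cdist x y <= `|x - y - k%:~R|.
Proof.
rewrite /cdist; have /andP[f1 f2] := floor_itv (x - y); rewrite intrD in f2.
set m := Num.floor _ in f1 f2 *; rewrite ge_min.
have [km|km] := lerP k m.
  apply/orP; left; rewrite -(ler_int R) in km.
  by rewrite ger0_norm; lra.
apply/orP; right; have : (m + 1)%:~R <= (k%:~R : R) by rewrite ler_int; lia.
by rewrite intrD => h; rewrite ler0_norm; lra.
Qed.

Lemma cdist_witness x y : exists k : int, cdist x y = `|x - y - k%:~R|.
Proof.
rewrite /cdist; have /andP[f1 f2] := floor_itv (x - y); rewrite intrD in f2.
set m := Num.floor _ in f1 f2 *.
set t := x - y - m%:~R; have [_|_] := lerP t (1 - t).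
  by exists m; rewrite ger0_norm// /t; lra.
by exists (m + 1); rewrite intrD ler0_norm; rewrite /t; lra.
Qed.

Lemma cdist_ge0 x y : 0 <= cdist x y.
Proof. by have [k ->] := cdist_witness x y. Qed.

Lemma cdist_le1 x y : cdist x y <= 1.
Proof.
rewrite /cdist ge_min; apply/orP; left.
by have /andP[_] := floor_itv (x - y); rewrite intrD; lra.
Qed.

Lemma cdist_le_norm x y : cdist x y <= `|x - y|.
Proof. by have := cdist_le x y 0; rewrite subr0. Qed.

Lemma cball_carc x r : cball x r `<=` carc (x - r) (x + r).
Proof.
move=> y [cy]; have [k ->] := cdist_witness x y.
rewrite ltr_norml => /andP[h1 h2]; split => //; exists k.
by apply/andP; split; lra.
Qed.

Lemma carc_cball x r u v : x - r < u -> v <= x + r -> carc u v `<=` cball x r.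
Proof.
move=> h1 h2 y [cy [k /andP[k1 k2]]]; split => //.
by apply: le_lt_trans (cdist_le x y k) _; rewrite ltr_norml; apply/andP; split; lra.
Qed.

Lemma measurable_cdist x : measurable_fun setT (cdist x : R -> R).
Proof.
have mt : measurable_fun setT (fun y : R => (x - y) - (Num.floor (x - y))%:~R).
  have mx : measurable_fun setT (fun y : R => x - y).
    by apply: measurable_funB.
  apply: measurable_funB => //.
  apply: nonincreasing_measurable => // a b ab.
  by rewrite ler_int le_floor//; lra.
apply: measurable_minr => //.
exact: measurable_funB.
Qed.

Lemma measurable_cball x r : measurable (cball x r).
Proof.
have -> : cball x r = @circle R `&` (cdist x @^-1` `]-oo, r[%classic).
  by apply/seteqP; split => y /=; rewrite /cball /= in_itv.
apply: measurableI; first exact: measurable_circle.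
by rewrite -[X in measurable X]setTI; exact: measurable_cdist.
Qed.

Lemma cdiam_ge (U : set R) x y : U x -> U y -> cdist x y <= cdiam U.
Proof.
move=> Ux Uy; apply: ub_le_sup.
  by exists 1 => _ [a _ [b _ <-]]; exact: cdist_le1.
by exists x => //; exists y.
Qed.

Lemma cdiam_le (U : set R) (l : R) : 0 <= l ->
  (forall x y, U x -> U y -> `|x - y| <= l) -> cdiam U <= l.
Proof.
move=> l0 h; rewrite /cdiam.
have [->|/set0P ne] := eqVneq [set cdist x y | x in U & y in U] set0.
  by rewrite sup0.
apply: ge_sup => // _ [a Ua [b Ub <-]].
by apply: le_trans (cdist_le_norm _ _) (h _ _ Ua Ub).
Qed.

Lemma cdiam_ge0 (U : set R) : 0 <= cdiam U.
Proof.
have [->|/set0P[x Ux]] := eqVneq U set0; last first.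
  by apply: le_trans (cdist_ge0 x x) (cdiam_ge Ux Ux).
rewrite /cdiam [X in sup X](_ : _ = set0) ?sup0//.
by apply/seteqP; split => z // [a []].
Qed.

End CircleMetric.

(** * Covering numbers and masses of balls *)

Section Coverings.
Context {R : realType}.
Variable mu : probability R R.

Lemma finite_cover_mass (A : nat -> set R) (B : set R) (m : nat) (c : R) :
  (forall j, (j < m)%N -> measurable (A j) /\ (mu (A j) <= c%:E)%E) ->
  measurable B -> (forall x, B x -> exists2 j, (j < m)%N & A j x) ->
  (mu B <= (m%:R * c)%:E)%E.
Proof.
move=> hA mB BA.
apply: (@le_trans _ _ (\sum_(k < m) mu (A k))%E).
  apply: content_subadditive => //; first by move=> k /= km; have [] := hA k km.
  move=> x /BA[j jm Ajx]; rewrite -bigcup_mkord; by exists j.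
apply: (@le_trans _ _ (\sum_(k < m) c%:E)%E).
  by apply: lee_sum => k _; have [] := hA k (ltn_ord k).
by rewrite sumEFin lee_fin sumr_const card_ord mulr_natl.
Qed.

Lemma covnum_le (Z : set R) (eps : R) (m : nat) (c : nat -> R) :
  (forall j, (j < m)%N -> @circle R (c j)) ->
  (forall x, Z x -> exists2 j, (j < m)%N & cball (c j) (eps / 2) x) ->
  (covnum Z eps <= m%:R%:E)%E.
Proof.
move=> hc hZ; apply: ereal_inf_lbound.
exists [seq c j | j <- iota 0 m]; last by rewrite size_map size_iota.
split.
  by move=> x /mapP[j]; rewrite mem_iota add0n => /andP[_ jm] ->; exact: hc.
move=> x /hZ[j jm hj]; exists (c j) => //=.
by apply/mapP; exists j => //; rewrite mem_iota.
Qed.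

Lemma covnum_circle (Z : set R) (eps : R) : Z `<=` @circle R -> 0 < eps < 1 ->
  (covnum Z eps <= (3 / eps)%:E)%E.
Proof.
(* The centres are j / M with 1 / M < eps / 2; since M <= 2 / eps + 1 and eps < 1, there are at most
   3 / eps of them. *)
move=> ZC /andP[e0 e1]; pose M := (Num.truncn (2 / eps)).+1.
have x0 : 0 <= 2 / eps by rewrite divr_ge0// ltW.
have /andP[t1 t2] := truncn_itv x0.
have M0 : 0 < (M%:R : R) by rewrite ltr0n.
have MI : M%:R^-1 < eps / 2 by rewrite -[X in _ < X]invrK ltf_pV2 ?posrE ?invr_gt0 ?invf_div//; lra.
apply: (@le_trans _ _ M%:R%:E).
  apply: (@covnum_le _ _ _ (fun j => j%:R / M%:R)).
    move=> j jM; rewrite /circle /= divr_ge0 ?ler0n//= ltr_pdivrMr// mul1r.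
    by rewrite ltr_nat.
  move=> x /[dup] /ZC /andP[c0 c1] Zx.
  have y0 : 0 <= x * M%:R by rewrite mulr_ge0// ltW.
  have /andP[h1 h2] := truncn_itv y0.
  exists (Num.truncn (x * M%:R)).
    by rewrite -(ltr_nat R); apply: le_lt_trans h1 _; rewrite gtr_pMl.
  split; first by rewrite /circle /= c0.
  apply: le_lt_trans (cdist_le_norm _ _) _; apply: lt_trans MI.
  have -> : (Num.truncn (x * M%:R))%:R / M%:R - x =
      ((Num.truncn (x * M%:R))%:R - x * M%:R) / M%:R by field; lra.
  rewrite normrM normfV (gtr0_norm M0) ltr_pdivrMr// mulVf ?gt_eqF//.
  by rewrite -natr1 in h2; rewrite ltr_norml; apply/andP; split; lra.
rewrite lee_fin /M -natr1.
have : 1 <= eps^-1 by rewrite invf_ge1// ltW.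
lra.
Qed.

Lemma bq_le (Z : set R) (eps s : R) : Z `<=` @circle R -> Z !=set0 ->
  0 < eps < 1 -> (covnum Z eps <= (eps `^ (- s))%:E)%E -> (bq Z eps <= s%:E)%E.
Proof.
move=> ZC [z Zz] e01 h; rewrite /bq lee_fin.
have [e0 e1] : 0 < eps /\ eps < 1 by lra.
have c1 : (1%:E <= covnum Z eps)%E.
  apply: le_ereal_inf_tmp => _ [cs [_ hcs] <-]; rewrite lee_fin ler1n.
  by have [c /= + _] := hcs z Zz; case: cs {hcs}.
have fin : covnum Z eps \is a fin_num.
  by rewrite ge0_fin_numE ?(le_lt_trans h) ?ltry// (le_trans _ c1)// lee_fin.
rewrite -(fineK fin) !lee_fin in h c1.
rewrite lnV ?posrE// invrN mulrN -mulNr -[- ln _]lnV ?posrE; last lra.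
apply: ln_ratio_le => //.
rewrite -[X in X <= _]invrK -powRN lef_pV2 ?posrE ?powR_gt0//; lra.
Qed.

(** If N balls of radius eps / 2 cover Z, then N (eps / 2)^s >= mu Z > 1/2, and passing from s to s'
    pays for the factor 2. *)
Lemma bq_ge (Z : set R) (eps s s' : R) : Z `<=` @circle R -> measurable Z ->
  (2^-1%:E < mu Z)%E -> 0 < eps < 1 ->
  (forall x, mu (cball x (eps / 2)) <= ((eps / 2) `^ s)%:E)%E ->
  2 * (eps / 2) `^ s <= eps `^ s' -> (s'%:E <= bq Z eps)%E.
Proof.
move=> ZC mZ + e01 hball hs.
have [e0 e1] : 0 < eps /\ eps < 1 by lra.
have q0 : 0 < (eps / 2) `^ s by rewrite powR_gt0; lra.
have p0 : 0 < eps `^ s' by rewrite powR_gt0.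
move=> muZ; rewrite /bq lee_fin.
have lo : (((eps `^ s')^-1)%:E <= covnum Z eps)%E.
  apply: le_ereal_inf_tmp => _ [cs [_ hcs] <-]; rewrite lee_fin.
  have : (mu Z <= ((size cs)%:R * (eps / 2) `^ s)%:E)%E.
    apply: (@finite_cover_mass (fun j => cball (nth 0 cs j) (eps / 2))) => //.
      by move=> j _; split; [exact: measurable_cball|exact: hball].
    move=> x /hcs[c /= ccs cx]; exists (index c cs); first by rewrite index_mem.
    by rewrite nth_index.
  move=> /(lt_le_trans muZ); rewrite lte_fin => h.
  rewrite -[X in X <= _]mul1r ler_pdivrMr//.
  have n0 : 0 <= ((size cs)%:R : R) by [].
  nra.
(* [bq] goes through [fine], which sends +oo to 0, so finiteness of the covering number matters. *)
have fin : covnum Z eps \is a fin_num.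
  rewrite ge0_fin_numE ?(le_lt_trans (covnum_circle ZC e01)) ?ltry//.
  by apply: le_trans lo; rewrite lee_fin invr_ge0 ltW.
rewrite -(fineK fin) lee_fin in lo.
have f0 : 0 < fine (covnum Z eps) by apply: lt_le_trans lo; rewrite invr_gt0.
rewrite lnV ?posrE// invrN mulrN -mulNr -[- ln _]lnV ?posrE//.
apply: ln_ratio_ge => //; rewrite invr_gt0 f0 /=.
by rewrite -[X in _ <= X]invrK lef_pV2 ?posrE ?invr_gt0.
Qed.

Lemma ldq_le x r s : 0 < r < 1 -> ((r `^ s)%:E <= mu (cball x r))%E ->
  (ldq mu x r <= s%:E)%E.
Proof.
move=> r01 h; have [r0 r1] : 0 < r /\ r < 1 by lra.
have fin : mu (cball x r) \is a fin_num.
  by apply: fin_num_measure; exact: measurable_cball.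
rewrite -(fineK fin) lee_fin in h.
have p0 : 0 < r `^ s by rewrite powR_gt0.
rewrite /ldq ifT; last exact: lt_le_trans h.
by rewrite lee_fin; exact: ln_ratio_le.
Qed.

Lemma ldq_ge x r s : 0 < r < 1 -> (mu (cball x r) <= (r `^ s)%:E)%E ->
  (s%:E <= ldq mu x r)%E.
Proof.
move=> r01 h; have [r0 r1] : 0 < r /\ r < 1 by lra.
have fin : mu (cball x r) \is a fin_num.
  by apply: fin_num_measure; exact: measurable_cball.
rewrite -(fineK fin) lee_fin in h.
rewrite /ldq; case: ifPn => [p0|_]; last by rewrite leey.
by rewrite lee_fin; apply: ln_ratio_ge => //; rewrite p0.
Qed.

End Coverings.

(** * Lower bounds from uniform mass estimates *)

Section LowerBounds.
Context {R : realType}.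
Variable mu : probability R R.

Definition ball_bound (s r : R) := forall x, (mu (cball x r) <= (r `^ s)%:E)%E.

Variable beta : R.
Hypothesis mu1 : circle_prob mu.
Hypothesis ballA : forall s, s < beta ->
  exists2 d, 0 < d < 1 & forall r, 0 < r < d -> ball_bound s r.
Hypothesis ballB : forall s, s < 1 -> forall d, 0 < d ->
  exists2 r, 0 < r < d & ball_bound s r.

Lemma lower_local_dim_ge x : (beta%:E <= lower_local_dim mu x)%E.
Proof.
apply: lee_lt_ub => s /ballA[d d01 hd].
apply: (liminf0_ge d01) => r rd; apply: ldq_ge; last exact: hd.
by lra.
Qed.

Lemma upper_local_dim_ge x : (1%:E <= upper_local_dim mu x)%E.
Proof.
apply: lee_lt_ub => s s1; apply: limsup0_ge => d d01.
have [|r rd hr] := ballB s1 (d := d); first lra.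
by exists r => //; apply: ldq_ge; [lra|exact: hr].
Qed.

(** The passage from diameter eps to radius eps / 2 and the factor 2 of [bq_ge] vanish in an
    arbitrarily small loss of exponent. *)
Lemma scale_cond (s s' : R) : s' < s -> exists2 d, 0 < d < 1 &
  forall eps, 0 < eps < d -> 2 * (eps / 2) `^ s <= eps `^ s'.
Proof.
move=> ss; have h0 : 0 < s - s' by lra.
have c0 : 0 < 2^-1 * 2 `^ s :> R by rewrite mulr_gt0// powR_gt0.
have [d d01 hd] := powR_small h0 c0; exists d => // eps ed.
have e0 : 0 < eps by lra.
have -> : (eps / 2) `^ s = eps `^ s' * (eps `^ (s - s') * (2 `^ s)^-1).
  rewrite powRM ?invr_ge0//; last lra.
  rewrite mulrA -powRD; last by apply/implyP => _; rewrite gt_eqF.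
  have -> : (2^-1 : R) `^ s = (2 `^ s)^-1.
    by rewrite -[2^-1]powR_inv1// -powRrM mulN1r powRN.
  by rewrite subrKC.
rewrite mulrCA -[X in _ <= X]mulr1 ler_pM2l ?powR_gt0//.
rewrite mulrA ler_pdivrMr ?powR_gt0// mul1r.
by have := hd _ ed; lra.
Qed.

Lemma lower_box_dim_ge (Z : set R) : Z `<=` @circle R -> measurable Z ->
  (2^-1%:E < mu Z)%E -> (beta%:E <= lower_box_dim Z)%E.
Proof.
move=> ZC mZ muZ; apply: lee_lt_ub => s' sb.
have sb' : (s' + beta) / 2 < beta by lra.
have ss' : s' < (s' + beta) / 2 by lra.
have [d1 d1p h1] := ballA sb'; have [d2 d2p h2] := scale_cond ss'.
have d12 : 0 < Num.min d1 d2 < 1 by rewrite lt_min gt_min; lra.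
apply: (liminf0_ge d12) => eps; rewrite lt_min => /and3P[e0 e1 e2].
apply: (bq_ge ZC mZ muZ (s := (s' + beta) / 2)).
- by lra.
- by apply: h1; lra.
- by apply: h2; lra.
Qed.

Lemma upper_box_dim_ge (Z : set R) : Z `<=` @circle R -> measurable Z ->
  (2^-1%:E < mu Z)%E -> (1%:E <= upper_box_dim Z)%E.
Proof.
move=> ZC mZ muZ; apply: lee_lt_ub => s' sb.
have sb' : (s' + 1) / 2 < 1 by lra.
have ss' : s' < (s' + 1) / 2 by lra.
have [d2 d2p h2] := scale_cond ss'.
apply: limsup0_ge => d d01.
have d12 : 0 < Num.min d d2 / 2 by rewrite divr_gt0// lt_min; lra.
have [r /andP[r0]] := ballB sb' d12.
rewrite ltr_pdivlMr// lt_min => /andP[r1 r2] hr.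
exists (r * 2); first by lra.
apply: (bq_ge ZC mZ muZ (s := (s' + 1) / 2)).
- by lra.
- by rewrite mulfK.
- by apply: h2; lra.
Qed.

(** [U] is replaced by the closed ball of radius diam U about one of its points, which is
    measurable. [ball_bound] speaks of open balls, so radii just above the diameter are used, which
    also settles diameter 0. *)
Lemma cover_mass (U : set R) (s d : R) : 0 <= s -> 0 < d ->
  (forall r, 0 < r < d -> ball_bound s r) ->
  U `<=` @circle R -> cdiam U < d ->
  exists V, [/\ measurable V, U `<=` V & (mu V <= ((cdiam U) `^ s)%:E)%E].
Proof.
move=> s0 d0 hd UC Ud.
have [->|/set0P[x Ux]] := eqVneq U set0.
  by exists set0; split => //; rewrite measure0 lee_fin powR_ge0.
exists (@circle R `&` cdist x @^-1` `]-oo, cdiam U]%classic).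
set V := (X in measurable X).
have mV : measurable V.
  apply: measurableI; first exact: measurable_circle.
  by rewrite -[X in measurable X]setTI; exact: measurable_cdist.
split => //.
  by move=> y Uy; split; [exact: UC|rewrite /= in_itv /=; exact: cdiam_ge].
have D0 := cdiam_ge0 U.
have Vr r : cdiam U < r < d -> (mu V <= (r `^ s)%:E)%E.
  move=> rd; apply: (@le_trans _ _ (mu (cball x r))); last by apply: hd; lra.
  apply: le_measure; rewrite ?inE//; first exact: measurable_cball.
  move=> y [cy]; rewrite /= in_itv /= => h; split => //.
  by apply: le_lt_trans h _; lra.
move: s0; rewrite le_eqVlt => /orP[/eqP<-|s0].
  by rewrite powRr0 probability_le1.
apply/lee_addgt0Pr => e e0; rewrite -EFinD.
have lt1 : (cdiam U) `^ s < d `^ s by apply: gt0_ltr_powR; rewrite ?nnegrE//; lra.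
(* [m] lies strictly between (diam U)^s and d^s and within [e] of the former; its s-th root is an
   admissible radius. *)
pose m := Num.min ((cdiam U) `^ s + e) (((cdiam U) `^ s + d `^ s) / 2).
have p0 := powR_ge0 (cdiam U) s.
have m1 : (cdiam U) `^ s < m by rewrite lt_min; lra.
have m2 : m < d `^ s by rewrite gt_min; apply/orP; right; lra.
have m0 : 0 <= m by lra.
have mK : (m `^ s^-1) `^ s = m by rewrite -powRrM mulVf ?powRr1// gt_eqF.
have K (a : R) : 0 <= a -> (a `^ s) `^ s^-1 = a.
  by move=> a0; rewrite -powRrM mulfV ?powRr1// gt_eqF.
have si : 0 < s^-1 by rewrite invr_gt0.
apply: (@le_trans _ _ m%:E); last by rewrite lee_fin ge_min lexx.
rewrite -mK; apply: Vr; apply/andP; split.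
  by rewrite -[X in X < _](K _ D0); apply: gt0_ltr_powR; rewrite ?nnegrE.
rewrite -[X in _ < X](K d); last exact: ltW.
by apply: gt0_ltr_powR; rewrite ?nnegrE//; lra.
Qed.

(** Mass distribution principle: for 0 <= s < beta the sum over any fine cover dominates the mass 1
    of Z, so the s-dimensional measure of Z cannot vanish. *)
Lemma hausdorff_dim_ge (Z : set R) : measurable Z -> mu Z = 1%E ->
  (beta%:E <= hausdorff_dim Z)%E.
Proof.
move=> mZ muZ; apply: le_ereal_inf_tmp => _ [s [s0 hs] <-].
rewrite lee_fin leNgt; apply/negP => sb.
have [d d01 hd] := ballA sb.
have d0 : 0 < d by lra.
suff h : (1%E <= hausdorff_measure s Z)%E by move: h; rewrite hs lee_fin; lra.
apply: (@le_trans _ _ (hausdorff_content s (d / 2) Z)); last first.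
  apply: ereal_sup_ubound; exists (d / 2) => //=.
  by rewrite in_itv /=; lra.
apply: le_ereal_inf_tmp => _ [U [hU ZU] <-].
have [V hV] : {V : nat -> set R & forall i,
    [/\ measurable (V i), U i `<=` V i & (mu (V i) <= ((cdiam (U i)) `^ s)%:E)%E]}.
  apply: (choice (P := fun i V => [/\ measurable V, U i `<=` V &
    (mu V <= ((cdiam (U i)) `^ s)%:E)%E])) => i.
  have [h1 h2] := hU i; apply: (cover_mass s0 d0 hd h1).
  by lra.
rewrite -[X in (X <= _)%E]muZ.
apply: (@le_trans _ _ (\sum_(0 <= i <oo) mu (V i))%E).
  apply: measure_sigma_subadditive => //; first by move=> i; have [] := hV i.
  by move=> x /ZU[i _ Uix]; exists i => //; have [_ h _] := hV i; exact: h.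
apply: lee_nneseries => i *; [exact: measure_ge0|by have [] := hV i].
Qed.

End LowerBounds.

(** * Upper local dimension at almost every point *)

Section Dyadic.
Context {R : realType}.
Variable mu : probability R R.
Hypothesis mu1 : circle_prob mu.

Local Notation half n := ((2^-1 : R) ^+ n).

Lemma half_pow_gt0 n : 0 < half n.
Proof. by rewrite exprn_gt0. Qed.

Lemma half_pow_le m n : (m <= n)%N -> half n <= half m.
Proof. by move=> mn; rewrite ler_wiXn2l//; lra. Qed.

Lemma half_pow_small (e : R) : 0 < e -> exists N, forall n, (N <= n)%N -> half n < e.
Proof.
move=> e0; have [N hN] := pow2_unbounded (2 / e); exists N => n Nn.
apply: (le_lt_trans (half_pow_le Nn)).
rewrite exprVn -[X in _ < X]invrK ltf_pV2 ?posrE ?invr_gt0 ?exprn_gt0//.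
apply: lt_le_trans hN; have : 0 < e^-1 by rewrite invr_gt0.
by lra.
Qed.

(* Borel-Cantelli on the dyadic intervals of abnormally small mass. *)
Lemma upper_local_dim_eta (eta : R) : 0 < eta ->
  {ae mu, forall x, (upper_local_dim mu x <= (1 + 2 * eta)%:E)%E}.
Proof.
move=> eta0.
pose I n j : set R := `[j%:R * half n, (j%:R + 1) * half n[%classic.
pose b n := half n `^ (1 + eta).
pose A n j : set R := if (mu (I n j) <= (b n)%:E)%E then I n j else set0.
pose E n : set R := \bigcup_(j in `I_(2 ^ n)) A n j.
have mA n j : measurable (A n j) by rewrite /A; case: ifP => _; [exact: measurable_itv|exact: measurable0].
have mE n : measurable (E n) by apply: bigcup_measurable => j _; exact: mA.
(* At most 2^n intervals of mass at most 2^(-n (1 + eta)) make up [E n], whose mass is thus at most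
   rho^n, a summable bound. *)
pose rho := (2^-1 : R) `^ eta.
have rho01 : 0 < rho < 1.
  rewrite powR_gt0//=.
  have := @gt0_ltr_powR R eta eta0 2^-1 1; rewrite !nnegrE powR1; apply; lra.
have muE n : (mu (E n) <= (rho ^+ n)%:E)%E.
  have -> : rho ^+ n = (2 ^ n)%:R * b n.
    rewrite /b powRD; last by apply/implyP => _; rewrite gt_eqF ?half_pow_gt0.
    have hh : (2 ^ n)%:R * half n = 1 by rewrite natrX -exprMn mulfV ?expr1n.
    rewrite powRr1 ?ltW ?half_pow_gt0// mulrA hh mul1r.
    rewrite /rho -[LHS]powR_mulrn ?powR_ge0// -[X in _ = X `^ _]powR_mulrn; last lra.
    by rewrite powRAC.
  apply: (finite_cover_mass (A := A n)) => //.
  move=> j _; split => //; rewrite /A; case: ifP => [//|_].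
  by rewrite measure0 lee_fin powR_ge0.
have E0 : mu (lim_sup_set E) = 0%E.
  apply: lim_sup_set_cvg0 => //.
  apply: (@le_lt_trans _ _ ((1 - rho)^-1)%:E); last exact: ltry.
  apply: ge0_series_le => [i|N]; first exact: measure_ge0.
  apply: (@le_trans _ _ (\sum_(0 <= i < N) (rho ^+ i)%:E)%E); first by apply: lee_sum => i _; exact: muE.
  rewrite sumEFin lee_fin big_mkord.
  have := subrX1 rho N; rewrite -[X in X = _]opprB -[rho - 1]opprB mulNr => /oppr_inj e.
  have r0 : 0 < 1 - rho by lra.
  rewrite -[leRHS]mul1r ler_pdivlMr// mulrC -e.
  have rN : 0 <= rho ^+ N by apply: exprn_ge0; lra.
  by lra.
have mC := @measurable_circle R.
exists (lim_sup_set E `|` ~` @circle R); split.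
- apply: measurableU; last exact: measurableC.
  by apply: bigcap_measurable => // k _; exact: bigcup_measurable.
- apply/eqP; rewrite -measure_le0.
  apply: le_trans (measureU2 _ _ _) _.
  + by apply: bigcap_measurable => // k _; exact: bigcup_measurable.
  + exact: measurableC.
  + have hC : mu (~` @circle R) = 0%E by rewrite probability_setC// mu1 subee.
    by rewrite [X in (X + _)%E]E0 [X in (_ + X)%E]hC adde0.
move=> x hx; apply: contrapT => /not_orP[nE /contrapT /andP[x0 x1]]; apply: hx => /=.
have [n0 hn0] : exists n0, forall n, (n0 <= n)%N -> ~ E n x.
  apply: contrapT => /forallNP h; apply: nE => m _.
  have /existsNP[n /not_implyP[mn /contrapT Enx]] := h m.
  by exists n.
have c0 : 0 < half 1 `^ (1 + eta) by rewrite powR_gt0 ?half_pow_gt0.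
have [d d01 hd] := powR_small eta0 c0.
have p0 := half_pow_gt0 n0.
have dd : 0 < Num.min d (half n0) < 1 by rewrite lt_min gt_min p0; lra.
apply: (limsup0_le dd) => r; rewrite lt_min => /and3P[r0 rd rn].
(* For the least such level n, the dyadic interval of x lies in the ball of radius r, and r <= 2 *
   2^(-n). *)
have exn : exists n, half n < r.
  by have [N hN] := half_pow_small r0; exists N; exact: hN.
case: (ex_minnP exn) => n hn minn.
have nn0 : (n0 < n)%N.
  rewrite ltnNge; apply/negP => nn; have := half_pow_le nn; lra.
have rle : r <= half n.-1.
  rewrite leNgt; apply/negP => /minn.
  by rewrite leqNgt ltn_predL (leq_ltn_trans _ nn0).
have half1 : half n.-1 = 2 * half n.
  by case: n nn0 {hn minn rle} => // n _; rewrite exprS mulrA mulfV ?mul1r.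
have pn := half_pow_gt0 n.
have y0 : 0 <= x / half n by rewrite divr_ge0// ltW.
have /andP[h1 h2] := truncn_itv y0.
set j := Num.truncn (x / half n) in h1 h2.
rewrite ler_pdivlMr// in h1; rewrite ltr_pdivrMr// -natr1 in h2.
have jn : (j < 2 ^ n)%N.
  rewrite -(ltr_nat R) natrX; have : j%:R * half n < 1 by lra.
  by rewrite exprVn ltr_pdivrMr ?exprn_gt0// mul1r.
have Ij : ~~ (mu (I n j) <= (b n)%:E)%E.
  apply/negP => h; apply: (hn0 n (ltnW nn0)); exists j => //.
  by rewrite /A h /I /= in_itv /= h1 h2.
rewrite -ltNge in Ij.
have jn1 : j%:R + 1 <= 2 ^+ n :> R by rewrite natr1 -natrX ler_nat.
have j1 : (j%:R + 1) * half n <= 1.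
  by rewrite exprVn ler_pdivrMr ?exprn_gt0// mul1r.
have r1 : r < 1 by lra.
apply: (ldq_le (s := 1 + 2 * eta)); first by rewrite r0.
apply: (@le_trans _ _ (mu (I n j))); last first.
  apply: le_measure; rewrite ?inE; [exact: measurable_itv|exact: measurable_cball|].
  move=> y; rewrite /I /= in_itv /= => /andP[y1 y2]; split.
    by rewrite /circle /= (le_trans _ y1) ?mulr_ge0//=; lra.
  by apply: le_lt_trans (cdist_le_norm _ _) _; rewrite ltr_norml; apply/andP; split; lra.
apply: le_trans (ltW Ij); rewrite lee_fin.
(* One eta has made the bad masses summable; the second absorbs the factor 2^(1 + eta) lost between
   r and 2^(-n). *)
have -> : 1 + 2 * eta = eta + (1 + eta) by ring.
rewrite powRD; last by apply/implyP => _; rewrite gt_eqF.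
apply: (@le_trans _ _ (half 1 `^ (1 + eta) * r `^ (1 + eta))).
  by rewrite ler_wpM2r ?powR_ge0//; apply: hd; rewrite r0.
rewrite -powRM ?expr1//; last by rewrite ltW.
by apply: ge0_ler_powR; rewrite ?nnegrE; lra.
Qed.

Lemma upper_local_dim_le : {ae mu, forall x, (upper_local_dim mu x <= 1%:E)%E}.
Proof.
have h : forall n, {ae mu, forall x,
    (upper_local_dim mu x <= (1 + 2 * half n)%:E)%E}.
  by move=> n; apply: upper_local_dim_eta; exact: half_pow_gt0.
move/ae_foralln : h => h.
apply: filterS h => x hx; apply: lee_gt_lb => s s1.
have e0 : 0 < (s - 1) / 2 by lra.
have [N hN] := half_pow_small e0.
apply: le_trans (hx N) _; rewrite lee_fin.
by have := hN N (leqnn N); lra.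
Qed.

End Dyadic.

(** * The concentration sets *)

Section Covers.
Context {R : realType}.
Variables (mu : probability R R) (Phi : R -> R) (beta : R).
Variables (q : nat -> nat) (r : nat -> R) (u v : nat -> nat -> R).
Hypothesis mu1 : circle_prob mu.
Hypothesis muE : forall t : R, 0 <= t <= 1 -> mu `[0, t[%classic = (Phi t)%:E.
Hypothesis Phi1 : forall x, Phi (x + 1) = Phi x + 1.
Hypothesis q0 : forall n, (0 < q n)%N.
Hypothesis r_small : forall n, 0 < r n <= 2^-1 ^+ n.
Hypothesis uv : forall n j, (j <= q n)%N -> u n j <= v n j < u n j + r n.
Hypothesis vu : forall n j, (j < q n)%N -> v n j <= u n j.+1 <= v n j + 1 /\
  Phi (u n j.+1) - Phi (v n j) <= 2^-1 ^+ n / (q n)%:R.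
Hypothesis uv_mass : forall n j, (j <= q n)%N ->
  (2 * (q n)%:R)^-1 <= Phi (v n j) - Phi (u n j).
Hypothesis u0 : forall n, u n 0%N <= 0.
Hypothesis v1 : forall n, 1 <= v n (q n).
Hypothesis qr : forall s, beta < s -> exists n0, forall n, (n0 <= n)%N ->
  (q n).+1%:R * r n `^ s <= 2^-1 ^+ n.

Local Notation half n := ((2^-1 : R) ^+ n).

(** The extreme indices 0 and q n belong to the intervals at the two ends of the fundamental domain
    [0, 1[, hence q n + 1 intervals. *)
Definition core n : set R :=
  [set x | @circle R x /\ exists2 j, (j <= q n)%N & u n j <= x <= v n j].

Lemma measurable_core n : measurable (core n).
Proof.
have -> : core n = @circle R `&` \bigcup_(j in [set j | (j <= q n)%N]) `[u n j, v n j]%classic.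
  apply/seteqP; split => x [cx [j jq xj]]; split => //; exists j => //.
apply: measurableI; first exact: measurable_circle.
by apply: bigcup_measurable => j _; exact: measurable_itv.
Qed.

Lemma core_compl n : (mu (@circle R `\` core n) <= (half n)%:E)%E.
Proof.
have qn0 : (q n)%:R != 0 :> R by rewrite pnatr_eq0 -lt0n.
have -> : half n = (q n)%:R * (half n / (q n)%:R) by rewrite mulrC divfK.
apply: (finite_cover_mass (A := fun j => carc (v n j) (u n j.+1))).
- move=> j jq; have [h1 h2] := vu jq.
  by have [mA ->] := carc_mass muE Phi1 h1; rewrite lee_fin.
- by apply: measurableD; [exact: measurable_circle|exact: measurable_core].
move=> x [cx nx]; have [x0 x1] := andP cx.
have ex : exists j, x <= v n j by exists (q n); have := v1 n; lra.
(* For the first interval that does not end before x, a point outside [core n] lies in the gap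
   preceding it; j = 0 is excluded by u n 0 <= 0. *)
case: (ex_minnP ex) => -[|j] xv minj.
  case: nx; split => //; exists 0%N => //.
  by rewrite xv andbT; have := u0 n; lra.
have jq : (j < q n)%N by apply: minj; have := v1 n; lra.
exists j => //; split => //; exists 0; rewrite addr0; apply/andP; split.
  by rewrite leNgt; apply/negP => /ltW /minj; rewrite ltnn.
rewrite ltNge; apply/negP => ux; apply: nx; split => //.
by exists j.+1 => //; rewrite ux xv.
Qed.

(** For the box dimension all points have to be covered at the same scale, so the points lying in
    every core from [m] on are kept, at the price of mass at most 2 * 2^(-m). *)
Definition tail m : set R := [set x | @circle R x /\ forall n, (m <= n)%N -> core n x].

Lemma measurable_tail m : measurable (tail m).
Proof.
have -> : tail m = @circle R `&` \bigcap_(n in [set n | (m <= n)%N]) core n.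
  by apply/seteqP; split => x [].
apply: measurableI; first exact: measurable_circle.
by apply: bigcap_measurable => [|n _]; [exists m => /=|exact: measurable_core].
Qed.

Lemma tail_mass m : ((1 - 2 * half m)%:E <= mu (tail m))%E.
Proof.
have mC := @measurable_circle R.
pose D := @circle R `\` tail m.
have mD : measurable D by apply: measurableD => //; exact: measurable_tail.
have hD : (mu D <= (2 * half m)%:E)%E.
  apply: (@le_trans _ _ (\sum_(0 <= i <oo) mu (@circle R `\` core (m + i)))%E).
    apply: measure_sigma_subadditive => //.
      by move=> i; apply: measurableD => //; exact: measurable_core.
    move=> x [cx nx]; apply: contrapT => hx; apply: nx; split => // n mn.
    apply: contrapT => nc; apply: hx; exists (n - m)%N => //.
    by rewrite subnKC.
  apply: ge0_series_le => [i|N]; first exact: measure_ge0.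
  apply: (@le_trans _ _ (\sum_(0 <= i < N) (half (m + i))%:E)%E).
    by apply: lee_sum => i _; exact: core_compl.
  rewrite sumEFin lee_fin.
  suff : \sum_(0 <= i < N) half (m + i) = 2 * half m - 2 * half (m + N).
    by move=> ->; have := half_pow_gt0 (R := R) (m + N); lra.
  elim: N => [|N IH]; first by rewrite big_geq// addn0 subrr.
  by rewrite big_nat_recr//= IH addnS exprS; lra.
have h1 : (1%E <= mu (tail m) + mu D)%E.
  rewrite -[X in (X <= _)%E]mu1.
  apply: le_trans (measureU2 mu (measurable_tail m) mD).
  apply: le_measure; rewrite ?inE//; first by apply: measurableU => //; exact: measurable_tail.
  by move=> x cx; have [h|h] := pselect (tail m x); [left|right].
rewrite EFinB leeBlDr//; apply: le_trans h1 _.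
exact: leeD2l.
Qed.

(** The Hausdorff and lower local dimensions allow good scales that depend on the point, and this
    set has full mass. *)
Definition infinitely_often : set R :=
  [set x | @circle R x /\ forall m, exists2 n, (m <= n)%N & core n x].

Lemma measurable_io : measurable infinitely_often.
Proof.
have -> : infinitely_often = @circle R `&` lim_sup_set core.
  apply/seteqP; split => x [cx h]; split => //.
    by move=> m _; have [n mn cn] := h m; exists n.
  by move=> m; have [n mn cn] := h m I; exists n.
apply: measurableI; first exact: measurable_circle.
apply: bigcap_measurable => // k _.
by apply: bigcup_measurable => j _; exact: measurable_core.
Qed.

Lemma io_mass : mu infinitely_often = 1%E.
Proof.
apply/eqP; rewrite eq_le probability_le1//; last exact: measurable_io.
apply: lee_lt_ub => s s1.
have e0 : 0 < (1 - s) / 2 by lra.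
have [N hN] := half_pow_small e0.
apply: le_trans (le_trans (tail_mass N) _).
  by rewrite lee_fin; have := hN N (leqnn N); lra.
apply: le_measure; rewrite ?inE.
- exact: measurable_tail.
- exact: measurable_io.
by move=> x [cx h]; split => // m; exists (maxn m N); [exact: leq_maxl|apply: h; exact: leq_maxr].
Qed.

(** The interval containing x is shorter than [r n], hence essentially inside the ball, and has mass
    at least 1 / (2 q n); for n > 0 the bound on (q n + 1) (r n)^s makes this at least (r n)^s. *)
Lemma core_ball n x s : (0 < n)%N -> (q n).+1%:R * r n `^ s <= half n ->
  core n x -> (((r n) `^ s)%:E <= mu (cball x (r n)))%E.
Proof.
move=> n0 hs [cx [j jq /andP[ux xv]]].
have /andP[uv1 uv2] := uv jq; have /andP[r0 rh] := r_small n.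
have h1 : half n <= 2^-1 by have := half_pow_le (R := R) n0; rewrite expr1.
have h01 : u n j <= v n j <= u n j + 1 by lra.
have [mA muA] := carc_mass muE Phi1 h01.
apply: (@le_trans _ _ (mu (carc (u n j) (v n j)))); last first.
  apply: le_measure; rewrite ?inE//; first exact: measurable_cball.
  by apply: carc_cball; lra.
rewrite muA lee_fin; apply: le_trans (uv_mass jq).
have Q0 : 0 < ((q n)%:R : R) by rewrite ltr0n.
rewrite -[X in X <= _]mul1r -[X in _ <= X]mul1r ler_pdivlMr; last lra.
rewrite mul1r; rewrite -natr1 in hs.
by have := powR_ge0 (r n) s; nra.
Qed.

Lemma lower_local_dim_le x : infinitely_often x -> (lower_local_dim mu x <= beta%:E)%E.
Proof.
move=> [cx io]; apply: lee_gt_lb => s /qr[n0 hn0].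
apply: liminf0_le => d /andP[d0 d1].
have [N hN] := half_pow_small d0.
have [n nm cn] := io (maxn n0 N.+1).
have n00 : (n0 <= n)%N by rewrite (leq_trans _ nm)// leq_maxl.
have nN : (N < n)%N by rewrite (leq_trans _ nm)// leq_maxr.
have /andP[r0 rh] := r_small n.
have hd := hN n (ltnW nN).
exists (r n); first by rewrite r0; lra.
apply: ldq_le; first by rewrite r0; lra.
by apply: (core_ball _ (hn0 n n00) cn); lia.
Qed.

Lemma tail_covnum n m : (m <= n)%N ->
  (covnum (tail m) (2 * r n) <= (q n).+1%:R%:E)%E.
Proof.
move=> mn.
(* Centres are points of the tail itself, as [u n j] may fall outside [0, 1[; an interval missing
   the tail gets the harmless centre 0. *)
pose c j : R := xget 0 [set x | tail m x /\ u n j <= x <= v n j].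
have c0 : @circle R 0 by rewrite /circle /= lexx ltr01.
apply: (@covnum_le _ _ _ _ c).
  by move=> j _; rewrite /c; case: xgetP => [x _ [[]]|].
move=> x tx; have [cx h] := tx; have [_ [j jq xj]] := h n mn.
exists j => //; have -> : 2 * r n / 2 = r n by field.
have : [set x | tail m x /\ u n j <= x <= v n j] (c j).
  by apply: xgetPex; exists x.
move=> [_ cj]; split => //; apply: le_lt_trans (cdist_le_norm _ _) _.
have := uv jq; move: cj xj => *.
by rewrite ltr_norml; apply/andP; split; lra.
Qed.

Lemma lower_box_dim_le m : (0 < mu (tail m))%E -> 0 <= beta ->
  (lower_box_dim (tail m) <= beta%:E)%E.
Proof.
move=> pos b0; apply: lee_gt_lb => s sb; have [n0 hn0] := qr sb.
have TC : tail m `<=` @circle R by move=> x [].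
have T0 : tail m !=set0.
  by apply/set0P/eqP => e; move: pos; rewrite e measure0 ltxx.
apply: liminf0_le => d /andP[d0 d1].
have d2 : 0 < d / 2 by lra.
have [N hN] := half_pow_small d2.
(* Taking n >= s gives 2^s <= 2^n, so the factor due to doubling the radius is cancelled by the
   2^(-n) in [qr]. *)
pose n := maxn (maxn m n0) (maxn N (Num.bound s)).
have [nm n0n nN ns] : [/\ (m <= n)%N, (n0 <= n)%N, (N <= n)%N & (Num.bound s <= n)%N].
  by rewrite /n; split; lia.
have /andP[r0 rh] := r_small n.
have hd := hN n nN.
exists (2 * r n); first by lra.
apply: bq_le => //; first by lra.
apply: le_trans (tail_covnum nm) _; rewrite lee_fin.
have s0 : 0 <= s by lra.
have p0 : 0 < r n `^ s by exact: powR_gt0.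
rewrite powRN powRM//; last exact: ltW.
rewrite -[X in X <= _]mul1r -[X in _ <= X]mul1r ler_pdivlMr ?mulr_gt0 ?powR_gt0// mul1r.
rewrite mulrCA.
have h2 : (2 : R) `^ s <= 2 ^+ n.
  rewrite -powR_mulrn//; apply: ler_powR; first lra.
  by apply/ltW/(lt_le_trans (archi_boundP s0)); rewrite ler_nat.
have := hn0 n n0n => hq.
apply: (@le_trans _ _ (2 ^+ n * half n)).
  by rewrite ler_pM ?powR_ge0// mulr_ge0// ltW.
by rewrite -exprMn mulfV// expr1n.
Qed.

(* The sets in row n = 0, 1, ... of a triangular array with rows of length q n + 1,
   listed row by row from row m on. *)
Fixpoint scan (m i : nat) : nat * nat :=
  if i is i'.+1 then
    let nj := scan m i' in
    if (nj.2 < q nj.1)%N then (nj.1, nj.2.+1) else (nj.1.+1, 0%N)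
  else (m, 0%N).

Lemma scan_bound m i : (m <= (scan m i).1)%N /\ ((scan m i).2 <= q (scan m i).1)%N.
Proof. by elim: i => [|i [h1 h2]] /=; [|case: ifP => //= _; split; lia]. Qed.

Lemma scan_surj m n j : (m <= n)%N -> (j <= q n)%N -> exists i, scan m i = (n, j).
Proof.
move=> mn; rewrite -(subnKC mn); elim: (n - m)%N j => [|k IH].
  elim=> [|j IHj] jq; first by exists 0%N; rewrite addn0.
  have [i hi] := IHj (ltnW jq); exists i.+1.
  by rewrite /= hi /= jq.
elim=> [|j IHj] jq.
  have [i hi] := IH _ (leqnn _); exists i.+1.
  by rewrite /= hi /= ltnn addnS.
have [i hi] := IHj (ltnW jq); exists i.+1.
by rewrite /= hi /= jq.
Qed.

(** A limsup set is covered by all rows n >= m together. Row n costs (q n + 1) (r n)^s <= 2^(-n), so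
    the whole cover costs at most 2 * 2^(-m). *)
Lemma hausdorff_io_le : 0 <= beta -> (hausdorff_dim infinitely_often <= beta%:E)%E.
Proof.
move=> b0; apply: lee_gt_lb => s sb; apply: ereal_inf_lbound.
have s0 : 0 < s by lra.
exists s => //; split; first exact: ltW.
apply/eqP; rewrite eq_le; apply/andP; split; last first.
  apply: (@le_trans _ _ (hausdorff_content s 1 infinitely_often)); last first.
    by apply: ereal_sup_ubound; exists 1 => //=; rewrite in_itv /= ltr01.
  apply: le_ereal_inf_tmp => _ [U _ <-].
  by apply: nneseries_ge0 => i *; rewrite lee_fin powR_ge0.
apply: ge_ereal_sup => _ [d /= + <-]; rewrite in_itv /= andbT => d0.
apply/lee_addgt0Pr => e e0; rewrite add0e.
have [n0 hn0] := qr sb.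
have e2 : 0 < e / 2 by lra.
have [N1 hN1] := half_pow_small d0; have [N2 hN2] := half_pow_small e2.
pose m := maxn n0 (maxn N1 N2).
have [mn0 mN1 mN2] : [/\ (n0 <= m)%N, (N1 <= m)%N & (N2 <= m)%N].
  by rewrite /m; split; lia.
pose W i : set R := [set x | @circle R x /\
  u (scan m i).1 (scan m i).2 <= x <= v (scan m i).1 (scan m i).2].
have Wd i : cdiam (W i) <= r (scan m i).1.
  have [_ /uv huv] := scan_bound m i.
  have /andP[r0 _] := r_small (scan m i).1.
  apply: cdiam_le; first exact: ltW.
  move=> x y [_ hx] [_ hy]; rewrite ler_norml.
  by apply/andP; split; lra.
apply: (@le_trans _ _ (\sum_(0 <= i <oo) ((cdiam (W i)) `^ s)%:E)%E).
  apply: ereal_inf_lbound; exists W => //; split.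
    move=> i; split; first by move=> x [].
    apply: le_trans (Wd i) _; have [h _] := scan_bound m i.
    have /andP[_ rh] := r_small (scan m i).1.
    by have := hN1 _ (leq_trans mN1 h); lra.
  move=> x [cx /(_ m)[n mn [_ [j jq hx]]]].
  by have [i hi] := scan_surj mn jq; exists i => //; split => //; rewrite hi.
apply: ge0_series_le => [i|N]; first by rewrite lee_fin powR_ge0.
rewrite sumEFin lee_fin.
(* The completed rows cost at most 2 * 2^(-m) - 2 * 2^(-n); the last term counts the entries of the
   current row n already listed. *)
pose T i := 2 * half m - 2 * half (scan m i).1 +
  (scan m i).2%:R * r (scan m i).1 `^ s.
have hT : \sum_(0 <= i < N) cdiam (W i) `^ s <= T N.
  elim: N => [|N IH].
    by rewrite big_geq// /T /= subrr mul0r addr0.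
  rewrite big_nat_recr//=.
  have h1 : cdiam (W N) `^ s <= r (scan m N).1 `^ s.
    apply: ge0_ler_powR; rewrite ?nnegrE ?cdiam_ge0//; first exact: ltW.
    by have /andP[/ltW] := r_small (scan m N).1.
  apply: le_trans (lerD IH h1) _; rewrite /T /=.
  have [mN jN] := scan_bound m N.
  move: (scan m N) mN jN => [n j] /= mN jN; case: ifPn => /= [jq|].
    by rewrite -natr1; lra.
  rewrite -leqNgt => qj; have jE : j = q n by lia.
  have := hn0 n (leq_trans mn0 mN); rewrite -jE -natr1 exprS.
  by lra.
apply: le_trans hT _; rewrite /T.
have [mN jN] := scan_bound m N.
have := hn0 _ (leq_trans mn0 mN); rewrite -natr1.
have : (scan m N).2%:R * r (scan m N).1 `^ s <= (q (scan m N).1)%:R * r (scan m N).1 `^ s.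
  by rewrite ler_wpM2r ?powR_ge0// ler_nat.
have := powR_ge0 (r (scan m N).1) s; have := half_pow_gt0 (R := R) (scan m N).1.
have := hN2 m mN2; lra.
Qed.

Hypothesis beta01 : 0 <= beta <= 1.
Hypothesis ballA : forall s, s < beta ->
  exists2 d, 0 < d < 1 & forall r, 0 < r < d -> ball_bound mu s r.
Hypothesis ballB : forall s, s < 1 -> forall d, 0 < d ->
  exists2 r, 0 < r < d & ball_bound mu s r.

Lemma ae_local_dim : {ae (mu : set R -> \bar R), forall x,
  lower_local_dim mu x = beta%:E /\ upper_local_dim mu x = 1%:E}.
Proof.
have h1 := upper_local_dim_le mu1.
have h2 : {ae mu, forall x, infinitely_often x}.
  exists (~` infinitely_often); split.
  - by apply: measurableC; exact: measurable_io.
  - by rewrite probability_setC ?io_mass ?subee//; exact: measurable_io.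
  - by move=> x.
apply: filterS2 h1 h2 => x ux iox; split; apply/eqP; rewrite eq_le.
  by rewrite lower_local_dim_le//; exact: lower_local_dim_ge ballA x.
by rewrite ux; exact: upper_local_dim_ge ballB x.
Qed.

Lemma hausdorff_dim_measE : hausdorff_dim_meas mu = beta%:E.
Proof.
apply/eqP; rewrite eq_le; apply/andP; split.
  have /andP[b0 _] := beta01.
  apply: le_trans (hausdorff_io_le b0); apply: ereal_inf_lbound.
  exists infinitely_often => //; split; first exact: measurable_io.
  by split; [move=> x []|exact: io_mass].
by apply: le_ereal_inf_tmp => _ [Z [mZ [_ muZ]] <-]; exact: hausdorff_dim_ge ballA _ mZ muZ.
Qed.

Lemma box_dim_meas_ge (bd : set R -> \bar R) (b : \bar R) :
  (forall Z, Z `<=` @circle R -> measurable Z -> (2^-1%:E < mu Z)%E -> (b <= bd Z)%E) ->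
  (b <= box_dim_meas bd mu)%E.
Proof.
move=> h.
apply: (@le_trans _ _ (ereal_inf [set bd Z | Z in [set Z | measurable Z /\
    Z `<=` @circle R /\ (1 - (2^-1)%:E < mu Z)%E]])).
  apply: le_ereal_inf_tmp => _ [Z [mZ [ZC muZ]] <-]; apply: h => //.
  have e : 1 - 2^-1 = 2^-1 :> R by field.
  by rewrite -EFinB e in muZ.
by apply: ereal_sup_ubound; exists 2^-1 => //=; rewrite in_itv /=; lra.
Qed.

Lemma lower_box_dim_measE : lower_box_dim_meas mu = beta%:E.
Proof.
apply/eqP; rewrite eq_le; apply/andP; split; last first.
  by apply: box_dim_meas_ge => Z ZC mZ muZ; exact: lower_box_dim_ge ballA _ ZC mZ muZ.
apply: ge_ereal_sup => _ [e /= + <-]; rewrite in_itv /= => /andP[e0 e1].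
have e2 : 0 < e / 2 by lra.
have [N hN] := half_pow_small e2; have hNN := hN N (leqnn N).
have ht : (1 - e%:E < mu (tail N))%E.
  by apply: lt_le_trans (tail_mass N); rewrite -EFinB lte_fin; lra.
apply: le_trans (lower_box_dim_le (m := N) _ _); last by have /andP[] := beta01.
  apply: ereal_inf_lbound; exists (tail N) => //; split; first exact: measurable_tail.
  by split => // x [].
by apply: lt_trans ht; rewrite -EFinB lte_fin; lra.
Qed.

Lemma upper_box_dim_measE : upper_box_dim_meas mu = 1%:E.
Proof.
apply/eqP; rewrite eq_le; apply/andP; split; last first.
  by apply: box_dim_meas_ge => Z ZC mZ muZ; exact: upper_box_dim_ge ballB _ ZC mZ muZ.
apply: ge_ereal_sup => _ [e /= + <-]; rewrite in_itv /= => /andP[e0 e1].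
apply: (@le_trans _ _ (upper_box_dim (@circle R))).
  apply: ereal_inf_lbound; exists (@circle R) => //; split; first exact: measurable_circle.
  by split => //; rewrite [X in (_ < X)%E]mu1 -EFinB lte_fin; lra.
apply: lee_gt_lb => s s1.
have p0 : 0 < s - 1 by lra.
have c0 : 0 < 3^-1 :> R by lra.
have [d d01 hd] := powR_small p0 c0.
apply: (limsup0_le d01) => eps ed.
have e0' : 0 < eps by lra.
apply: bq_le => //.
- by exists 0; rewrite /circle /= lexx ltr01.
- by lra.
apply: le_trans (covnum_circle _ _) _ => //; first by lra.
rewrite lee_fin powRN -[X in _ <= X]mul1r ler_pdivlMr ?powR_gt0//.
have e0'' : 0 <= eps by exact: ltW.
have -> : eps `^ s = eps `^ (s - 1) * eps.
  rewrite -[X in _ * X](powRr1 e0'') -powRD ?subrK//.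
  by apply/implyP => _; rewrite gt_eqF.
have := hd eps ed; set p := eps `^ _ => h.
have -> : 3 / eps * (p * eps) = 3 * p by field; rewrite gt_eqF.
by lra.
Qed.

End Covers.

(** * The limit *)

Section Exponents.
Context {R : realType}.

(* Interpolation of the two mass bounds with weights theta and 1 - theta. *)
Lemma interp_bound (C r Q E theta m : R) : 0 < C -> 0 < r -> 0 < Q ->
  0 < theta <= 1 -> E * theta = 1 ->
  m <= C * (r * Q `^ (E - 1)) -> m <= C * Q^-1 -> m <= C * r `^ theta.
Proof.
move=> C0 r0 Q0 /andP[t0 t1] Et h1 h2.
have [m0|m0] := lerP m 0.
  by apply: le_trans m0 _; rewrite mulr_ge0 ?powR_ge0// ltW.
rewrite -ler_pdivrMl// in h1; rewrite -ler_pdivrMl// in h2; rewrite -ler_pdivrMl//.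
set x := C^-1 * m in h1 h2 *.
have x0 : 0 < x by rewrite mulr_gt0// invr_gt0.
have Qp p : 0 < Q `^ p by exact: powR_gt0.
have -> : x = x `^ theta * x `^ (1 - theta).
  rewrite -powRD; last by apply/implyP => _; rewrite gt_eqF.
  by rewrite subrKC powRr1// ltW.
have i1 : x `^ theta <= (r * Q `^ (E - 1)) `^ theta.
  apply: ge0_ler_powR => //; rewrite ?nnegrE; [exact: ltW|exact: ltW|].
  by rewrite mulr_ge0// ltW.
have i2 : x `^ (1 - theta) <= (Q^-1) `^ (1 - theta).
  apply: ge0_ler_powR => //; rewrite ?nnegrE ?subr_ge0 ?invr_ge0//; exact: ltW.
apply: le_trans (ler_pM (powR_ge0 _ _) (powR_ge0 _ _) i1 i2) _.
have [r0' Q0'] : 0 <= r /\ 0 <= Q by split; exact: ltW.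
rewrite powRM ?powR_ge0// -powR_inv1// -!powRrM -mulrA -powRD; last first.
  by apply/implyP => _; rewrite gt_eqF.
rewrite (_ : (E - 1) * theta + -1 * (1 - theta) = 0) ?powRr0 ?mulr1//.
by rewrite mulrBl Et; ring.
Qed.

Lemma inv_small (e : R) : 0 < e -> exists n0 : nat, forall n, (n0 <= n)%N -> n.+1%:R^-1 <= e.
Proof.
move=> e0; have ei : 0 <= e^-1 by rewrite invr_ge0 ltW.
exists (Num.bound e^-1) => n hn.
rewrite -[leRHS]invrK lef_pV2 ?posrE ?invr_gt0//.
apply/ltW/(lt_le_trans (archi_boundP ei)); rewrite ler_nat; lia.
Qed.

End Exponents.

Section Good.
Context {R : realType}.
Variables (phi : R -> R) (L : R).
Hypothesis gphi : bilip_lift phi L.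

Lemma bilip_ge1 : 1 <= L. Proof. by case: gphi. Qed.

Lemma bilip_mono : {mono phi : x y / x <= y}.
Proof.
have L1 := bilip_ge1; have L0 : 0 < L^-1 by rewrite invr_gt0; lra.
apply: le_mono => x y xy; have := bilip_ge gphi (ltW xy).
have d : 0 < y - x by lra.
by have := mulr_gt0 L0 d; lra.
Qed.

Lemma bilip_shift x : phi (x + 1) = phi x + 1.
Proof. by case: gphi => _ [phi' []]. Qed.

Lemma bilip0 : phi 0 = 0.
Proof. by case: gphi => _ [phi' []]. Qed.

Lemma bilip_inv : exists psi, cancel psi phi.
Proof.
have [L1 [phi' [d b _ _ _]]] := gphi.
have Li : 0 < L^-1 by rewrite invr_gt0; lra.
have lo x : L^-1 <= phi' x by have /andP[] := b x.
by have [psi [_ h]] := has_deriv_bij d Li lo; exists psi.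
Qed.

End Good.

(** * Limit of the conjugacies *)

Section Limit.
Context {R : realType}.
Variables (tau beta : R).
Hypothesis tauL : liouville tau.
Hypothesis beta01 : 0 <= beta <= 1.
Variables (q : nat -> nat) (L : nat -> R) (Phi F : nat -> R -> R).

(** It serves twice: as a positive floor under theta when beta is small, and as the loss of exponent
    by which q^(w n) swallows [L n] and numerical constants. *)
Let w n : R := n.+1%:R^-1.
Let theta n : R := Num.max beta (w n).
Let E n : R := (theta n)^-1.
Let l n : R := (q n.+1)%:R `^ (E n - 1).

Hypothesis init : [/\ q 0%N = 1%N, L 0%N = 1, Phi 0%N = id & F 0%N = (fun x => x + tau)].
Hypothesis bilipPhi : forall n, bilip_lift (Phi n) (L n).
Hypothesis liftF : forall n, lifted tau (Phi n) (F n).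
Hypothesis q_ge2 : forall n, (2 <= q n.+1)%N.
Hypothesis q_grow : forall n, (2 ^ (n + 5) * q n <= q n.+1)%N.
Hypothesis L_small : forall n, L n * 2 ^+ (n + 6) <= (q n.+1)%:R `^ w n.
Hypothesis q_big : forall n, 2 ^+ n.+1 <= (q n.+1)%:R `^ (w n * w n).
Hypothesis PhiS : forall n, Phi n.+1 = gmob (q n.+1) (l n) \o Phi n.
Hypothesis LS : forall n, L n.+1 = l n * L n.
Hypothesis FS : forall n j x, (j <= n.+1)%N ->
  `|derive1n j (F n.+1) x - derive1n j (F n) x| <= (q n.+1)%:R^-1.

Let c n : R := (q n.+1)%:R^-1.

Let q_gt0 n : (0 < q n)%N.
Proof. by case: n => [|n]; [case: init => ->|have := q_ge2 n; lia]. Qed.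

Let Q_gt0 n : 0 < ((q n)%:R : R).
Proof. by rewrite ltr0n. Qed.

Let c_gt0 n : 0 < c n.
Proof. by rewrite invr_gt0. Qed.

Let c_grow n : 2 ^+ (n + 6) * c n.+1 <= c n.
Proof.
have h : 2 ^+ (n + 6) * (q n.+1)%:R <= ((q n.+2)%:R : R).
  rewrite -natrX -natrM ler_nat; apply: leq_trans (q_grow n.+1).
  by rewrite addSnnS.
rewrite /c ler_pdivrMr// mulrC ler_pdivlMr//.
Qed.

Let c_half n : 2 * c n.+1 <= c n.
Proof.
apply: le_trans (c_grow n); rewrite ler_pM2r//.
by rewrite -[X in X <= _]expr1 ler_weXn2l//; [lra|lia].
Qed.

Let c_half_pow n : c n <= 2^-1 ^+ n.
Proof.
elim: n => [|n IH].
  by rewrite expr0 /c invf_le1// ler1n.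
by rewrite exprS; have := c_half n; lra.
Qed.

Let c_small (e : R) : 0 < e -> exists n0, forall n, (n0 <= n)%N -> c n < e.
Proof.
move=> e0; have [N hN] := half_pow_small e0; exists N => n Nn.
exact: le_lt_trans (c_half_pow n) (hN n Nn).
Qed.

Let w_bounds n : 0 < w n <= 1.
Proof. by rewrite /w invr_gt0 ltr0n /= invf_le1 ?ler1n// ltr0n. Qed.

Let theta_bounds n : 0 < theta n <= 1.
Proof.
have /andP[w0 w1] := w_bounds n; have /andP[b0 b1] := beta01.
by rewrite /theta lt_max w0 orbT ge_max b1 w1.
Qed.

Let E_ge1 n : 1 <= E n.
Proof. by have /andP[t0 t1] := theta_bounds n; rewrite /E invf_ge1. Qed.

Let l_ge1 n : 1 <= l n.
Proof.
rewrite /l -[X in X <= _](powRr0 (q n.+1)%:R) ler_powR//; last by rewrite subr_ge0.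
by rewrite ler1n.
Qed.

Lemma limit_cdf : exists Phioo : R -> R, forall n x, `|Phioo x - Phi n x| <= 2 * c n.
Proof.
have H x : exists y, forall n, `|y - Phi n x| <= 2 * c n.
  have [||n _|y hy] := @geometric_limit R (fun n => Phi n x) c 0%N.
  - by move=> n; exact: ltW.
  - exact: c_half.
  - by rewrite PhiS /=; exact: gmob_near.
  - by exists y => n; exact: hy.
by have [P hP] := choice H; exists P => n x.
Qed.

Section LimitCdf.
Variable P : R -> R.
Hypothesis PE : forall n x, `|P x - Phi n x| <= 2 * c n.

Let PE2 n x : Phi n x - 2 * c n <= P x <= Phi n x + 2 * c n.
Proof. by have := PE n x; rewrite ler_norml => /andP[h1 h2]; apply/andP; split; lra. Qed.

Lemma limit_nd : {homo P : x y / x <= y}.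
Proof.
move=> x y xy; apply/ler_addgt0Pr => e e0.
have e4 : 0 < e / 4 by lra.
have [n hn] := c_small e4; have := hn n (leqnn n).
have /andP[h1 h2] := PE2 n x; have /andP[h3 h4] := PE2 n y.
have : Phi n x <= Phi n y by rewrite (bilip_mono (bilipPhi n)).
lra.
Qed.

Lemma limit_eq (x y : R) : (forall e, 0 < e -> `|x - y| <= e) -> x = y.
Proof.
move=> h; apply/eqP; rewrite -subr_eq0 -normr_le0; apply/ler_addgt0Pr => e e0.
by rewrite add0r; exact: h.
Qed.

Lemma limit_shift x : P (x + 1) = P x + 1.
Proof.
apply: limit_eq => e e0; have e4 : 0 < e / 4 by lra.
have [n hn] := c_small e4; have := hn n (leqnn n).
have -> : P (x + 1) - (P x + 1) = (P (x + 1) - Phi n (x + 1)) - (P x - Phi n x).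
  by rewrite (bilip_shift (bilipPhi n)); ring.
move=> cn; apply: le_trans (ler_normB _ _) _.
by have := PE n x; have := PE n (x + 1); lra.
Qed.

Lemma limit0 : P 0 = 0.
Proof.
apply: limit_eq => e e0; have e4 : 0 < e / 4 by lra.
have [n hn] := c_small e4; have := hn n (leqnn n).
by rewrite subr0; have := PE n 0; rewrite (bilip0 (bilipPhi n)) subr0; lra.
Qed.

(** The limit inherits the Lipschitz constant [L n] up to 2 * c n at each end. Used with n and with
    n + 1, it produces two competing mass bounds. *)
Lemma limit_modulus n x y : x <= y -> P y - P x <= L n * (y - x) + 4 * c n.
Proof.
move=> xy; have /andP[h1 h2] := PE2 n x; have /andP[h3 h4] := PE2 n y.
by have /andP[_ h] := bilip_ge (bilipPhi n) xy; lra.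
Qed.

Lemma limit_continuous : continuous P.
Proof.
move=> x; apply/cvgrPdist_le => e e0.
have e8 : 0 < e / 8 by lra.
have [n hn] := c_small e8; have cn := hn n (leqnn n).
have L1 := bilip_ge1 (bilipPhi n).
have d0 : 0 < e / 2 / L n by rewrite divr_gt0//; lra.
near=> y.
have xy : `|x - y| < e / 2 / L n.
  by near: y; apply/nbhs_ballP; exists (e / 2 / L n).
rewrite ltr_pdivlMr in xy; last lra.
have [h|/ltW h] := lerP x y.
  have h1 := limit_modulus n h; have h2 := limit_nd h.
  by rewrite ler0_norm in xy; [rewrite ler0_norm; lra|lra].
have h1 := limit_modulus n h; have h2 := limit_nd h.
by rewrite ger0_norm in xy; [rewrite ger0_norm; lra|lra].
Unshelve. all: by end_near. Qed.

Let Lc_small (e : R) : 0 < e -> exists n0, forall n, (n0 <= n)%N -> L n * c n < e.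
Proof.
move=> e0; have [N hN] := half_pow_small e0; exists N => n Nn.
apply: le_lt_trans (hN n Nn).
have L1 := bilip_ge1 (bilipPhi n).
rewrite /c ler_pdivrMr// exprVn mulrC ler_pdivlMr ?exprn_gt0//.
apply: (@le_trans _ _ (L n * 2 ^+ (n + 6))).
  by rewrite ler_pM2l; [rewrite ler_weXn2l ?leq_addr//; lra|lra].
apply: le_trans (L_small n) _.
rewrite -[X in _ <= X]powRr1// ler_powR//; first by rewrite ler1n.
by have /andP[] := w_bounds n.
Qed.

(** Replacing G by F n costs 2 * c n, which Phi n amplifies by at most [L n]; the growth of q makes
    L n * c n tend to 0. *)
Lemma limit_conj (G : R -> R) : (forall n x, `|G x - F n x| <= 2 * c n) ->
  forall x, P (G x) = P x + tau.
Proof.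
move=> hG x; apply: limit_eq => e e0; have e8 : 0 < e / 8 by lra.
have [n1 h1] := c_small e8; have [n2 h2] := Lc_small e8.
pose n := maxn n1 n2.
have hc := h1 n (leq_maxl _ _); have hL := h2 n (leq_maxr _ _).
have [conjF _] := liftF n.
have -> : P (G x) - (P x + tau) = (P (G x) - Phi n (G x)) - (P x - Phi n x) +
   (Phi n (G x) - Phi n (F n x)) by rewrite conjF; ring.
have hd' : `|Phi n (G x) - Phi n (F n x)| <= L n * `|G x - F n x|.
  have [L1 [phi' [d b _ _ _]]] := bilipPhi n.
  apply: (has_deriv_lip d) => z; have /andP[b1 b2] := b z.
  rewrite ger0_norm//; apply: le_trans b1; rewrite invr_ge0; lra.
have L1 := bilip_ge1 (bilipPhi n).
have := hG n x => hGx.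
have hLL : L n * `|G x - F n x| <= L n * (2 * c n) by rewrite ler_pM2l; lra.
apply: le_trans (ler_normD _ _) _.
have := ler_normB (P (G x) - Phi n (G x)) (P x - Phi n x).
by have := PE n x; have := PE n (G x); lra.
Qed.

(** Stage n + 1 bounds the mass by r l, stage n by 1/q_(n+1), both up to 6 * L n, and interpolation
    yields the exponent theta n. The 6 is 2 for the length of the arc plus 4 for the limit
    errors. *)
Let mass_bound n x r : c n.+1 <= r -> r <= c n ->
  P (x + r) - P (x - r) <= (q n.+1)%:R `^ w n * r `^ theta n.
Proof.
move=> r1 r2; have r0 : 0 < r by exact: lt_le_trans r1.
have L1 := bilip_ge1 (bilipPhi n); have l1 := l_ge1 n.
have xr : x - r <= x + r by lra.
have C6 : 6 * L n <= (q n.+1)%:R `^ w n.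
  apply: le_trans (L_small n); rewrite mulrC ler_pM2l; last lra.
  apply: (@le_trans _ _ (2 ^+ 6)); first by rewrite !exprS expr0; lra.
  by rewrite ler_weXn2l ?leq_addl//; lra.
have m1 : P (x + r) - P (x - r) <= (q n.+1)%:R `^ w n * (r * l n).
  apply: le_trans (limit_modulus n.+1 xr) _; rewrite LS.
  apply: (@le_trans _ _ (6 * L n * (r * l n))); last first.
    by rewrite ler_wpM2r// mulr_ge0; lra.
  have : 4 * c n.+1 <= 4 * r by lra.
  have : 1 <= l n * L n by nra.
  have -> : l n * L n * (x + r - (x - r)) = 2 * (l n * L n) * r by ring.
  have -> : 6 * L n * (r * l n) = 6 * (l n * L n) * r by ring.
  nra.
have m2 : P (x + r) - P (x - r) <= (q n.+1)%:R `^ w n * (q n.+1)%:R^-1.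
  apply: le_trans (limit_modulus n xr) _.
  apply: (@le_trans _ _ (6 * L n * c n)); last by rewrite ler_wpM2r// ltW.
  have -> : x + r - (x - r) = 2 * r by ring.
  by have := c_gt0 n; nra.
have Qw : 0 < (q n.+1)%:R `^ w n by exact: powR_gt0.
apply: (interp_bound Qw r0 (Q_gt0 n.+1) (theta_bounds n) _ m1 m2).
by rewrite /E mulVf//; have /andP[t0 _] := theta_bounds n; rewrite gt_eqF.
Qed.

Let Qw_le n r : 0 < r -> r <= c n -> (q n.+1)%:R `^ w n <= r `^ (- w n).
Proof.
move=> r0 rc; rewrite powRN -[X in X <= _]invrK lef_pV2 ?posrE ?invr_gt0 ?powR_gt0//.
have -> : ((q n.+1)%:R `^ w n)^-1 = c n `^ w n.
  by rewrite /c -powRN -[X in _ = X `^ _]powR_inv1// -powRrM mulN1r.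
have /andP[w0 _] := w_bounds n.
by apply: ge0_ler_powR; rewrite ?nnegrE ?(ltW w0) ?(ltW r0) ?(ltW (c_gt0 n)).
Qed.

Lemma mass_lower s : s < beta -> exists2 d, 0 < d < 1 & forall r, 0 < r < d ->
  forall x, P (x + r) - P (x - r) <= r `^ s.
Proof.
move=> sb; have e0 : 0 < beta - s by lra.
have [n0 hn0] := inv_small e0.
exists (c n0.+1).
  by rewrite c_gt0 /c invf_lt1// ltr1n; exact: q_ge2.
move=> r /andP[r0 rd] x.
have ex : exists n, c n <= r.
  by have [N hN] := c_small r0; exists N; apply/ltW/hN.
(* The least index with c <= r is some n + 1; then r <= c n, and r < c (n0 + 1) forces n >= n0. *)
case: (ex_minnP ex) => -[|n] cn minn.
  have : c n0.+1 <= c 0%N; last lra.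
  elim: n0.+1 => [//|k IH]; apply: le_trans IH.
  by have := c_half k; have := c_gt0 k.+1; lra.
have rn : r <= c n by rewrite leNgt; apply/negP => /ltW /minn; rewrite ltnn.
have n0n : (n0 <= n)%N.
  rewrite leqNgt; apply/negP => nn0.
  have mon k m : c (m + k)%N <= c m.
    elim: k => [|k IH]; first by rewrite addn0.
    by rewrite addnS; apply: le_trans IH; have := c_half (m + k)%N; have := c_gt0 (m + k).+1; lra.
  have := mon (n0.+1 - n.+1)%N n.+1; rewrite subnKC; last lia.
  by lra.
have r1 : 0 < r <= 1.
  by rewrite r0 /=; apply: le_trans rn _; rewrite /c invf_le1// ler1n.
apply: le_trans (mass_bound x cn rn) _.
apply: (@le_trans _ _ (r `^ (- w n) * r `^ theta n)).
  by rewrite ler_wpM2r ?powR_ge0// Qw_le.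
rewrite -powRD; last by apply/implyP => _; rewrite gt_eqF.
apply: le_powR_exp => //.
have := hn0 n n0n; rewrite -/(w n) => wn.
have : beta <= theta n by rewrite /theta le_max lexx.
by lra.
Qed.

(** At r = c n = 1/q_(n+1) the new concentration is not yet visible: the modulus of stage n bounds
    the mass by 6 * L n * r, and 6 * L n <= r^(- w n). *)
Lemma mass_upper s : s < 1 -> forall d, 0 < d -> exists2 r, 0 < r < d &
  forall x, P (x + r) - P (x - r) <= r `^ s.
Proof.
move=> s1 d d0; have e0 : 0 < 1 - s by lra.
have [n1 h1] := inv_small e0; have [n2 h2] := c_small d0.
pose n := maxn n1 n2; exists (c n).
  by rewrite c_gt0 h2// leq_maxr.
move=> x.
have cn1 : 0 < c n <= 1.
  by apply/andP; split; [exact: c_gt0|rewrite /c invf_le1// ler1n].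
have xr : x - c n <= x + c n by have := c_gt0 n; lra.
apply: le_trans (limit_modulus n xr) _.
have L1 := bilip_ge1 (bilipPhi n).
have C6 : 6 * L n <= (q n.+1)%:R `^ w n.
  apply: le_trans (L_small n); rewrite mulrC ler_pM2l; last lra.
  apply: (@le_trans _ _ (2 ^+ 6)); first by rewrite !exprS expr0; lra.
  by rewrite ler_weXn2l ?leq_addl//; lra.
apply: (@le_trans _ _ (6 * L n * c n)).
  have -> : x + c n - (x - c n) = 2 * c n by ring.
  by have := c_gt0 n; nra.
apply: (@le_trans _ _ (c n `^ (- w n) * c n)).
  by rewrite ler_wpM2r ?(ltW (c_gt0 n))//; apply: le_trans C6 _; rewrite Qw_le.
rewrite -[X in _ * X](powRr1 (ltW (c_gt0 n))) -powRD; last by apply/implyP => _; rewrite gt_eqF.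
apply: le_powR_exp => //.
by have := h1 n (leq_maxl _ _); rewrite -/(w n); lra.
Qed.

(** * Intervals on which the limit measure concentrates *)

Section LimitCovers.
Variable Psi : nat -> R -> R.
Hypothesis PsiK : forall n, cancel (Psi n) (Phi n).

(** Half-width of the intervals before [Psi n], in units of 1/q_(n+1). With 2^(n+1) / l, [mob_gap]
    leaves outside at most the fraction 1 / (2 l a) = 2^(-(n+2)); with 1/2 the intervals fill the
    circle. *)
Let a n : R := Num.min 2^-1 (2 ^+ n.+1 / l n).
Let u n j : R := Psi n ((j%:R - a n) / (q n.+1)%:R).
Let v n j : R := Psi n ((j%:R + a n) / (q n.+1)%:R).
(** As q l = q^E, the factor q^(- E) is the length scale 1/(q l) of the concentration, and q^w
    absorbs [L n] and the powers of 2. *)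
Let r n : R := (q n.+1)%:R `^ (w n - E n).

Let a_bounds n : 0 < a n <= 2^-1.
Proof.
have l1 := l_ge1 n; rewrite /a lt_min ge_min lexx andbT.
by rewrite divr_gt0 ?exprn_gt0//; lra.
Qed.

Let al_le n : a n * l n <= 2 ^+ n.+1.
Proof.
have l1 := l_ge1 n; have l0 : 0 < l n by lra.
by rewrite -ler_pdivlMr// /a ge_min lexx orbT.
Qed.

Let mob_a n : 1 - 2 * mob (l n) (a n) <= 2^-1 ^+ n.+2.
Proof.
have h0 := half_pow_gt0 (R := R) n.+2; have l1 := l_ge1 n.
rewrite /a; have [_|h] := leP 2^-1 (2 ^+ n.+1 / l n).
  by rewrite mob_half; lra.
have p0 : 0 < 2 ^+ n.+1 :> R by rewrite exprn_gt0.
apply: le_trans (mob_gap l1 _) _.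
  by rewrite divr_gt0/=; lra.
rewrite (_ : 2 * l n * _ = 2 ^+ n.+2) ?exprVn// [RHS]exprS.
set p := 2 ^+ n.+1; have F1 (x y : R) : y != 0 -> 2 * y * (x / y) = 2 * x.
  by move=> y0; field.
by apply: F1; lra.
Qed.

Let Phi_u n j : Phi n.+1 (u n j) = (j%:R - mob (l n) (a n)) * c n.
Proof.
have Q0 : (q n.+1)%:R != 0 :> R by rewrite gt_eqF.
rewrite PhiS /= /u PsiK /gmob mulrC; congr (_ * _).
rewrite mulrC divfK// addrC.
by have := mob_int (l n) (- a n) j; rewrite -pmulrn => ->; rewrite mobN addrC.
Qed.

Let Phi_v n j : Phi n.+1 (v n j) = (j%:R + mob (l n) (a n)) * c n.
Proof.
have Q0 : (q n.+1)%:R != 0 :> R by rewrite gt_eqF.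
rewrite PhiS /= /v PsiK /gmob mulrC; congr (_ * _).
rewrite mulrC divfK// addrC.
by have := mob_int (l n) (a n) j; rewrite -pmulrn => ->; rewrite addrC.
Qed.

Let c_next n : 4 * c n.+1 <= 2^-1 ^+ n.+4 * c n.
Proof.
have p0 : 0 < 2 ^+ n.+4 :> R by rewrite exprn_gt0.
rewrite exprVn ler_pdivlMl//; apply: le_trans (c_grow n).
have -> : (n + 6 = n.+4 + 2)%N by lia.
by rewrite exprD mulrCA mulrA [4 * _]mulrC (_ : 2 ^+ 2 = 4 :> R)//; ring.
Qed.

(** Under Phi (n+1) the interval has mass 2 * mob a >= 3/4 in units of c n; the limit changes it by
    at most 4 * c (n+1) <= c n / 16, which leaves 1/2. *)
Lemma cover_mass_ge n j : (2 * (q n.+1)%:R)^-1 <= P (v n j) - P (u n j).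
Proof.
have /andP[h1 _] := PE2 n.+1 (v n j); have /andP[_ h2] := PE2 n.+1 (u n j).
rewrite Phi_v in h1; rewrite Phi_u in h2.
have h3 := c_next n; have c0 := c_gt0 n.
have h4 : 2^-1 ^+ n.+2 <= 2^-1 ^+ 2 :> R by apply: half_pow_le; lia.
have h5 : 2^-1 ^+ n.+4 <= 2^-1 ^+ 4 :> R by apply: half_pow_le; lia.
rewrite !exprS expr0 in h4; rewrite !exprS expr0 in h5.
have h6 := mob_a n.
have h7 : 2^-1 ^+ n.+4 * c n <= 16^-1 * c n by rewrite ler_wpM2r//; [lra|rewrite !exprS; lra].
have h8 : 3 / 4 * c n <= 2 * mob (l n) (a n) * c n.
  by rewrite ler_wpM2r//; [lra|move: h4 h6; rewrite !exprS; lra].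
by rewrite invfM -/(c n); lra.
Qed.

Lemma cover_gap_le n j : P (u n j.+1) - P (v n j) <= 2^-1 ^+ n / (q n.+1)%:R.
Proof.
have /andP[h1 _] := PE2 n.+1 (v n j); have /andP[_ h2] := PE2 n.+1 (u n j.+1).
rewrite Phi_v in h1; rewrite Phi_u -natr1 in h2.
have h3 := c_next n; have c0 := c_gt0 n.
have h0 := half_pow_gt0 (R := R) n.
have h8 : (1 - 2 * mob (l n) (a n)) * c n <= 2^-1 ^+ n.+2 * c n by rewrite ler_wpM2r// ltW.
have h9 : 0 < 2^-1 ^+ n * c n by rewrite mulr_gt0.
rewrite -/(c n); move: h3 h8; rewrite !exprS -!mulrA; lra.
Qed.

Lemma cover_radius n : 0 < r n <= 2^-1 ^+ n.
Proof.
rewrite /r powR_gt0//=.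
have Q1 : 1 <= (q n.+1)%:R :> R by rewrite ler1n.
(* As E n >= 1 = (n + 1) * w n, the exponent w n - E n is at most - n * w n, and q^(w n) >= 2. *)
apply: (@le_trans _ _ ((q n.+1)%:R `^ (- (w n * n%:R)))).
  rewrite ler_powR//; have := E_ge1 n.
  have : w n * n.+1%:R = 1 by rewrite /w mulVf.
  by rewrite -natr1; lra.
rewrite powRN powRrM powR_mulrn ?powR_ge0// exprVn lef_pV2 ?posrE ?exprn_gt0 ?powR_gt0//.
apply: lerXn2r; rewrite ?nnegrE ?powR_ge0//.
apply: le_trans (L_small n).
have L1 := bilip_ge1 (bilipPhi n).
apply: (@le_trans _ _ (1 * 2 ^+ (n + 6))); last by rewrite ler_wpM2r// exprn_ge0.
by rewrite mul1r -[X in X <= _]expr1 ler_weXn2l//; [lra|lia].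
Qed.

(** [Psi n] stretches by at most [L n]; with a l <= 2^(n+1) the length is at most L n * 2^(n+2) / (q
    l), strictly below q^w / (q l) = r n. *)
Lemma cover_length n j : u n j <= v n j < u n j + r n.
Proof.
have /andP[a0 _] := a_bounds n; have c0 := c_gt0 n; have l1 := l_ge1 n.
have e : Phi n (v n j) - Phi n (u n j) = 2 * a n * c n.
  by rewrite /v /u !PsiK /c; ring.
have uv : u n j <= v n j.
  rewrite -(bilip_mono (bilipPhi n)) -subr_ge0 e; apply: mulr_ge0; lra.
rewrite uv /= -ltrBlDl.
have L1 := bilip_ge1 (bilipPhi n); have L0 : 0 < L n by lra.
have /andP[h _] := bilip_ge (bilipPhi n) uv.
rewrite e ler_pdivrMl// in h; apply: le_lt_trans h _.
have Q0 := Q_gt0 n.+1; have l0 : 0 < l n by lra.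
have -> : r n = (q n.+1)%:R `^ w n * (l n)^-1 * c n.
  rewrite /r /l /c -powRN -[X in _ * X]powR_inv1 ?(ltW Q0)//.
  rewrite -!powRD; try by apply/implyP => _; rewrite gt_eqF.
  by congr (_ `^ _); ring.
rewrite mulrA ltr_pM2r// ltr_pdivlMr//.
apply: lt_le_trans (L_small n).
apply: (@le_lt_trans _ _ (L n * (2 * 2 ^+ n.+1))).
  by rewrite -!mulrA ler_pM2l// ler_pM2l// al_le.
by rewrite -exprS (ltr_pM2l L0) ltr_eXn2l ?ltr1n// -[n.+2]addn2 ltn_add2l.
Qed.

Lemma cover_next n j : v n j <= u n j.+1 <= v n j + 1.
Proof.
have /andP[a0 a1] := a_bounds n; have c0 := c_gt0 n.
have c1 : c n <= 1 by rewrite /c invf_le1// ler1n.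
have mono := bilip_mono (bilipPhi n).
rewrite -[X in X && _]mono -[X in _ && X]mono (bilip_shift (bilipPhi n)) /u /v !PsiK -natr1.
rewrite -/(c n).
by apply/andP; split; nra.
Qed.

Lemma cover_first n : u n 0%N <= 0.
Proof.
have /andP[a0 a1] := a_bounds n; have c0 := c_gt0 n.
rewrite -(bilip_mono (bilipPhi n)) (bilip0 (bilipPhi n)) /u PsiK -/(c n) sub0r mulNr oppr_le0.
by rewrite mulr_ge0// ltW.
Qed.

Lemma cover_last n : 1 <= v n (q n.+1).
Proof.
have /andP[a0 a1] := a_bounds n; have Q0 := Q_gt0 n.+1.
rewrite -(bilip_mono (bilipPhi n)) -[1]add0r (bilip_shift (bilipPhi n)) (bilip0 (bilipPhi n)).
by rewrite add0r /v PsiK ler_pdivlMr// mul1r lerDl ltW.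
Qed.

Lemma cover_dim s : beta < s -> exists n0, forall n, (n0 <= n)%N ->
  (q n.+1).+1%:R * r n `^ s <= 2^-1 ^+ n.
Proof.
move=> sb; have /andP[b0 b1] := beta01.
(* The choice (s + 2) * w n <= s - beta gives (s + 1) * w n <= s - theta n in both cases of the
   maximum. *)
have d0 : 0 < (s - beta) / (s + 2) by rewrite divr_gt0; lra.
have [n0 hn0] := inv_small d0; exists n0 => n n0n.
have := hn0 n n0n; rewrite -/(w n) ler_pdivlMr; last lra.
move=> hw; have /andP[w0 w1] := w_bounds n; have /andP[t0 t1] := theta_bounds n.
have tE : theta n * E n = 1 by rewrite /E mulfV// gt_eqF.
have st : (s + 1) * w n <= s - theta n.
  by rewrite /theta; have [_|_] := leP beta (w n); lra.
(* In q (r n)^s the exponent of q is 1 - s (E n - w n). Multiplied by theta n, with theta n * E n =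
   1, the claim that it is at most - (w n)^2 reduces to the margin; [q_big] then turns it into a
   factor 2^(-(n+1)). *)
have kappa : w n * w n <= s * (E n - w n) - 1.
  rewrite -subr_ge0 -(pmulr_rge0 _ t0).
  have -> : theta n * (s * (E n - w n) - 1 - w n * w n) =
    s * (theta n * E n) - s * (theta n * w n) - theta n - theta n * w n * w n by ring.
  rewrite tE mulr1.
  have h1 : theta n * w n <= w n by nra.
  have h2 : theta n * w n * w n <= w n by nra.
  have h3 : s * (theta n * w n) <= s * w n by rewrite ler_wpM2l//; lra.
  lra.
have Q0 := Q_gt0 n.+1.
have Q1 : 1 <= (q n.+1)%:R :> R by rewrite ler1n.
apply: (@le_trans _ _ (2 * ((q n.+1)%:R * r n `^ s))).
  by rewrite mulrA -natr1 ler_wpM2r ?powR_ge0//; lra.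
have -> : (q n.+1)%:R * r n `^ s = (q n.+1)%:R `^ (1 + (w n - E n) * s).
  rewrite /r -powRrM -[X in X * _](powRr1 (ltW Q0)) -powRD//.
  by apply/implyP => _; rewrite gt_eqF.
apply: (@le_trans _ _ (2 * (q n.+1)%:R `^ (- (w n * w n)))).
  rewrite ler_pM2l// ler_powR//; lra.
rewrite powRN.
have h := q_big n; have p0 : 0 < 2 ^+ n.+1 :> R by rewrite exprn_gt0.
apply: (@le_trans _ _ (2 * (2 ^+ n.+1)^-1)).
  by rewrite ler_pM2l// lef_pV2 ?posrE ?powR_gt0.
by rewrite exprS invfM mulrA mulfV// mul1r exprVn.
Qed.

End LimitCovers.

End LimitCdf.

Let F_shift n x : F n (x + 1) = F n x + 1.
Proof.
have [cF _] := liftF n.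
apply: (inc_inj (bilip_mono (bilipPhi n))).
by rewrite cF !(bilip_shift (bilipPhi n)) cF; ring.
Qed.

Let F0 : F 0%N = (fun x => x + tau). Proof. by case: init. Qed.

Lemma limit_diffeo : exists G, [/\ smooth G, forall x, 2^-1 <= derive1 G x,
  forall x, G (x + 1) = G x + 1 & forall n x, `|G x - F n x| <= 2 * c n].
Proof.
have [||||G sG hG] := @smooth_lim R F c.
- by move=> n; exact: lifted_smooth (liftF n).
- by move=> n; exact: ltW.
- exact: c_half.
- exact: FS.
have GF n x : `|G x - F n x| <= 2 * c n by exact: (hG n 0%N x).
exists G; split => //.
- move=> x; have := hG 0%N 1%N x isT.
  have dF0 : has_deriv (fun x : R => x + tau) (fun=> 1).
    by apply: (has_deriv_eq (has_derivD (@has_deriv_id R) (has_deriv_cst tau))) => y; rewrite addr0.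
  rewrite F0 /derive1n /= (has_deriv_derive1 dF0) ler_norml => /andP[h _].
  (* q 0 = 1 and the factor 2^5 in [q_grow] give q 1 >= 32, so the derivative of G stays within 1/16
     of that of the rotation; stage 0 already controls order 1. *)
  have c0 : c 0%N <= 32^-1.
    rewrite /c lef_pV2 ?posrE// ler_nat; have := q_grow 0%N.
    by case: init => -> _ _ _; rewrite muln1.
  by lra.
- move=> x; apply: limit_eq => e e0; have e4 : 0 < e / 4 by lra.
  have [n hn] := c_small e4; have := hn n (leqnn n).
  have -> : G (x + 1) - (G x + 1) = (G (x + 1) - F n (x + 1)) - (G x - F n x).
    by rewrite F_shift; ring.
  move=> cn; apply: le_trans (ler_normB _ _) _.
  by have := GF n x; have := GF n (x + 1); lra.
Qed.

Lemma ball_bound_cdf (P : R -> R) (mu : probability R R) (s r : R) :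
  (forall t : R, 0 <= t <= 1 -> mu `[0, t[%classic = (P t)%:E) ->
  (forall x, P (x + 1) = P x + 1) -> 0 < r <= 2^-1 ->
  (forall x, P (x + r) - P (x - r) <= r `^ s) -> ball_bound mu s r.
Proof.
move=> muE P1 /andP[r0 r1] h x.
have hx : x - r <= x + r <= x - r + 1 by lra.
have [mA muA] := carc_mass muE P1 hx.
apply: (@le_trans _ _ (mu (carc (x - r) (x + r)))).
  by apply: le_measure; rewrite ?inE; [exact: measurable_cball|exact: mA|exact: cball_carc].
by rewrite muA lee_fin.
Qed.

Lemma limit_theorem : exists G : R -> R,
    smooth_lift G /\ rotation_number_is G tau /\
    exists mu : probability R R,
      circle_prob mu /\ circ_invariant G mu /\
      (forall nu : probability R R, circle_prob nu -> circ_invariant G nu ->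
         forall A : set R, measurable A -> nu A = mu A) /\
      {ae (mu : set R -> \bar R), forall x, lower_local_dim mu x = beta%:E /\
                        upper_local_dim mu x = 1%:E} /\
      hausdorff_dim_meas mu = beta%:E /\
      lower_box_dim_meas mu = beta%:E /\
      upper_box_dim_meas mu = 1%:E.
Proof.
have [P PE] := limit_cdf.
have [G [sG dG G1 GF]] := limit_diffeo.
have Pnd := limit_nd PE; have P1 := limit_shift PE; have P0 := limit0 PE.
have Pc := limit_continuous PE; have PG := limit_conj PE GF.
have P11 : P 1 = 1 by rewrite -[1 in LHS]add0r P1 P0 add0r.
have hG : has_deriv G (derive1 G) by exact: derivable_hd (sG 0%N).
have h20 : 0 < 2^-1 :> R by lra.
have [Gi [_ GiK]] := has_deriv_bij hG h20 dG.
have Gmono : {mono G : x y / x <= y}.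
  apply: le_mono => x y xy; have [z _ e] := has_deriv_MVT hG (ltW xy).
  have d0 : 0 < y - x by lra.
  by rewrite -subr_gt0 e mulr_gt0//; have := dG z; lra.
exists G; split; first by split => //; split => // x; have := dG x; lra.
split; first exact: rotation_lift Pnd P1 P0 PG.
have [mu muE] := circle_measure Pnd Pc P0 P11.
have mu1 : circle_prob mu by rewrite /circle_prob circleE muE ?P11// ler01 lexx.
exists mu; split => //; split; first exact: cdf_invariant P1 P0 Gmono G1 GiK PG _ mu1 muE.
split.
  move=> nu nu1 inu; apply: circle_prob_unique => // t ht.
  rewrite muE// circle_cdfE//; congr (_%:E).
  exact: (cdf_unique Pnd P1 P0 Gmono G1 PG tauL nu1 inu).
have [Psi PsiK] : {Psi : nat -> R -> R & forall n, cancel (Psi n) (Phi n)}.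
  by apply: (choice (P := fun n psi => cancel psi (Phi n))) => n; exact: bilip_inv.
have bA : forall s, s < beta -> exists2 d, 0 < d < 1 &
    forall r, 0 < r < d -> ball_bound mu s r.
  move=> s /(mass_lower PE)[d d01 hd']; exists (Num.min d 2^-1).
    by rewrite lt_min gt_min; lra.
  move=> r; rewrite lt_min => /and3P[r0 rd r2].
  by apply: ball_bound_cdf muE P1 _ _; [lra|apply: hd'; lra].
have bB : forall s, s < 1 -> forall d, 0 < d ->
    exists2 r, 0 < r < d & ball_bound mu s r.
  move=> s s1 d d0.
  have d2 : 0 < Num.min d 2^-1 by rewrite lt_min d0; lra.
  have [r /andP[r0]] := mass_upper PE s1 d2; rewrite lt_min => /andP[rd r2] h.
  by exists r; [lra|apply: ball_bound_cdf muE P1 _ h; lra].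
(* Row n of the concentration sets lives at the denominator q (n + 1), so indices shift by one. *)
have q1 n : (0 < q n.+1)%N by [].
have cr n := cover_radius n.
have cl n j (_ : (j <= q n.+1)%N)   := cover_length PsiK n j.
have cn n j (_ : (j < q n.+1)%N) := conj (cover_next PsiK n j) (cover_gap_le PE PsiK n j).
have cm n j (_ : (j <= q n.+1)%N) := cover_mass_ge PE PsiK n j.
have cf := cover_first PsiK; have cla := cover_last PsiK; have cd := cover_dim.
split; first exact: (ae_local_dim mu1 muE P1 q1 cr cl cn cm cf cla cd bA bB).
split; first exact: (hausdorff_dim_measE mu1 muE P1 q1 cr cl cn cf cla cd beta01 bA).
split; first exact: (lower_box_dim_measE mu1 muE P1 q1 cr cl cn cf cla cd beta01 bA).
exact: (upper_box_dim_measE mu1 bB).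
Qed.

End Limit.

Theorem theorem1p5 (R : realType) (tau beta : R) :
  liouville tau -> 0 <= beta <= 1 ->
  exists F : R -> R,
    smooth_lift F /\ rotation_number_is F tau /\
    exists mu : probability R R,
      circle_prob mu /\ circ_invariant F mu /\
      (forall nu : probability R R, circle_prob nu -> circ_invariant F nu ->
         forall A : set R, measurable A -> nu A = mu A) /\
      {ae (mu : set R -> \bar R), forall x, lower_local_dim mu x = beta%:E /\
                        upper_local_dim mu x = 1%:E} /\
      hausdorff_dim_meas mu = beta%:E /\
      lower_box_dim_meas mu = beta%:E /\
      upper_box_dim_meas mu = 1%:E.
Proof.
move=> tauL beta01.
pose E n : R := (Num.max beta n.+1%:R^-1)^-1.
(* One summand per growth condition: the power n + 1 in the second is undone by w n = 1/(n + 1), and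
   the third works because (n + 1)^3 (w n)^2 = n + 1. *)
pose Q0 n q (L : R) := (2 ^ (n + 5) * q + Num.bound `|(L * 2 ^+ (n + 6)) ^+ n.+1| +
  2 ^ (n.+1 ^ 3))%N.
have E1 n : 1 <= E n.
  have /andP[b0 b1] := beta01.
  rewrite /E invf_ge1; first by rewrite ge_max b1 invf_le1 ?ler1n.
  by rewrite lt_max invr_gt0 ltr0n orbT.
have [q [L [Phi [F [init gl Qq S FS]]]]] := conjugation_sequence Q0 tauL E1.
have q2 n : (2 <= q n.+1)%N by have [] := Qq n.
have L1 n : 1 <= L n by have [/bilip_ge1] := gl n.
apply: (@limit_theorem R tau beta tauL beta01 q L Phi F) => //.
- by move=> n; have [] := gl n.
- by move=> n; have [] := gl n.
- by move=> n; have [h _] := Qq n; apply: leq_trans (ltnW h); rewrite /Q0 -addnA leq_addr.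
- move=> n; have [h _] := Qq n.
  set x := L n * _.
  have x0 : 0 <= x by rewrite mulr_ge0 ?exprn_ge0//; have := L1 n; lra.
  have -> : x = (x ^+ n.+1) `^ n.+1%:R^-1.
    by rewrite -powR_mulrn// -powRrM mulfV ?powRr1.
  apply: ge0_ler_powR; rewrite ?nnegrE ?invr_ge0 ?exprn_ge0//.
  apply: le_trans (ler_norm _) _; apply/ltW.
  apply: lt_le_trans (archi_boundP (normr_ge0 _)) _.
  by rewrite ler_nat; apply: leq_trans (ltnW h); rewrite /Q0 -/x -addnA addnCA leq_addr.
- move=> n; have [h _] := Qq n.
  set w := _^-1; have w0 : 0 <= w by rewrite invr_ge0.
  have wn : n.+1%:R * w = 1 :> R by rewrite /w mulfV.
  have hq : (2 : R) ^+ (n.+1 ^ 3) <= (q n.+1)%:R.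
    by rewrite -natrX ler_nat; apply: leq_trans (ltnW h); rewrite /Q0 leq_addl.
  apply: (@le_trans _ _ ((2 ^+ (n.+1 ^ 3)) `^ (w * w))); last first.
    by apply: ge0_ler_powR; rewrite ?nnegrE ?mulr_ge0 ?exprn_ge0.
  rewrite -[X in X <= _]powR_mulrn// -[X in _ <= X `^ _]powR_mulrn// -powRrM !expnS expn0 muln1 !natrM.
  rewrite (_ : _ * (w * w) = n.+1%:R * (n.+1%:R * w) * (n.+1%:R * w)); last by ring.
  by rewrite wn !mulr1.
- by move=> n; have [] := S n.
- by move=> n; have [] := S n.
Qed.
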